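(* Let $D\subset\mathbb{C}^n$ be a bounded $\alpha$-regular domain, let $K\subset D$ be a compact set and let $\psi\in C(K)$ with $\psi<0$ on $K$, such that $\psi$ admits a negative $\alpha$-subharmonic extension to $D$ (some $\widetilde\psi\in\alpha\text{-}sh(D)$ with $\widetilde\psi<0$ on $D$ and $\widetilde\psi|_K=\psi$). Then: (1) a point $z_0\in K$ is locally $(\alpha,\psi)$-regular if and only if it is locally $\alpha$-regular, i.e. for every neighborhood $B\subset D$ of $z_0$ one has $\omega^*_\alpha(z_0,K\cap\overline B,D)=-1$; (2) if moreover $\psi$ admits an extension $\widetilde\psi$ which is strictly $\alpha$-subharmonic in a neighborhood $D^+$ of $\overline D$ and satisfies $\widetilde\psi|_K=\psi|_K$ and $\widetilde\psi<0$ on $D$, then a point $z_0\in K$ is locally $(\alpha,\psi)$-regular if and only if it is $(\alpha,\psi)$-regular.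
   Context: Fix a closed, strictly positive differential form $\alpha$ of bidegree $(n-1,n-1)$ on an open subset of $\mathbb{C}^n$ containing all sets considered, with $C^1$ coefficients. Let $d=\partial+\bar\partial$, $d^c=(\bar\partial-\partial)/(4i)$. For an open set $\Omega$, $u\in L^1_{loc}(\Omega)$ is $\alpha$-subharmonic ($u\in\alpha\text{-}sh(\Omega)$) if it is strongly upper semicontinuous (upper semicontinuous, and for every $z^0\in\Omega$ and every set $A$ of full Lebesgue measure near $z^0$, $\limsup_{z\to z^0,z\in A}u(z)=u(z^0)$) and $\int u\,\alpha\wedge dd^c\omega\ge0$ for every nonnegative test function $\omega$; $u\equiv-\infty$ is also allowed. $u$ is strictly $\alpha$-subharmonic in $\Omega$ if for every relatively compact subdomain $G\Subset\Omega$ there is $\varepsilon>0$ with $u-\varepsilon|z|^2\in\alpha\text{-}sh(G)$. A bounded domain $D$ is $\alpha$-regular if there is $\rho\in\alpha\text{-}sh(D)$ with $\rho<0$ on $D$ and $\rho\to0$ at $\partial D$. For $E\subset D$ and bounded $\psi$ on $E$ with $\sup_E\psi<0$, $\mathcal U(E,D,\psi)$ is the class of $u\in\alpha\text{-}sh(D)$ with $u<0$ on $D$, $u\le\psi$ on $E$; $\omega_\alpha(z,E,D,\psi)=\sup\{u(z):u\in\mathcal U(E,D,\psi)\}$, $\omega^*_\alpha(z,E,D,\psi)=\limsup_{w\to z}\omega_\alpha(w,E,D,\psi)$; for $\psi\equiv-1$ write $\omega^*_\alpha(z,E,D)$. A point $z_0\in K$ is $(\alpha,\psi)$-regular if $\omega^*_\alpha(z_0,K,D,\psi)=\psi(z_0)$,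 and locally $(\alpha,\psi)$-regular if $\omega^*_\alpha(z_0,K\cap\overline B,D,\psi)=\psi(z_0)$ for every neighborhood $B\subset\mathbb{C}^n$ of $z_0$. *)

(* Defs.v *)
(* C^n is identified with R^(2n),
   realised as the row space 'rV[R]_(n + n): real coordinate (lshift n j)
   is Re z_j and (rshift n j) is Im z_j. *)
From mathcomp Require Import all_boot all_order all_algebra.
From mathcomp Require Import all_classical all_reals all_analysis.

Set Implicit Arguments.
Unset Strict Implicit.
Unset Printing Implicit Defensive.

Import Order.TTheory GRing.Theory Num.Theory.
Import numFieldNormedType.Exports.

Local Open Scope classical_set_scope.
Local Open Scope ring_scope.

Section Defs.
Variables (R : realType) (n : nat).

Definition Cn := 'rV[R]_(n + n).

Definition xc (j : 'I_n) : 'I_(n + n) := lshift n j.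
Definition yc (j : 'I_n) : 'I_(n + n) := rshift n j.

Definition ev (i : 'I_(n + n)) : Cn := delta_mx 0 i.

Fixpoint dpath (s : seq 'I_(n + n)) (f : Cn -> R) : Cn -> R :=
  match s with
  | [::] => f
  | i :: s' => 'D_(ev i) (dpath s' f)
  end.

Definition d2 (f : Cn -> R) (i l : 'I_(n + n)) : Cn -> R :=
  'D_(ev i) ('D_(ev l) f).

Definition smooth (f : Cn -> R) : Prop :=
  forall (s : seq 'I_(n + n)) (x : Cn), differentiable (dpath s f) x.

Definition C1_on (G : set Cn) (f : Cn -> R) : Prop :=
  (forall x, G x -> differentiable f x) /\
  (forall i : 'I_(n + n), {within G, continuous ('D_(ev i) f)}).

(* A (n-1,n-1)-form alpha is encoded by the Hermitian matrix of functions
   a_{jk} = b_{jk} + i c_{jk} (b symmetric, c antisymmetric) such that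
   alpha /\ dd^c w = (positive constant) * (L w) dV  with
   L w = Re sum_{j,k} a_{jk} d^2 w/(dz_j dzbar_k)   (up to the factor 1/4). *)
Definition Lop (b c : 'I_n -> 'I_n -> Cn -> R) (w : Cn -> R) (x : Cn) : R :=
  \sum_(j < n) \sum_(k < n)
     (b j k x * (d2 w (xc j) (xc k) x + d2 w (yc j) (yc k) x)
      - c j k x * (d2 w (xc j) (yc k) x - d2 w (yc j) (xc k) x)).

Definition closed_strictly_positive_form (G : set Cn)
    (b c : 'I_n -> 'I_n -> Cn -> R) : Prop :=
  [/\ open G,
      (forall j k, C1_on G (b j k) /\ C1_on G (c j k)),
      (forall j k x, G x -> b j k x = b k j x /\ c j k x = - c k j x),
      (* strictly positive: the Hermitian matrix is positive definite *)
      (forall x, G x -> forall p q : 'I_n -> R, (exists j, p j != 0 \/ q j != 0) ->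
         0 < \sum_(j < n) \sum_(k < n)
               (b j k x * (p j * p k + q j * q k) - c j k x * (p j * q k - q j * p k)))
    & (* closed: sum_j d a_{jk} / dz_j = 0 for every k (real and imaginary parts) *)
      (forall x, G x -> forall k,
         \sum_(j < n) ('D_(ev (xc j)) (b j k) x + 'D_(ev (yc j)) (c j k) x) = 0 /\
         \sum_(j < n) ('D_(ev (xc j)) (c j k) x - 'D_(ev (yc j)) (b j k) x) = 0)].

Definition setc (x : Cn) (k : nat) (t : R) : Cn :=
  \row_j (if (j : nat) == k then t else x ord0 j).

Local Open Scope ereal_scope.

Fixpoint iint (k : nat) (f : Cn -> \bar R) (x : Cn) : \bar R :=
  match k with
  | 0 => f x
  | k'.+1 => \int[lebesgue_measure]_t (iint k' f (setc x k' t))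
  end.

(* Lebesgue integral over R^(2n) (= C^n), for Borel functions via Tonelli/Fubini *)
Definition integral (f : Cn -> \bar R) : \bar R := iint (n + n) f 0%R.

Definition borel (A : set Cn) : Prop :=
  smallest (sigma_algebra setT) [set B | open B] A.

Definition null_set (S : set Cn) : Prop :=
  exists N, [/\ borel N, S `<=` N & integral (fun x => (\1_N x)%:E) = 0].

Definition full_near (A : set Cn) (z0 : Cn) : Prop :=
  exists2 r : R, (0 < r)%R & null_set [set z | (`|z - z0| < r)%R /\ ~ A z].

Definition L1loc (Om : set Cn) (u : Cn -> \bar R) : Prop :=
  forall K, compact K -> K `<=` Om ->
    integral (fun x => (\1_K x)%:E * `|u x|) < +oo.

Definition strongly_usc (Om : set Cn) (u : Cn -> \bar R) : Prop :=
  [/\ (forall z0, Om z0 -> u z0 < +oo),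
      (forall z0, Om z0 -> forall c : R, u z0 < c%:E ->
          \forall z \near z0, u z < c%:E)
    & (forall z0 (A : set Cn), Om z0 -> full_near A z0 ->
          forall c : R, c%:E < u z0 -> forall r : R, (0 < r)%R ->
            exists z, [/\ A z, (`|z - z0| < r)%R & c%:E < u z])].

Definition test_fn (Om : set Cn) (w : Cn -> R) : Prop :=
  [/\ smooth w,
      (forall x, (0 <= w x)%R)
    & exists K, [/\ compact K, K `<=` Om & forall x, ~ K x -> w x = 0%R]].

Definition ash (b c : 'I_n -> 'I_n -> Cn -> R) (Om : set Cn) (u : Cn -> \bar R)
  : Prop :=
  (forall z, Om z -> u z = -oo) \/
  [/\ L1loc Om u, strongly_usc Om u &
      forall w, test_fn Om w ->
        0 <= integral (fun x => u x * (Lop b c w x)%:E)].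

Definition sqnorm (z : Cn) : R := (\sum_(i < n + n) (z ord0 i) ^+ 2)%R.

Definition domain (D : set Cn) : Prop := [/\ open D, connected D & D !=set0].

Definition bounded_set (D : set Cn) : Prop :=
  exists M : R, forall z, D z -> (`|z| <= M)%R.

Definition strictly_ash (b c : 'I_n -> 'I_n -> Cn -> R) (Om : set Cn)
    (u : Cn -> \bar R) : Prop :=
  forall G', domain G' -> compact (closure G') -> closure G' `<=` Om ->
    exists2 eps : R, (0 < eps)%R &
      ash b c G' (fun z => u z - (eps * sqnorm z)%:E).

Definition alpha_regular (b c : 'I_n -> 'I_n -> Cn -> R) (D : set Cn) : Prop :=
  bounded_set D /\ domain D /\
  exists rho : Cn -> \bar R,
    [/\ ash b c D rho,
        (forall z, D z -> rho z < 0)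
      & forall xi, closure D xi -> ~ D xi ->
          forall e : R, (0 < e)%R -> exists2 d : R, (0 < d)%R &
            forall z, D z -> (`|z - xi| < d)%R -> - e%:E < rho z].

Definition Uclass (b c : 'I_n -> 'I_n -> Cn -> R) (E D : set Cn) (psi : Cn -> R)
  : set (Cn -> \bar R) :=
  [set u | [/\ ash b c D u, (forall z, D z -> u z < 0) &
                (forall z, E z -> u z <= (psi z)%:E)]].

Definition omega (b c : 'I_n -> 'I_n -> Cn -> R) (E D : set Cn) (psi : Cn -> R)
    (z : Cn) : \bar R :=
  ereal_sup [set u z | u in Uclass b c E D psi].

Definition omega_star (b c : 'I_n -> 'I_n -> Cn -> R) (E D : set Cn)
    (psi : Cn -> R) (z : Cn) : \bar R :=
  ereal_inf [set ereal_sup [set omega b c E D psi w |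
                             w in [set w | D w /\ (`|w - z| < r)%R]]
            | r in [set r : R | (0 < r)%R]].

Definition regular_pt b c (K D : set Cn) (psi : Cn -> R) (z0 : Cn) : Prop :=
  omega_star b c K D psi z0 = (psi z0)%:E.

Definition loc_regular_pt b c (K D : set Cn) (psi : Cn -> R) (z0 : Cn) : Prop :=
  forall B : set Cn, nbhs z0 B ->
    omega_star b c (K `&` closure B) D psi z0 = (psi z0)%:E.

End Defs.

(* Main.v *)
(* In the real coordinates of C^n = R^N, N = 2n, the operator of alpha is
   L = sum A_il d_i d_l with A symmetric, positive definite, C^1 and with
   divergence-free rows, so that L kills affine functions in the weak sense.

   Part (1) is the scaling u -> u / |psi(z0)| on a small ball, where psi is almost constant.

   Part (2), local from global: phi = psit - eps |z - z0|^2 is alpha-subharmonic on D, and for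
   u <= psi on K cap B the combination v = (1 - d) phi + d u with d small satisfies v <= psi on
   all of K, because d |psi| <= (1 - d) eps |z - z0|^2 off B.  This requires that a sum of
   alpha-subharmonic functions be strongly upper semicontinuous, and that the bound for the
   upper regularisation of v at z0 yield one for that of u, although phi is only upper
   semicontinuous.  Both follow from a weak Harnack inequality: if u <= M on B(z0, r) and
   |w - z0| < theta r, the integral of M - u over B(z0, theta r) is at most
   C r^N (M - u(w)).

   Proof of the weak Harnack inequality: composing a quadratic form frozen at p with a smoothed
   and cut off fundamental solution t^(-n) gives a smooth compactly supported W >= 0 with
   L W >= a r^(-N) 1_{B(z0, theta r)} - e sigma^(-N) 1_{B(p, sigma)}; testing u against W bounds
   the integral of M - u over B(z0, theta r) by C (r / sigma)^N times its integral over
   B(p, sigma).  Summing over a maximal 2 sigma-separated set of points p in the superlevel set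
   {u >= u(w) - eta} near w, which has positive measure by strong upper semicontinuity, and
   letting sigma tend to 0 replaces the small balls by that set, on which M - u is small. *)
Require Import Defs.
From HB Require Import structures.
From mathcomp Require Import all_boot all_order all_algebra.
From mathcomp Require Import all_classical all_reals all_analysis.
From mathcomp Require Import measurable_realfun ring lra.
Import Order.TTheory GRing.Theory Num.Theory.
Import numFieldNormedType.Exports.
Local Open Scope classical_set_scope.
Local Open Scope ring_scope.
Set Implicit Arguments.
Unset Strict Implicit.
Unset Printing Implicit Defensive.

(** * Lebesgue measure on C^n *)

(** The coefficients are merely C^1 and [u] is merely locally integrable and strongly upper
    semicontinuous, so mean value formulas and regularisation by convolution are not at hand: [u] is
    only tested against smooth compactly supported [W]. As the integral of [L W] vanishes, [L W]
    must be negative somewhere; this is confined to one small ball B(p, sigma), with the weight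
    sigma^(-N) of a mass of order one.

    A single centre p does not reach the value [u w], since it is not known beforehand that averages
    over B(p, sigma) approach [u p]. Many disjoint balls avoid differentiation of integrals: they
    add up to an integral over a thin neighbourhood of a closed superlevel set, whose volume, being
    positive, cancels from the estimate.

    For sums, the deficits of u and v below their local upper bounds are both small on average in a
    small ball, so u + v cannot stay below a number smaller than u(z0) + v(z0) almost everywhere. *)

Definition bCn (R : realType) (n : nat) := g_sigma_algebraType (@open (Cn R n)).

(** * The maximum norm, whose balls are cubes, and Borel maps into C^n *)

Section Coordinates.
Variables (R : realType) (n : nat).
Local Notation V := (Cn R n).

Lemma coord_le_norm (x : V) i : `|x ord0 i| <= `|x|.
Proof.
rewrite [leRHS]/Num.Def.normr/= mx_normrE.
by apply: (le_trans _ (le_bigmax _ _ (ord0, i))).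
Qed.

Lemma norm_ltP (x : V) (r : R) : 0 < r ->
  (`|x| < r) <-> (forall i, `|x ord0 i| < r).
Proof.
move=> r0; split => [xr i|xr]; first exact: le_lt_trans (coord_le_norm _ _) xr.
rewrite [ltLHS]/Num.Def.normr/= mx_normrE; apply/bigmax_ltP; split => // -[j i] _ /=.
by rewrite (ord1 j).
Qed.

Lemma norm_leP (x : V) (r : R) : 0 <= r ->
  (`|x| <= r) <-> (forall i, `|x ord0 i| <= r).
Proof.
move=> r0; split => [xr i|xr]; first exact: le_trans (coord_le_norm _ _) xr.
rewrite [leLHS]/Num.Def.normr/= mx_normrE; apply/bigmax_leP; split => // -[j i] _ /=.
by rewrite (ord1 j).
Qed.

Lemma ball_CnE (x : V) (r : R) : ball x r = [set y | `|y - x| < r].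
Proof.
by rewrite mx_norm_ball; apply/seteqP; split => y; rewrite /ball_ /= distrC.
Qed.

Lemma open_measurable_bCn (U : set V) : open U -> measurable (U : set (bCn R n)).
Proof. exact: sub_sigma_algebra. Qed.

Lemma closed_measurable_bCn (U : set V) : closed U -> measurable (U : set (bCn R n)).
Proof.
by move=> cU; rewrite -[U]setCK; apply: measurableC; apply: open_measurable_bCn; exact: closed_openC.
Qed.

(* Second countability: the balls with rational centre and radius 1/(m+1). *)
Lemma open_rational_balls (U : set V) : open U ->
  U = \bigcup_(p in [set p : 'rV[rat]_(n + n) * nat |
       ball (map_mx ratr p.1 : V) p.2.+1%:R^-1 `<=` U])
      ball (map_mx ratr p.1 : V) p.2.+1%:R^-1.
Proof.
move=> oU; apply/seteqP; split => [x Ux|x [p /= + xp]]; last exact.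
have /nbhs_ballP[e /= e0 eU] : nbhs x U by exact: open_nbhs_nbhs.
have [m me] : exists m : nat, m.+1%:R^-1 < e / 2.
  exists (Num.truncn (e / 2)^-1); rewrite -[ltRHS]invrK ltf_pV2 ?posrE ?invr_gt0 ?divr_gt0//.
  exact: truncnS_gt.
have m0 : 0 < m.+1%:R^-1 :> R by rewrite invr_gt0.
have /choice[q xq] : forall i, exists q : rat, `|x ord0 i - ratr q| < m.+1%:R^-1 :> R.
  move=> i.
  have [y [/= yb [q _ qy]]] := @dense_rat R (ball (x ord0 i) m.+1%:R^-1)
    (ex_intro _ _ (ballxx _ m0)) (ball_open _ _).
  by exists q; rewrite qy.
have xb : ball (map_mx ratr (\row_i q i) : V) m.+1%:R^-1 x.
  rewrite ball_CnE /=; apply/norm_ltP => // i.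
  by rewrite !mxE.
exists (\row_i q i, m) => //= y; rewrite ball_CnE => /= yb.
apply: eU; rewrite ball_CnE /=; rewrite ball_CnE /= in xb.
have -> : y - x = (y - (map_mx ratr (\row_i q i) : V)) - (x - map_mx ratr (\row_i q i)).
  by rewrite opprB addrA subrK.
apply: (le_lt_trans (ler_normB _ _)).
by rewrite [ltRHS]splitr; apply: ltrD; exact: lt_trans me.
Qed.

(** Every open set is a countable union of rational cubes, and the preimage of a cube is a finite
    intersection of conditions on single coordinates. *)
Lemma measurable_fun_bCn d (S : measurableType d) (f : S -> bCn R n) :
  (forall i, measurable_fun setT (fun s => (f s : V) ord0 i)) ->
  measurable_fun setT f.
Proof.
move=> mf; apply: (measurability (@open V : set (set (bCn R n))) erefl) => _ [U oU <-].
rewrite setTI (open_rational_balls oU) preimage_bigcup.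
rewrite bigcup_mkcond; apply: countable_bigcupT_measurable => // -[q m].
case: ifPn => // _ /=.
have m0 : 0 < m.+1%:R^-1 :> R by rewrite invr_gt0.
rewrite (_ : _ @^-1` _ = \bigcap_(i in [set: 'I_(n + n)])
    ((fun s => (f s : V) ord0 i) @^-1` ball (ratr (q ord0 i) : R) m.+1%:R^-1)); last first.
  apply/seteqP; split => s /=; rewrite ball_CnE /=.
    by move=> /norm_ltP => /(_ m0) fs i _ /=; rewrite /ball/= distrC; have := fs i; rewrite !mxE.
  move=> fs; apply/norm_ltP => // i; rewrite !mxE distrC; exact: fs.
apply: fin_bigcap_measurable => // i _.
rewrite -[X in measurable X]setTI; apply: mf => //.
by apply: open_measurable; exact: ball_open.
Qed.

Lemma continuous_measurable_bCn (f : V -> R) :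
  continuous f -> measurable_fun setT (f : bCn R n -> R).
Proof.
move=> cf; apply: (measurability _ (RGenOpens.measurableE R)).
move=> _ [_ [a [b ->] <-]]; rewrite setTI.
by apply: open_measurable_bCn; move/continuousP : cf; apply; exact: interval_open.
Qed.

Lemma coord_continuousV i : continuous (fun x : V => x ord0 i).
Proof. exact: coord_continuous. Qed.

Lemma measurable_coord i : measurable_fun setT (fun x : bCn R n => (x : V) ord0 i).
Proof. apply: continuous_measurable_bCn; exact: coord_continuousV. Qed.

Lemma measurable_setc k :
  measurable_fun setT (fun p : bCn R n * measurableTypeR R => setc (p.1 : V) k p.2 : bCn R n).
Proof.
apply: measurable_fun_bCn => i.
have [ik|ik] := eqVneq (i : nat) k.
  under eq_fun do rewrite mxE ik eqxx; exact: measurable_snd.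
under eq_fun do rewrite mxE (negbTE ik).
apply: (measurableT_comp (measurable_coord i)); exact: measurable_fst.
Qed.

End Coordinates.

(** * The iterated integral as a measure *)

Section IteratedIntegral.
Variables (R : realType) (n : nat).
Local Notation V := (Cn R n).
Local Notation T := (bCn R n).
Local Open Scope ereal_scope.
Implicit Types (f g : V -> \bar R) (k : nat).

Lemma eq_iint k f g : f =1 g -> iint k f =1 iint k g.
Proof.
by move=> fg; elim: k => [|k IH] x //=; apply: eq_integral => t _; exact: IH.
Qed.

Lemma iint_ge0 k f : (forall x, 0 <= f x) -> forall x, 0 <= iint k f x.
Proof.
move=> f0; elim: k => [|k IH] x //=; by apply: integral_ge0 => t _; exact: IH.
Qed.

Lemma measurable_section f x k : measurable_fun setT (f : T -> \bar R) ->
  measurable_fun setT (fun t : measurableTypeR R => f (setc x k t)).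
Proof.
move=> mf; apply: (measurableT_comp mf).
exact: (measurableT_comp (@measurable_setc R n k) (@pair1_measurable _ _ T (measurableTypeR R) x)).
Qed.

Lemma measurable_iint k f : measurable_fun setT (f : T -> \bar R) ->
  measurable_fun setT (iint k f : T -> \bar R).
Proof.
move=> mf; elim: k => [|k IH] //=.
pose h (p : T * measurableTypeR R) := iint k f (setc (p.1 : V) k p.2).
have mh : measurable_fun setT h by exact: (measurableT_comp IH (@measurable_setc R n k)).
(* Tonelli's theorem gives measurability in the parameter for nonnegative integrands, hence the
   separate treatment of the positive and negative parts. *)
have -> : (fun x => \int[lebesgue_measure]_t iint k f (setc x k t)) =
   (fun x => \int[lebesgue_measure]_t h^\+ (x, t) - \int[lebesgue_measure]_t h^\- (x, t)).
  by apply/funext => x; rewrite integralE; congr (_ - _); apply: eq_integral => t _; rewrite /h ?funeposE ?funenegE.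
apply: emeasurable_funB.
  exact: (measurable_fun_fubini_tonelli_F (h^\+) (measurable_funepos mh)).
exact: (measurable_fun_fubini_tonelli_F (h^\-) (measurable_funeneg mh)).
Qed.

Lemma measurable_iint_section k k' x f : measurable_fun setT (f : T -> \bar R) ->
  measurable_fun setT (fun t : measurableTypeR R => iint k f (setc x k' t)).
Proof. by move=> mf; exact: (measurable_section _ _ (measurable_iint k mf)). Qed.

Lemma ge0_le_iint k f g : measurable_fun setT (f : T -> \bar R) ->
  measurable_fun setT (g : T -> \bar R) -> (forall x, 0 <= f x) ->
  (forall x, f x <= g x) -> forall x, iint k f x <= iint k g x.
Proof.
move=> mf mg f0 fg; elim: k => [|k IH] x //=.
apply: ge0_le_integral => //.
- by move=> t _; apply: iint_ge0.
- exact: measurable_iint_section.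
- exact: measurable_iint_section.
Qed.

Lemma ge0_iint_series k (F : nat -> V -> \bar R) :
  (forall j, measurable_fun setT (F j : T -> \bar R)) ->
  (forall j x, 0 <= F j x) ->
  forall x, iint k (fun x => \sum_(j <oo) F j x) x = \sum_(j <oo) iint k (F j) x.
Proof.
move=> mF F0; elim: k => [|k IH] x //=.
under eq_integral do rewrite IH.
apply: (@integral_nneseries _ _ _ lebesgue_measure setT measurableT (fun j t => iint k (F j) (setc x k t))) => //.
- by move=> j; exact: measurable_iint_section.
- by move=> j t _; apply: iint_ge0.
Qed.

Lemma ge0_iintD k f g : measurable_fun setT (f : T -> \bar R) ->
  measurable_fun setT (g : T -> \bar R) -> (forall x, 0 <= f x) ->
  (forall x, 0 <= g x) -> forall x, iint k (f \+ g) x = iint k f x + iint k g x.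
Proof.
move=> mf mg f0 g0; elim: k => [|k IH] x //=.
under eq_integral do rewrite IH.
apply: ge0_integralD => //.
- by move=> t _; apply: iint_ge0.
- exact: measurable_iint_section.
- by move=> t _; apply: iint_ge0.
- exact: measurable_iint_section.
Qed.

Lemma ge0_iintZl k (r : R) f : measurable_fun setT (f : T -> \bar R) ->
  (0 <= r)%R -> (forall x, 0 <= f x) ->
  forall x, iint k (fun x => r%:E * f x) x = r%:E * iint k f x.
Proof.
move=> mf r0 f0; elim: k => [|k IH] x //=.
under eq_integral do rewrite IH.
apply: ge0_integralZl_EFin => //.
- by move=> t _; apply: iint_ge0.
- exact: measurable_iint_section.
Qed.

Lemma iint0 k (x : V) : iint k (fun _ : V => 0) x = 0 :> \bar R.
Proof. by elim: k x => [|k IH] x //=; under eq_integral do rewrite IH; rewrite integral0. Qed.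

Lemma monotone_iint k (F : nat -> V -> \bar R) :
  (forall j, measurable_fun setT (F j : T -> \bar R)) ->
  (forall j x, 0 <= F j x) -> (forall x, nondecreasing_seq (F ^~ x)) ->
  forall x, iint k (fun x => limn (F ^~ x)) x = limn (fun j => iint k (F j) x).
Proof.
move=> mF F0 ndF; elim: k => [|k IH] x //=.
under eq_integral do rewrite IH.
apply: (@monotone_convergence _ _ _ lebesgue_measure setT measurableT (fun j t => iint k (F j) (setc x k t))) => //.
- by move=> j; exact: measurable_iint_section.
- by move=> j t _; apply: iint_ge0.
- by move=> t _ i j ij; apply: ge0_le_iint => // y; exact: ndF.
Qed.

Definition leb (A : set T) : \bar R := Defs.integral (fun x : V => (\1_A x)%:E).

Lemma measurable_indic_bCn (A : set T) : measurable A ->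
  measurable_fun setT (fun x : T => (\1_A x)%:E : \bar R).
Proof. by move=> mA; apply/measurable_EFinP. Qed.

Let leb0 : leb set0 = 0.
Proof.
rewrite -(iint0 (n + n) (0%R : V)); apply: eq_iint => x.
by rewrite indic0.
Qed.

Let leb_ge0 A : 0 <= leb A.
Proof. by apply: iint_ge0 => x; rewrite lee_fin. Qed.

Let leb_sigma_additive : semi_sigma_additive leb.
Proof.
move=> F mF tF mUF.
rewrite /leb /Defs.integral.
have -> : iint (n + n) (fun x => (\1_(\bigcup_n F n) x)%:E) 0%R =
   \sum_(j <oo) iint (n + n) (fun x => (\1_(F j) x)%:E) 0%R :> \bar R.
  rewrite -ge0_iint_series.
  - by apply: eq_iint => x; exact: indic_bigcup.
  - by move=> j; exact: measurable_indic_bCn.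
  - by move=> j x; rewrite lee_fin.
apply: is_cvg_nneseries => j _ _; exact: leb_ge0.
Qed.

HB.instance Definition _ := isMeasure.Build _ T R leb leb0 leb_ge0 leb_sigma_additive.

End IteratedIntegral.

(** * Agreement of the iterated integral with the integral against [leb] *)

Section LebesgueMeasureCn.
Variables (R : realType) (n : nat).
Local Notation V := (Cn R n).
Local Notation T := (bCn R n).
Local Notation mu := (@leb R n).
Local Open Scope ereal_scope.
Implicit Types (f g : V -> \bar R) (k : nat).

Lemma ge0_iint_sum k (I : Type) (s : seq I) (F : I -> V -> \bar R) :
  (forall i, measurable_fun setT (F i : T -> \bar R)) ->
  (forall i x, 0 <= F i x) ->
  forall x, iint k (fun x => \sum_(i <- s) F i x) x = \sum_(i <- s) iint k (F i) x.
Proof.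
move=> mF F0 x; elim: s => [|i s IH].
  rewrite big_nil -[RHS](iint0 k x); apply: eq_iint => y; exact: big_nil.
rewrite big_cons -IH -ge0_iintD//.
- by apply: eq_iint => y; rewrite big_cons.
- by apply: emeasurable_sum => j; exact: mF.
- by move=> y; apply: sume_ge0.
Qed.

Import HBNNSimple.

Lemma integral_nnsfun_iint (g : {nnsfun T >-> R}) :
  \int[mu]_x (g x)%:E = Defs.integral (fun x : V => (g x)%:E).
Proof.
rewrite integralT_nnsfun sintegralE.
have -> : Defs.integral (fun x : V => (g x)%:E) =
  Defs.integral (fun x : V => \sum_(r <- finmap.enum_fset (fset_set (range g))) (r * \1_(g @^-1` [set r]) x)%:E).
  apply: eq_iint => x; rewrite sumEFin; congr EFin.
  by rewrite [LHS]fimfunE fsbig_finite.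
have nn r x : 0 <= (r * \1_(g @^-1` [set r]) x)%:E.
  rewrite lee_fin indicE; have [/set_mem /= <-|] := boolP (x \in _); last by rewrite mulr0.
  by rewrite mulr1 fun_ge0.
rewrite fsbig_finite//= /Defs.integral ge0_iint_sum//; last first.
  move=> r; apply/measurable_EFinP; exact: measurable_funM.
apply: eq_bigr => r _.
have [r0|r0] := leP 0%R r.
  rewrite -[RHS]/(Defs.integral _) /Defs.integral.
  under eq_iint do rewrite EFinM.
  by rewrite ge0_iintZl//; exact: measurable_indic_bCn.
have e0 : g @^-1` [set r] = set0.
  by apply/seteqP; split => // x /= gx; move: r0; rewrite -gx ltNge fun_ge0.
rewrite e0 measure0 mule0 -(iint0 (n + n) (0%R : V)); apply: eq_iint => x.
by rewrite indic0 mulr0.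
Qed.

Lemma ge0_integral_leb f : measurable_fun setT (f : T -> \bar R) ->
  (forall x, 0 <= f x) -> Defs.integral f = \int[mu]_x f x.
Proof.
move=> mf f0.
pose g := nnsfun_approx measurableT mf.
have gf x : f x = limn (EFin \o g ^~ x).
  by apply/esym/cvg_lim => //; exact: cvg_nnsfun_approx.
transitivity (limn (fun j => \int[mu]_x (g j x)%:E)).
  under eq_fun do rewrite integral_nnsfun_iint.
  rewrite /Defs.integral -monotone_iint.
  - by apply: eq_iint => x; rewrite gf.
  - by move=> j; exact/measurable_EFinP.
  - by move=> j x; rewrite lee_fin; exact: fun_ge0.
  - by move=> x i j ij; rewrite lee_fin; move/lefP : (nd_nnsfun_approx measurableT mf ij); apply.
rewrite -monotone_convergence//.
- by apply: eq_integral => x _; rewrite gf.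
- by move=> j; exact/measurable_EFinP.
- by move=> j x _; rewrite lee_fin; exact: fun_ge0.
- by move=> x _ i j ij; rewrite lee_fin; exact/lefP/nd_nnsfun_approx.
Qed.

(* Fubini: an inner integral may be of the form oo - oo, but only on a null set of the
   outer variable. *)
Lemma iint_funeposneg k f : measurable_fun setT (f : T -> \bar R) ->
  forall x, iint k (fun y => `|f y|) x < +oo ->
  iint k f x = iint k f^\+ x - iint k f^\- x.
Proof.
move=> mf; elim: k => [|k IH] x /=; first by move=> _; rewrite [in LHS](funeposneg f).
move=> ltoo.
have mab : measurable_fun setT ((fun y => `|f y|) : T -> \bar R) by exact: measurableT_comp.
have mp : measurable_fun setT (f^\+ : T -> \bar R) by exact: measurable_funepos.
have mn : measurable_fun setT (f^\- : T -> \bar R) by exact: measurable_funeneg.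
have iab : lebesgue_measure.-integrable setT (fun t => iint k (fun y => `|f y|) (setc x k t)).
  apply/integrableP; split; first exact: measurable_iint_section.
  by under eq_integral do rewrite gee0_abs ?iint_ge0//.
have ip : lebesgue_measure.-integrable setT (fun t => iint k f^\+ (setc x k t)).
  apply: (le_integrable _ _ _ iab) => //; first exact: measurable_iint_section.
  move=> t _; rewrite !gee0_abs ?iint_ge0//; apply: ge0_le_iint => // y.
  by rewrite -/((abse \o f) y) fune_abse leeDl.
have iN : lebesgue_measure.-integrable setT (fun t => iint k f^\- (setc x k t)).
  apply: (le_integrable _ _ _ iab) => //; first exact: measurable_iint_section.
  move=> t _; rewrite !gee0_abs ?iint_ge0//; apply: ge0_le_iint => // y.
  by rewrite -/((abse \o f) y) fune_abse leeDr.
rewrite -(integralB measurableT ip iN); apply: ae_eq_integral => //.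
- exact: measurable_iint_section.
- exact: (emeasurable_funB (measurable_iint_section k k x mp) (measurable_iint_section k k x mn)).
have := integrable_ae measurableT iab; apply: filterS => t /= /(_ I) tfin _.
by apply: IH; rewrite ltey_eq tfin.
Qed.

Lemma integral_leb f : mu.-integrable setT (f : T -> \bar R) ->
  Defs.integral f = \int[mu]_x f x.
Proof.
move=> /integrableP[mf foo].
rewrite /Defs.integral iint_funeposneg//; last first.
  by rewrite -/(Defs.integral _) ge0_integral_leb//; exact: measurableT_comp.
have mp : measurable_fun setT (f^\+ : T -> \bar R) by exact: measurable_funepos.
have mn : measurable_fun setT (f^\- : T -> \bar R) by exact: measurable_funeneg.
by rewrite [RHS]integralE -(ge0_integral_leb mp)// -(ge0_integral_leb mn).
Qed.

End LebesgueMeasureCn.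

(** * Translation invariance and the volume of balls *)

Section Translation.
Variables (R : realType) (n : nat).
Local Notation V := (Cn R n).
Local Notation T := (bCn R n).
Local Notation mu := (@leb R n).
Local Open Scope ereal_scope.
Implicit Types (f g : V -> \bar R) (k : nat).

Section Line.
Variable a : R.
Let sh (t : measurableTypeR R) : measurableTypeR R := (t + a)%R.

Let msh : measurable_fun setT sh.
Proof. by apply: measurable_funD. Qed.

Let sh_mixin := isMeasurableFun.Build _ _ _ _ _ msh.
Let sh_pack : {mfun _ >-> _} := HB.pack sh sh_mixin.

Lemma lebesgue_measure_shift (A : set (measurableTypeR R)) : measurable A ->
  pushforward lebesgue_measure sh A = lebesgue_measure A.
Proof.
move=> mA; rewrite -[sh]/(sh_pack : _ -> _).
apply/esym/lebesgue_measure_unique => //= _ [[u v]] _ <-.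
rewrite /pushforward.
have -> : sh @^-1` `]u, v] = `](u - a)%R, (v - a)%R]%classic.
  by apply/seteqP; split => t /=; rewrite !in_itv/= /sh ltrBlDr lerBrDr.
by rewrite !lebesgue_measure_itv/= !lte_fin ltrD2r; case: ifP => // _; rewrite -!EFinB; congr EFin; ring.
Qed.

Lemma ge0_integral_shift (f : R -> \bar R) :
  measurable_fun (setT : set (measurableTypeR R)) f -> (forall t, 0 <= f t) ->
  \int[lebesgue_measure]_t f (t + a)%R = \int[lebesgue_measure]_t f t.
Proof.
move=> mf f0.
have := @ge0_integral_pushforward _ _ _ _ _ sh msh lebesgue_measure setT f measurableT mf (fun t _ => f0 t).
rewrite preimage_setT => <-.
by apply: eq_measure_integral => A mA _; exact: lebesgue_measure_shift.
Qed.

Lemma integral_shift (f : R -> \bar R) :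
  measurable_fun (setT : set (measurableTypeR R)) f ->
  \int[lebesgue_measure]_t f (t + a)%R = \int[lebesgue_measure]_t f t.
Proof.
move=> mf; rewrite integralE [RHS]integralE; congr (_ - _).
- rewrite -(ge0_integral_shift (measurable_funepos mf) (funepos_ge0 f)).
  by apply: eq_integral => t _; rewrite !funeposE.
- rewrite -(ge0_integral_shift (measurable_funeneg mf) (funeneg_ge0 f)).
  by apply: eq_integral => t _; rewrite !funenegE.
Qed.

End Line.

Lemma iint_indep k f (x y : V) : (forall i : 'I_(n + n), (k <= i)%N -> x ord0 i = y ord0 i) ->
  iint k f x = iint k f y.
Proof.
elim: k x y => [|k IH] x y xy /=.
  by congr f; apply/matrixP => j i; rewrite (ord1 j); exact: xy.
apply: eq_integral => t _; apply: IH => i ki; rewrite !mxE.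
have [//|ik] := eqVneq (i : nat) k.
by apply: xy; rewrite ltn_neqAle eq_sym ik ki.
Qed.

Lemma iint_translate k f (h x : V) : measurable_fun setT (f : T -> \bar R) ->
  iint k (fun y => f (y + h)%R) x = iint k f (x + h)%R.
Proof.
move=> mf; elim: k x => [|k IH] x //=.
under eq_integral do rewrite IH.
have [kn|nk] := ltnP k (n + n).
  rewrite -(integral_shift (h ord0 (Ordinal kn)) (measurable_iint_section k k (x + h)%R mf)).
  apply: eq_integral => t _; congr iint; apply/matrixP => j i; rewrite (ord1 j) !mxE.
  have [ik|//] := eqVneq (i : nat) k.
  by congr (_ + _)%R; congr (h _ _); apply: val_inj.
apply: eq_integral => t _; congr iint; apply/matrixP => j i; rewrite (ord1 j) !mxE.
by rewrite ltn_eqF// (leq_trans (ltn_ord i)).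
Qed.

Lemma integral_translate f (h : V) : measurable_fun setT (f : T -> \bar R) ->
  Defs.integral (fun y => f (y + h)%R) = Defs.integral f.
Proof.
move=> mf; rewrite /Defs.integral iint_translate//; apply: iint_indep => i.
by rewrite leqNgt ltn_ord.
Qed.

(** A ball is a product of intervals; each integration trades one coordinate constraint for a factor
    2r. *)
Lemma iint_ball (z : V) (r : R) k : (0 <= r)%R -> (k <= n + n)%N -> forall x : V,
  iint k (fun x => (\1_[set y : V | forall i, (`|y ord0 i - z ord0 i| < r)%R] x)%:E) x =
  ((r *+ 2) ^+ k)%:E *
   (\1_[set y : V | forall i : 'I_(n + n), (k <= i)%N -> (`|y ord0 i - z ord0 i| < r)%R] x)%:E.
Proof.
move=> r0; elim: k => [|k IH] kn x.
  by rewrite /= expr0 mul1e; congr (\1_ _ x)%:E; apply/seteqP; split => y /= h i *; exact: h.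
rewrite [LHS]/=.
under eq_integral do rewrite (IH (ltnW kn)).
rewrite ge0_integralZl_EFin//; last 2 first.
- pose B := [set y : V | forall i : 'I_(n + n), (k <= i)%N -> (`|y ord0 i - z ord0 i| < r)%R].
  apply: (@measurable_section _ _ (fun x => (\1_B x)%:E) x k).
  apply: measurable_indic_bCn.
  rewrite (_ : B = \bigcap_(i in [set i : 'I_(n + n) | (k <= i)%N])
     [set y : V | (`|y ord0 i - z ord0 i| < r)%R]); last first.
    by apply/seteqP; split => y /= h i; [move=> /h | exact: h].
  apply: fin_bigcap_measurable => // i _.
  rewrite (_ : [set _ | _] = (fun y : V => y ord0 i) @^-1` ball (z ord0 i) r); last first.
    by apply/seteqP; split => y /=; rewrite /ball/= distrC.
  rewrite -[X in measurable X]setTI; apply: measurable_coord => //.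
  by apply: open_measurable; exact: ball_open.
- by rewrite exprn_ge0// mulrn_wge0.
pose B1 := [set y : V | forall i : 'I_(n + n), (k.+1 <= i)%N -> (`|y ord0 i - z ord0 i| < r)%R].
rewrite -/B1.
transitivity (((r *+ 2) ^+ k)%:E * \int[lebesgue_measure]_t
    ((\1_B1 x)%:E * (\1_(ball (z ord0 (Ordinal kn)) r) (t : R))%:E)).
  congr (_ * _); apply: eq_integral => t _; rewrite -EFinM; congr EFin.
  rewrite !indicE -natrM mulnb; congr (nat_of_bool _)%:R.
  apply/idP/andP => [/set_mem /= h|[/set_mem /= h1 /set_mem h2]].
    split; apply/mem_set.
      by move=> i ki; have := h i (ltnW ki); rewrite mxE gtn_eqF.
    by have := h (Ordinal kn) (leqnn k); rewrite mxE eqxx /ball/= distrC.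
  apply/mem_set => i; rewrite leq_eqVlt mxE => /orP[/eqP ki|ki].
    rewrite -ki eqxx; move: h2; rewrite /ball/= distrC; congr (`|_ - z _ _| < _)%R.
    exact: val_inj.
  by rewrite gtn_eqF//; exact: h1.
rewrite ge0_integralZl_EFin//; last first.
  apply/measurable_EFinP; apply: measurable_indic.
  by apply: open_measurable; exact: ball_open.
rewrite integral_indic ?setIT//; last by apply: open_measurable; exact: ball_open.
transitivity (((r *+ 2) ^+ k)%:E * ((\1_B1 x)%:E * (r *+ 2)%:E)).
  by congr (_ * (_ * _)); exact: lebesgue_measure_ball.
by rewrite muleCA -EFinM -exprSr muleC.
Qed.

Lemma leb_ball (z : V) (r : R) : (0 < r)%R ->
  mu [set y : V | (`|y - z| < r)%R] = ((r *+ 2) ^+ (n + n))%:E.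
Proof.
move=> r0; rewrite /leb.
rewrite (_ : [set y : V | (`|y - z| < r)%R] =
  [set y : V | forall i, (`|y ord0 i - z ord0 i| < r)%R]); last first.
  apply/seteqP; split => y /=.
    by move=> /norm_ltP => /(_ r0) h i; have := h i; rewrite !mxE.
  by move=> h; apply/norm_ltP => // i; rewrite !mxE.
rewrite /Defs.integral iint_ball ?(ltW r0)// indicE mem_set ?mule1// => i.
by rewrite leqNgt ltn_ord.
Qed.

End Translation.

(** * The operator of alpha *)

Section IntegrationByParts.
Variables (R : realType) (n : nat).
Local Notation V := (Cn R n).
Local Notation T := (bCn R n).
Local Notation mu := (@leb R n).

Lemma is_derive_line (h : V -> R) (x v : V) (s : R) :
  derivable h (x + s *: v) v ->
  is_derive s (1 : R) (fun s => h (x + s *: v)) ('D_v h (x + s *: v)).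
Proof.
have E : (fun r => r^-1 *: (((fun s => h (x + s *: v)) \o shift s) (r *: (1 : R)) - h (x + s *: v))) =
         (fun r => r^-1 *: ((h \o shift (x + s *: v)) (r *: v) - h (x + s *: v))).
  apply/funext => r /=; congr (_ *: (h _ - _)).
  by rewrite [r *: (1 : R)]mulr1 scalerDl addrCA.
move=> dh; apply: DeriveDef; first by rewrite /derivable E.
by rewrite /derive E.
Qed.

Lemma line_increment (h : V -> R) (x v : V) (C s : R) :
  (forall y, derivable h y v) -> (forall y, `|'D_v h y| <= C) -> 0 < s ->
  `|h (x + s *: v) - h x| <= C * s.
Proof.
move=> dh bd s0.
have dl t : is_derive t (1 : R) (fun s => h (x + s *: v)) ('D_v h (x + t *: v)).
  exact: is_derive_line.
have [|c _] := @MVT R (fun s => h (x + s *: v)) (fun t => 'D_v h (x + t *: v)) 0 s s0 (fun t _ => dl t).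
  apply: continuous_subspaceT => t; apply: differentiable_continuous.
  by apply/derivable1_diffP; have [] := dl t.
rewrite scale0r addr0 subr0 => ->.
by rewrite normrM (gtr0_norm s0) ler_pM2r.
Qed.

Lemma compact_norm_bound (K : set V) : compact K ->
  exists2 M : R, 0 < M & forall x, K x -> `|x| < M.
Proof.
move=> /compact_bounded[M [_ KM]]; exists (`|M| + 2).
  by rewrite ltr_wpDl.
move=> x Kx; apply: (@le_lt_trans _ _ (`|M| + 1)); last by rewrite ltrD2l ltr1n.
by apply: KM => //; rewrite (le_lt_trans (ler_norm _))// ltrDl.
Qed.

Lemma measurable_ball_bCn (z : V) (r : R) : measurable ([set y : V | `|y - z| < r] : set T).
Proof. by rewrite -(ball_CnE z); apply: open_measurable_bCn; exact: ball_open. Qed.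

Lemma indic_ball_integrable (z : V) (r : R) : 0 < r ->
  mu.-integrable setT (fun x : T => (\1_[set y : V | `|y - z| < r] (x : V))%:E).
Proof.
move=> r0; apply/integrableP; split; first exact: (measurable_indic_bCn (measurable_ball_bCn z r)).
rewrite (eq_integral (fun x : T => (\1_[set y : V | `|y - z| < r] (x : V))%:E)); last first.
  by move=> x _; rewrite gee0_abs// lee_fin.
rewrite integral_indic ?setIT//; last exact: measurable_ball_bCn.
by change (mu [set y : V | (`|y - z| < r)%R] < +oo)%E; rewrite leb_ball// ltry.
Qed.

Lemma compact_closed_ball_Cn (z : V) (r : R) : compact [set y : V | `|y - z| <= r].
Proof.
apply: bounded_closed_compact.
  exists (`|z| + r); split; first exact: num_real.
  move=> B rB y /= yr; rewrite -[y](subrK z).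
  by apply: (le_trans (ler_normD _ _)); rewrite addrC; apply: ltW; apply: le_lt_trans rB; rewrite lerD2l.
have -> : [set y : V | `|y - z| <= r] = closed_ball_ Num.Def.normr z r.
  by apply/seteqP; split => y /=; rewrite /closed_ball_ /= distrC.
exact: closed_closed_ball_.
Qed.

Lemma continuous_bounded_on (K : set V) (h : V -> R) : compact K ->
  (forall x, K x -> {for x, continuous h}) -> exists2 B : R, 0 < B & forall x, K x -> `|h x| <= B.
Proof.
move=> cK ch.
have cKh : {within K, continuous h}.
  by apply: continuous_in_subspaceT => x /set_mem; exact: ch.
have [M [_ KM]] := compact_bounded (continuous_compact cKh cK).
exists (`|M| + 1); first by rewrite ltr_wpDl.
by move=> x Kx; apply: KM; [rewrite (le_lt_trans (ler_norm _))// ltrDl|exists x].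
Qed.

Lemma leb_bounded_integrable (g : V -> R) (B M : R) : 0 < M ->
  measurable_fun setT (g : T -> R) -> (forall x, `|g x| <= B) ->
  (forall x, M <= `|x| -> g x = 0) -> mu.-integrable setT (EFin \o (g : T -> R)).
Proof.
move=> M0 mg gB gM.
apply: (@le_integrable _ _ _ mu setT measurableT _ (fun x => B%:E * (\1_[set y : V | `|y - 0| < M] (x : V))%:E)%E).
- exact/measurable_EFinP.
- move=> x _; rewrite -EFinM /comp !abse_EFin lee_fin indicE.
  have B0 : 0 <= B := le_trans (normr_ge0 _) (gB 0).
  have [xM|xM] := ltP `|(x : V)| M.
    rewrite mem_set /=; last by rewrite subr0.
    by rewrite mulr1 (ger0_norm B0).
  by rewrite gM// normr0 normr_ge0.
- by apply: integrableZl => //; exact: indic_ball_integrable.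
Qed.

(** The difference quotients of [h] have integral zero by translation invariance and are bounded by
    [C] by the mean value theorem; dominated convergence passes to the derivative. *)
Lemma integral_partial0 (h : V -> R) (i : 'I_(n + n)) (C M : R) :
  0 < M -> continuous h -> (forall y, derivable h y (ev R i)) ->
  (forall y, `|'D_(ev R i) h y| <= C) -> (forall x, M <= `|x| -> h x = 0) ->
  mu.-integrable setT (EFin \o ('D_(ev R i) h : T -> R)) /\
  (\int[mu]_x ('D_(ev R i) h (x : V))%:E = 0)%E.
Proof.
move=> M0 ch dh bd hM.
set e := ev R i.
have mh : measurable_fun setT (h : T -> R) by exact: continuous_measurable_bCn.
pose d m : R := m.+1%:R^-1.
have d0 m : 0 < d m by rewrite invr_gt0.
pose f m (x : T) := (m.+1%:R * (h ((x : V) + d m *: e) - h x))%:E.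
have ne1 : `|e : V| <= 1.
  by apply/norm_leP => // j; rewrite mxE eqxx/=; case: (_ == _); rewrite ?normr1 ?normr0.
have fb m x : `|m.+1%:R * (h ((x : V) + d m *: e) - h x)| <= C.
  rewrite normrM ger0_norm// mulrC -ler_pdivlMr//.
  exact: line_increment.
(* The steps [d m] are at most 1, so all quotients vanish outside the ball of radius M + 1. *)
have f0 m (x : V) : M + 1 <= `|x| -> m.+1%:R * (h (x + d m *: e) - h x) = 0.
  move=> xM; have xM' : M <= `|x| by apply: le_trans xM; rewrite lerDl.
  rewrite (hM _ xM') hM ?subrr ?mulr0//.
  suff : `|x| <= `|x + d m *: e| + 1 by move: xM; lra.
  rewrite -{1}[x](addrK (d m *: e)).
  apply: (le_trans (ler_normB _ _)); rewrite lerD2l normrZ gtr0_norm//.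
  by rewrite mulr_ile1 ?(ltW (d0 m))// /d invf_le1 ?ler1n.
have mf0 m : measurable_fun setT (fun x : T => m.+1%:R * (h ((x : V) + d m *: e) - h x)).
  apply: measurable_funM => //; apply: measurable_funB => //.
  apply: (@continuous_measurable_bCn _ _ (fun x => h (x + d m *: e))) => x.
  apply: (@continuous_comp _ _ _ (fun x : V => x + d m *: e) h); last exact: ch.
  exact: (cvgD (@cvg_id _ (nbhs x)) (@cvg_cst _ (d m *: e) _ (nbhs x) _)).
have mf m : measurable_fun setT (f m) by exact/measurable_EFinP.
have fcvg x : f ^~ x @ \oo --> ('D_e h (x : V))%:E.
  apply: cvg_EFin; first by near=> m.
  have dx := dh x; rewrite /derivable in dx.
  have /cvgr_dnbhsP /(_ d) := dx.
  rewrite -/('D_e h x) => H.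
  have {}H := H (conj (fun m => lt0r_neq0 (d0 m)) (@cvg_harmonic R)).
  rewrite (_ : fine \o _ = fun m => (d m)^-1 *: ((h \o shift (x : V)) (d m *: ev R i) - h x))//.
  by apply/funext => m; rewrite /= /d invrK [(x : V) + _]addrC.
have df : measurable_fun setT (fun x : T => ('D_e h (x : V))%:E).
  by apply: (emeasurable_fun_cvg f) => // x _; exact: fcvg.
have M1 : 0 < M + 1 by rewrite addr_gt0.
have ig : mu.-integrable setT (fun x : T => (C%:E * (\1_[set y : V | `|y - 0| < M + 1] (x : V))%:E)%E).
  by apply: integrableZl => //; exact: indic_ball_integrable.
have fdom : \forall x \ae mu, forall m : nat, [set: T] x ->
    (`|f m x| <= C%:E * (\1_[set y : V | `|y - 0| < M + 1] (x : V))%:E)%E.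
  apply: aeW => x m _; rewrite -EFinM /f abse_EFin lee_fin indicE.
  have [xM|xM] := ltP `|(x : V)| (M + 1).
    rewrite mem_set /=; last by rewrite subr0.
    by rewrite mulr1; exact: fb.
  by rewrite f0// normr0 memNset ?mulr0//= subr0 ltNge xM.
have [iD _ cvgI] := dominated_convergence measurableT mf df (aeW _ (fun x _ => fcvg x)) ig fdom.
split => //.
have [B _ hB] := continuous_bounded_on (@compact_closed_ball_Cn 0 M) (fun x _ => ch x).
have hB' x : `|h x| <= B.
  have [xM|xM] := leP `|x| M; first by apply: hB; rewrite /= subr0.
  by rewrite hM ?normr0 ?(ltW xM)//; apply: (le_trans (normr_ge0 _) (hB 0 _)); rewrite /= subrr normr0 ltW.
have ih : mu.-integrable setT (EFin \o (h : T -> R)).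
  by apply: (@leb_bounded_integrable _ B M) => // x.
have If m : (\int[mu]_x f m x = 0)%E.
  pose hs (x : T) := h ((x : V) + d m *: e).
  have mhs : measurable_fun setT hs.
    apply: (@continuous_measurable_bCn _ _ (fun x => h (x + d m *: e))) => x.
    apply: (@continuous_comp _ _ _ (fun x : V => x + d m *: e) h); last exact: ch.
    exact: (cvgD (@cvg_id _ (nbhs x)) (@cvg_cst _ (d m *: e) _ (nbhs x) _)).
  have ihs : mu.-integrable setT (EFin \o hs).
    apply: (@leb_bounded_integrable _ B (M + 1)) => // x; first exact: hB'.
    move=> xM; rewrite /hs.
    have := f0 m x xM; rewrite (hM x); last by apply: le_trans xM; rewrite lerDl.
    by rewrite subr0 => /eqP; rewrite mulf_eq0 pnatr_eq0/= => /eqP.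
  rewrite /f; under eq_integral do rewrite EFinM EFinB.
  rewrite integralZl//; last exact: integrableB.
  rewrite integralB_EFin// -(integral_leb ihs) -(integral_leb ih).
  rewrite -(integral_translate (d m *: e) (measurable_int _ ih)) subee ?mule0//.
  by rewrite (integral_leb ihs); exact: integrable_fin_num.
move/cvg_lim : cvgI => <- //.
by under eq_fun do rewrite If; exact: lim_cst.
Unshelve. all: by end_near.
Qed.

End IntegrationByParts.

(** * Products of a coefficient with a compactly supported function *)

Section CutOff.
Variables (R : realType) (n : nat).
Local Notation V := (Cn R n).
Local Notation T := (bCn R n).
Local Notation mu := (@leb R n).

Lemma compact_closedV (K : set V) : compact K -> closed K.
Proof. by apply: compact_closed; exact: norm_hausdorff. Qed.

Lemma near_out (K : set V) (f : V -> R) (x : V) : closed K ->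
  (forall y, ~ K y -> f y = 0) -> ~ K x -> \forall y \near x, f y = 0.
Proof.
move=> cK f0 nKx; have : nbhs x (~` K).
  by apply: open_nbhs_nbhs; split => //; exact: closed_openC.
by apply: filterS => y; exact: f0.
Qed.

Lemma derive_out (K : set V) (f : V -> R) (x v : V) : closed K ->
  (forall y, ~ K y -> f y = 0) -> ~ K x -> 'D_v f x = 0.
Proof.
move=> cK f0 nKx; rewrite (near_eq_derive (g := cst 0)) ?derive_cst//.
exact: near_out nKx.
Qed.

Lemma C1_on_continuous (G : set V) (g : V -> R) i x : open G -> C1_on G g -> G x ->
  {for x, continuous ('D_(ev R i) g)}.
Proof.
move=> oG [_ /(_ i)]; rewrite continuous_open_subspace// => c Gx.
by apply: c; exact/mem_set.
Qed.

(** Nothing is known of [g] outside [G], but there the product vanishes on a whole neighbourhood,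
    because [K] is closed and contained in [G]. *)
Lemma integral_partial_cutoff (G K : set V) (g f : V -> R) (i : 'I_(n + n)) :
  open G -> C1_on G g -> compact K -> K `<=` G ->
  (forall x, differentiable f x) -> continuous ('D_(ev R i) f) ->
  (forall x, ~ K x -> f x = 0) ->
  mu.-integrable setT (fun x : T => ('D_(ev R i) (g * f) (x : V))%:E) /\
  (\int[mu]_x ('D_(ev R i) (g * f) (x : V))%:E = 0)%E.
Proof.
move=> oG Cg cK KG df cDf f0; have clK := compact_closedV cK.
have gf0 x : ~ K x -> (g * f) x = 0 by move=> nK; rewrite fctE f0// mulr0.
have dg x : G x -> differentiable g x by case: Cg => + _; apply.
have KnearG x : ~ G x -> ~ K x by move=> nG /KG.
have cgf : continuous (g * f).
  move=> x; have [Gx|nGx] := pselect (G x).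
    exact/differentiable_continuous/differentiableM/df/dg.
  have n0 := near_out clK gf0 (KnearG _ nGx).
  rewrite /continuous_at gf0; last exact: KnearG.
  have nf : {near x, cst 0 =1 g * f} by apply: filterS n0 => y /= ->.
  exact: (cvg_trans (near_eq_cvg nf) (cvg_cst _)).
have dgf x : derivable (g * f) x (ev R i).
  have [Gx|nGx] := pselect (G x).
    exact/diff_derivable/differentiableM/df/dg.
  apply: (near_eq_derivable (f := cst 0)); last exact: derivable_cst.
  have n0 := near_out clK gf0 (KnearG _ nGx).
  by apply: filterS n0 => y /= ->.
have cD x : K x -> {for x, continuous (fun x => g x * 'D_(ev R i) f x + f x * 'D_(ev R i) g x)}.
  move=> Kx; have c1 := differentiable_continuous (dg _ (KG _ Kx)).
  have c2 := C1_on_continuous (i := i) oG Cg (KG _ Kx).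
  exact: (cvgD (cvgM c1 (cDf x)) (cvgM (differentiable_continuous (df x)) c2)).
have [B B0 hB] := continuous_bounded_on cK cD.
have [M M0 KM] := compact_norm_bound cK.
apply: (@integral_partial0 _ _ (g * f) i B M) => //.
  move=> x; have [Kx|nKx] := pselect (K x).
    rewrite deriveM; [exact: hB|exact/diff_derivable/dg/KG|exact/diff_derivable/df].
  by rewrite (derive_out _ clK gf0 nKx) normr0 ltW.
move=> x Mx; apply: gf0 => /KM; by rewrite ltNge Mx.
Qed.

End CutOff.

(** * The real coefficient matrix *)

Section Operator.
Variables (R : realType) (n : nat).
Local Notation V := (Cn R n).
Local Notation T := (bCn R n).
Local Notation mu := (@leb R n).
Variables (G : set V) (b c : 'I_n -> 'I_n -> V -> R).

(* Entries of the real symmetric matrix with blocks [[b, -c], [c, b]]. *)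
Definition acoef (i l : 'I_(n + n)) : V -> R :=
  match fintype.split i, fintype.split l with
  | inl j, inl k => b j k
  | inr j, inr k => b j k
  | inl j, inr k => - c j k
  | inr j, inl k => c j k
  end.

Lemma LopE w x : Lop b c w x = \sum_i \sum_l acoef i l x * d2 w i l x.
Proof.
rewrite big_split_ord /= /Lop.
under [X in _ = X + _]eq_bigr do rewrite big_split_ord /=.
under [X in _ = _ + X]eq_bigr do rewrite big_split_ord /=.
rewrite -[RHS]big_split /=; apply: eq_bigr => j _.
rewrite -[X in _ = X + _]big_split -[X in _ = _ + X]big_split -[RHS]big_split.
apply: eq_bigr => k _.
rewrite /acoef !(unsplitK (inl _)) !(unsplitK (inr _)) /xc /yc fctE.
move: (b j k x) (c j k x) (d2 w (lshift n j) (lshift n k) x) (d2 w (rshift n j) (rshift n k) x)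
  (d2 w (lshift n j) (rshift n k) x) (d2 w (rshift n j) (lshift n k) x) => ? ? ? ? ? ? /=.
ring.
Qed.

Hypothesis HG : closed_strictly_positive_form G b c.

Let oG : open G. Proof. by case: HG. Qed.

Lemma acoef_C1 i l : C1_on G (acoef i l).
Proof.
have [_ C1 _ _ _] := HG.
rewrite /acoef; case: (fintype.split i) => j; case: (fintype.split l) => k;
  have [Cb Cc] := C1 j k => //.
have [dc cc] := Cc; split => [x Gx|m]; first exact/differentiableN/dc.
rewrite continuous_open_subspace// => x /set_mem Gx.
have cx := C1_on_continuous (i := m) oG Cc Gx.
have nE : {near x, (fun y => - 'D_(ev R m) (c j k) y) =1 'D_(ev R m) (- c j k)}.
  have : nbhs x G by exact: open_nbhs_nbhs.
  by apply: filterS => y Gy /=; rewrite deriveN//; exact/diff_derivable/dc.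
have Ex : - 'D_(ev R m) (c j k) x = 'D_(ev R m) (- c j k) x by exact: (nbhs_singleton nE).
rewrite /prop_for /continuous_at -Ex.
exact: (cvg_trans (near_eq_cvg nE) (cvgN cx)).
Qed.

Lemma acoef_sym i l x : G x -> acoef i l x = acoef l i x.
Proof.
have [_ _ sym _ _] := HG => Gx.
by rewrite /acoef; case: (fintype.split i) => j; case: (fintype.split l) => k;
  have [Hb Hc] := sym j k x Gx; rewrite ?Hb// ?fctE Hc ?opprK.
Qed.

Lemma acoef_pos (p : 'I_(n + n) -> R) x : G x -> (exists i, p i != 0) ->
  0 < \sum_i \sum_l acoef i l x * (p i * p l).
Proof.
have [_ _ _ pos _] := HG => Gx [i pi0].
have : exists j, p (lshift n j) != 0 \/ p (rshift n j) != 0.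
  by move: pi0; rewrite -(splitK i); case: (fintype.split i) => j /= pj; exists j; [left|right].
move=> /(pos x Gx (fun j => p (lshift n j)) (fun j => p (rshift n j))).
congr (0 < _).
rewrite [RHS]big_split_ord /=.
under [X in _ = X + _]eq_bigr do rewrite big_split_ord /=.
under [X in _ = _ + X]eq_bigr do rewrite big_split_ord /=.
rewrite -[RHS]big_split /=; apply: eq_bigr => j _.
rewrite -[X in _ = X + _]big_split -[X in _ = _ + X]big_split -[RHS]big_split.
apply: eq_bigr => k _.
rewrite /acoef !(unsplitK (inl _)) !(unsplitK (inr _)) fctE.
move: (b j k x) (c j k x) (p (lshift n j)) (p (rshift n j)) (p (lshift n k)) (p (rshift n k)) => ? ? ? ? ? ? /=.
ring.
Qed.

(** For a left index this is the real part of the closedness equation, for a right index the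
    negative of its imaginary part. *)
Lemma acoef_div l x : G x -> \sum_i 'D_(ev R i) (acoef i l) x = 0.
Proof.
have [_ C1 _ _ dv] := HG => Gx.
rewrite big_split_ord /= -big_split /=.
rewrite -(splitK l); case: (fintype.split l) => k; have [d1 d2] := dv x Gx k.
  rewrite (eq_bigr (fun j => 'D_(ev R (xc j)) (b j k) x + 'D_(ev R (yc j)) (c j k) x))//.
  by move=> j _; rewrite /acoef !(unsplitK (inl _)) !(unsplitK (inr _)).
rewrite (eq_bigr (fun j => - ('D_(ev R (xc j)) (c j k) x - 'D_(ev R (yc j)) (b j k) x))).
  by rewrite sumrN d2 oppr0.
move=> j _; rewrite /acoef !(unsplitK (inl _)) !(unsplitK (inr _)) deriveN ?opprB 1?addrC//.
by apply/diff_derivable; have [_ [+ _]] := C1 j k; apply.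
Qed.

End Operator.

(** * Affine functions and the divergence form of the operator *)

Section AffineHarmonic.
Variables (R : realType) (n : nat).
Local Notation V := (Cn R n).
Local Notation T := (bCn R n).
Local Notation mu := (@leb R n).

Definition affine (a : R) (p : 'I_(n + n) -> R) (x : V) : R := a + \sum_i p i * x ord0 i.

Lemma derivable_coord (x v : V) i : is_derive x v (fun y : V => y ord0 i) (v ord0 i).
Proof.
have dc := differentiable_coord x ord0 i.
apply: DeriveDef; first exact: diff_derivable.
rewrite /derive (_ : (fun h => _) = fun h => h^-1 * h * v ord0 i); last first.
  by apply/funext => h /=; rewrite !mxE addrK /GRing.scale/= mulrA.
apply/cvg_lim => //; apply: (cvg_trans _ (@cvg_cst _ (v ord0 i) _ (0 : R)^' _)).
apply: near_eq_cvg; near=> h; rewrite mulVf ?mul1r//.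
by near: h; exact: nbhs_dnbhs_neq.
Unshelve. all: by end_near. Qed.

Lemma differentiable_affine a p x : differentiable (affine a p) x.
Proof.
rewrite (_ : affine a p = cst a + (\sum_i (p i *: (fun y : V => y ord0 i)))); last first.
  by apply/funext => y; rewrite /affine !fctE/= fct_sumE.
apply: differentiableD => //; apply: differentiable_sum => i.
apply: differentiableZ; exact: differentiable_coord.
Qed.

Lemma derive_affine a p x l : 'D_(ev R l) (affine a p) x = p l.
Proof.
rewrite (_ : affine a p = cst a + (\sum_i (p i *: (fun y : V => y ord0 i)))); last first.
  by apply/funext => y; rewrite /affine !fctE/= fct_sumE.
have dc i : derivable (fun y : V => y ord0 i) x (ev R l) by have [] := derivable_coord x (ev R l) i.
rewrite deriveD//; last by apply: derivable_sum => i; apply: derivableZ.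
rewrite derive_cst add0r derive_sum; last by move=> i; apply: derivableZ.
rewrite (bigD1 l)//= big1 ?addr0.
  by rewrite deriveZ// (@derive_val _ _ _ _ _ _ _ (derivable_coord x (ev R l) l)) /ev mxE !eqxx/= /GRing.scale/= mulr1.
move=> i il; rewrite deriveZ// (@derive_val _ _ _ _ _ _ _ (derivable_coord x (ev R l) i)).
by rewrite /ev mxE (negbTE il) andbF /GRing.scale/= mulr0.
Qed.

Lemma smooth_diff0 (w : V -> R) x : smooth w -> differentiable w x.
Proof. by move=> /(_ [::] x). Qed.

Lemma smooth_diff1 (w : V -> R) l x : smooth w -> differentiable ('D_(ev R l) w) x.
Proof. by move=> /(_ [:: l] x). Qed.

Variables (G K : set V) (b c : 'I_n -> 'I_n -> V -> R).
Hypothesis HG : closed_strictly_positive_form G b c.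
Hypotheses (cK : compact K) (KG : K `<=` G).
Variable w : V -> R.
Hypotheses (sw : smooth w) (w0 : forall x, ~ K x -> w x = 0).

Let oG : open G. Proof. by case: HG. Qed.
Let clK := compact_closedV cK.

Let dw0 l x : ~ K x -> 'D_(ev R l) w x = 0.
Proof. exact: derive_out. Qed.

Let d2w0 i l x : ~ K x -> d2 w i l x = 0.
Proof. by apply: derive_out => // y; exact: dw0. Qed.

Lemma Lop_out x : ~ K x -> Lop b c w x = 0.
Proof.
move=> nK; rewrite LopE big1// => i _; rewrite big1// => l _.
by rewrite d2w0 ?mulr0.
Qed.

Lemma Lop_continuous x : G x -> {for x, continuous (Lop b c w)}.
Proof.
move=> Gx; rewrite (_ : Lop b c w = \sum_i \sum_l (acoef b c i l * d2 w i l)); last first.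
  by apply/funext => y; rewrite LopE fct_sumE; apply: eq_bigr => i _; rewrite fct_sumE.
apply: differentiable_continuous.
apply: differentiable_sum => i; apply: differentiable_sum => l.
apply: differentiableM; last exact: (sw [:: i; l]).
by have [+ _] := acoef_C1 HG i l; apply.
Qed.

(** Green's identity with an affine multiplier. The mixed terms with one derivative on each factor
    cancel between the two divergences; the terms with differentiated coefficients sum to zero, over
    i by closedness and over l by closedness and symmetry. *)
Lemma affine_Lop_divergence a p x :
  affine a p x * Lop b c w x = \sum_i \sum_l
    ('D_(ev R i) (acoef b c i l * (affine a p * 'D_(ev R l) w)) x
     - 'D_(ev R l) (acoef b c i l * (p i *: w)) x).
Proof.
have [Gx|nG] := pselect (G x); last first.
  have nK : ~ K x by move=> /KG.
  rewrite Lop_out// mulr0 big1// => i _; rewrite big1// => l _.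
  rewrite !(@derive_out _ _ K) ?subrr// => y nKy; rewrite !fctE ?w0 ?dw0 ?mulr0//.
  by rewrite scaler0 mulr0.
have dA i l v : derivable (acoef b c i l) x v.
  by apply: diff_derivable; have [+ _] := acoef_C1 HG i l; apply.
have da v : derivable (affine a p) x v by exact/diff_derivable/differentiable_affine.
have d1 l v : derivable ('D_(ev R l) w) x v by exact/diff_derivable/smooth_diff1.
have d0 v : derivable w x v by exact/diff_derivable/smooth_diff0.
pose A i l := acoef b c i l x; pose W l := 'D_(ev R l) w x.
pose DA j i l := 'D_(ev R j) (acoef b c i l) x.
under eq_bigr => i _.
  under eq_bigr => l _.
    rewrite deriveM//; last exact: derivableM.
    rewrite deriveM// derive_affine deriveM//; last exact: derivableZ.
    rewrite deriveZ// !fctE.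
    rewrite (_ : _ - _ = affine a p x * (acoef b c i l x * d2 w i l x)
      + (affine a p x * W l * DA i i l - p i * w x * DA l i l)); last first.
      rewrite /W /DA /d2 /GRing.scale/=.
      move: (acoef b c i l x) (affine a p x) ('D_(ev R i) ('D_(ev R l) w) x) ('D_(ev R l) w x)
        ('D_(ev R i) (acoef b c i l) x) ('D_(ev R l) (acoef b c i l) x) (w x) (p i) => *.
      ring.
    over.
  rewrite big_split/= sumrB; over.
rewrite big_split/= sumrB.
have E : affine a p x * Lop b c w x =
    \sum_i \sum_l affine a p x * (acoef b c i l x * d2 w i l x).
  by rewrite LopE mulr_sumr; apply: eq_bigr => i _; rewrite mulr_sumr.
have S1 : \sum_i \sum_l affine a p x * W l * DA i i l = 0.
  by rewrite exchange_big big1//= => l _; rewrite -mulr_sumr (acoef_div HG l Gx) mulr0.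
have S2 : \sum_i \sum_l p i * w x * DA l i l = 0.
  rewrite big1// => i _; rewrite -mulr_sumr (_ : \sum_l _ = 0) ?mulr0//.
  rewrite (eq_bigr (fun l => 'D_(ev R l) (acoef b c l i) x)); first exact: (acoef_div HG i Gx).
  move=> l _; apply: near_eq_derive; have : nbhs x G by exact: open_nbhs_nbhs.
  by apply: filterS => y Gy; exact: (acoef_sym HG).
by rewrite E S1 S2 subr0 addr0.
Qed.

(** The constants allow [u] to be replaced by M - u in a test; the linear functions allow |z|^2 to
    be recentred at an arbitrary point. *)
Lemma integral_affine_Lop a p :
  mu.-integrable setT (fun x : T => (affine a p (x : V) * Lop b c w x)%:E) /\
  (\int[mu]_x (affine a p (x : V) * Lop b c w x)%:E = 0)%E.
Proof.
have P1 i l : mu.-integrable setT (fun x : T =>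
      ('D_(ev R i) (acoef b c i l * (affine a p * 'D_(ev R l) w)) (x : V))%:E) /\
    (\int[mu]_x ('D_(ev R i) (acoef b c i l * (affine a p * 'D_(ev R l) w)) (x : V))%:E = 0)%E.
  apply: (@integral_partial_cutoff _ _ G K) => //.
  - exact: (acoef_C1 HG).
  - by move=> x; apply: differentiableM; [exact: differentiable_affine|exact: smooth_diff1].
  - rewrite (_ : 'D_(ev R i) _ = affine a p * d2 w i l + p i *: 'D_(ev R l) w).
      move=> x; apply: differentiable_continuous; apply: differentiableD.
        by apply: differentiableM; [exact: differentiable_affine|exact: (sw [:: i; l])].
      by apply: differentiableZ; exact: smooth_diff1.
    apply/funext => x; rewrite deriveM ?derive_affine; first last.
    + exact/diff_derivable/smooth_diff1.
    + exact/diff_derivable/differentiable_affine.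
    by rewrite !fctE [X in _ + X]mulrC.
  - by move=> x nK; rewrite fctE dw0// mulr0.
have P2 i l : mu.-integrable setT (fun x : T =>
      ('D_(ev R l) (acoef b c i l * (p i *: w)) (x : V))%:E) /\
    (\int[mu]_x ('D_(ev R l) (acoef b c i l * (p i *: w)) (x : V))%:E = 0)%E.
  apply: (@integral_partial_cutoff _ _ G K) => //.
  - exact: (acoef_C1 HG).
  - by move=> x; apply: differentiableZ; exact: smooth_diff0.
  - rewrite (_ : 'D_(ev R l) _ = p i *: 'D_(ev R l) w).
      by move=> x; apply/differentiable_continuous/differentiableZ; exact: smooth_diff1.
    by apply/funext => x; rewrite deriveZ//; exact/diff_derivable/smooth_diff0.
  - by move=> x nK; rewrite fctE w0// scaler0.
have I1 i l : mu.-integrable setT (fun x : T =>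
      ('D_(ev R i) (acoef b c i l * (affine a p * 'D_(ev R l) w)) (x : V)
       - 'D_(ev R l) (acoef b c i l * (p i *: w)) (x : V))%:E).
  under [X in _.-integrable _ X]eq_fun do rewrite EFinB.
  by apply: integrableB => //; [case: (P1 i l)|case: (P2 i l)].
have E : (fun x : T => (affine a p (x : V) * Lop b c w x)%:E) =
  (fun x : T => \sum_i \sum_l
    ('D_(ev R i) (acoef b c i l * (affine a p * 'D_(ev R l) w)) (x : V)
     - 'D_(ev R l) (acoef b c i l * (p i *: w)) (x : V))%:E)%E.
  apply/funext => x; rewrite affine_Lop_divergence -sumEFin.
  by apply: eq_bigr => i _; rewrite sumEFin.
rewrite E; split.
  by apply: integrable_sum => // i _; apply: integrable_sum => // l _; exact: I1.
rewrite integral_sum//; last by move=> i; apply: integrable_sum => // l _; exact: I1.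
rewrite big1// => i _; rewrite integral_sum// big1// => l _.
have [p1 z1] := P1 i l; have [p2 z2] := P2 i l.
under eq_integral do rewrite EFinB.
by rewrite integralB// z1 z2 sube0.
Qed.

Lemma Lop_bounded : exists2 B : R, 0 < B & forall x, `|Lop b c w x| <= B.
Proof.
have [B B0 hB] := continuous_bounded_on cK (fun x Kx => Lop_continuous (KG Kx)).
exists B => // x; have [Kx|nK] := pselect (K x); first exact: hB.
by rewrite Lop_out// normr0 ltW.
Qed.

(** The coefficients are arbitrary outside [G], so global measurability is read off from the
    integrability of the product with the constant 1. *)
Lemma measurable_Lop : measurable_fun setT (Lop b c w : T -> R).
Proof.
have [i1 _] := integral_affine_Lop 1 (fun _ => 0).
apply/measurable_EFinP; have := measurable_int _ i1.
congr measurable_fun; apply/funext => x /=.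
by rewrite /affine big1 ?addr0 ?mul1r// => i _; rewrite mul0r.
Qed.

End AffineHarmonic.

(** * Subharmonic functions *)

Section Subharmonic.
Variables (R : realType) (n : nat).
Local Notation V := (Cn R n).
Local Notation T := (bCn R n).
Local Notation mu := (@leb R n).
Local Open Scope ereal_scope.
Implicit Types (u : V -> \bar R) (Om K : set V).

(** The clauses of [strongly_usc] that do not involve sets of full measure. They suffice for
    measurability and closed superlevel sets, and pass to sums by an elementary argument. *)
Definition usc_on Om u : Prop :=
  (forall z, Om z -> u z < +oo) /\
  (forall z, Om z -> forall t : R, u z < t%:E -> \forall y \near z, u y < t%:E).

Lemma strongly_usc_usc Om u : strongly_usc Om u -> usc_on Om u.
Proof. by case. Qed.

Lemma measurable_usc Om u : open Om -> usc_on Om u -> measurable_fun (Om : set T) (u : T -> \bar R).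
Proof.
move=> oO [_ usc]; apply: (measurability _ (ErealGenInftyO.measurableE R)).
move=> _ [_ [r ->] <-]; apply: open_measurable_bCn.
rewrite openE => z [Oz /=]; rewrite in_itv /= => uz; rewrite /interior.
have n1 : nbhs z Om by exact: open_nbhs_nbhs.
have n2 := usc z Oz r uz.
by apply: filterS2 n1 n2 => y Oy uy; split => //=; rewrite in_itv.
Qed.

Lemma measurable_compact K : compact K -> measurable (K : set T).
Proof. by move=> cK; exact: (closed_measurable_bCn (compact_closedV cK)). Qed.

Lemma indic_mul_restrict K (f : V -> \bar R) :
  (fun x : V => (\1_K x)%:E * `|f x|) = ((fun x : T => `|f x|) \_ (K : set T)).
Proof.
apply/funext => x; rewrite patchE indicE; case: ifPn => xK.
  by rewrite mul1e.
by rewrite mul0e.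
Qed.

Lemma L1locP Om u : open Om -> measurable_fun (Om : set T) (u : T -> \bar R) ->
  L1loc Om u <-> (forall K, compact K -> K `<=` Om -> mu.-integrable (K : set T) (u : T -> \bar R)).
Proof.
move=> oO mu_; have mO : measurable (Om : set T) by exact: open_measurable_bCn.
split => H K cK KO; have mK := measurable_compact cK.
  have muK : measurable_fun (K : set T) (u : T -> \bar R) by exact: (measurable_funS mO KO mu_).
  have maK : measurable_fun (K : set T) (fun x : T => `|u x|) by exact: measurableT_comp muK.
  apply/integrableP; split=> //.
  have := H K cK KO; rewrite indic_mul_restrict ge0_integral_leb.
  - by rewrite -integral_mkcond.
  - by apply/(measurable_restrictT _ mK).
  - by move=> x; rewrite patchE; case: ifPn.
have /integrableP[muK] := H K cK KO.
have maK : measurable_fun (K : set T) (fun x : T => `|u x|) by exact: measurableT_comp muK.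
rewrite indic_mul_restrict ge0_integral_leb.
- by rewrite -integral_mkcond.
- by apply/(measurable_restrictT _ mK).
- by move=> x; rewrite patchE; case: ifPn.
Qed.

Lemma null_set_leb (N : set V) : Defs.null_set N ->
  exists M : set T, [/\ measurable M, N `<=` M & mu M = 0].
Proof. by move=> [M [bM NM M0]]; exists M. Qed.

Lemma full_near_meets (A : set V) z0 : full_near A z0 -> exists2 r1 : R, (0 < r1)%R &
  forall S : set T, measurable S -> 0 < mu S -> (forall z, S z -> (`|(z : V) - z0| < r1)%R) ->
  exists z, S z /\ A z.
Proof.
move=> [r1 r10 /null_set_leb[M [mM NM M0]]]; exists r1 => // S mS S0 Sr.
apply: contrapT => nex.
have SM : S `<=` M.
  move=> z Sz; apply: NM; split; first exact: Sr.
  by move=> Az; apply: nex; exists z.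
have : mu S <= mu M by apply: le_measure; rewrite ?inE.
by rewrite M0 leNgt S0.
Qed.

Lemma leb_ball_gt0 (z : V) (r : R) : (0 < r)%R -> 0 < mu [set y : V | (`|y - z| < r)%R].
Proof. by move=> r0; rewrite leb_ball// lte_fin exprn_gt0// mulrn_wgt0. Qed.

(** * The weak inequality: reduction to compact sets, scaling, affine functions *)

Section Equation.
Variables (G : set V) (b c : 'I_n -> 'I_n -> V -> R).
Hypothesis HG : closed_strictly_positive_form G b c.

(** The second alternative of [ash], kept apart because all estimates concern functions that are not
    declared to be identically -oo. *)
Definition ash_proper Om u : Prop :=
  [/\ L1loc Om u, strongly_usc Om u &
      forall w, test_fn Om w -> 0 <= Defs.integral (fun x => u x * (Lop b c w x)%:E)].

Lemma integral_test K u w : compact K -> K `<=` G -> smooth w ->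
  (forall x, ~ K x -> w x = 0%R) -> mu.-integrable (K : set T) (u : T -> \bar R) ->
  mu.-integrable (K : set T) (fun x : T => u x * (Lop b c w x)%:E) /\
  Defs.integral (fun x => u x * (Lop b c w x)%:E) =
    \int[mu]_(x in (K : set T)) (u x * (Lop b c w x)%:E).
Proof.
move=> cK KG sw w0 iu; have mK := measurable_compact cK.
have [B B0 hB] := Lop_bounded HG cK KG sw w0.
have iK : mu.-integrable (K : set T) (fun x : T => u x * (Lop b c w x)%:E).
  apply: integrableMl => //.
    by apply: measurable_funTS; exact: (measurable_Lop HG cK KG sw w0).
  exists B; split; first exact: num_real.
  by move=> t Bt x _ /=; rewrite (le_trans (hB x))// ltW.
split => //.
have E : (fun x => u x * (Lop b c w x)%:E) = (fun x : T => u x * (Lop b c w x)%:E) \_ (K : set T).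
  apply/funext => x; rewrite patchE; case: ifPn => // /negP xK.
  by rewrite (Lop_out b c cK w0) ?mule0// => Kx; apply: xK; exact/mem_set.
rewrite [in LHS]E integral_leb -?integral_mkcond//.
by apply/(integrable_mkcond _ mK).
Qed.

Lemma ash_proper_scale Om u (r : R) : open Om -> Om `<=` G -> (0 < r)%R ->
  ash_proper Om u -> ash_proper Om (fun z => r%:E * u z).
Proof.
move=> oO OG r0 [L1 su tst]; have [u1 u2 u3] := su.
have su' : strongly_usc Om (fun z => r%:E * u z).
  split.
  - move=> z Oz; have := u1 z Oz; case: (u z) => [s _| |_] //; first by rewrite -EFinM ltry.
    by rewrite mulrNy gtr0_sg// mul1e.
  - move=> z Oz t; rewrite -lte_pdivlMl// -EFinM => /(u2 z Oz).
    by apply: filterS => y; rewrite EFinM lte_pdivlMl.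
  - move=> z A Oz fA t; rewrite -lte_pdivrMl// -EFinM => /(u3 z A Oz fA) H e e0.
    by have [y [Ay yz]] := H e e0; rewrite EFinM lte_pdivrMl// => ty; exists y.
have mu1 := measurable_usc oO (strongly_usc_usc su).
have mu2 := measurable_usc oO (strongly_usc_usc su').
have iu := (L1locP oO mu1).1 L1.
split => //.
  apply/(L1locP oO mu2) => K cK KO; apply: integrableZl; last exact: iu.
  exact: measurable_compact.
move=> w tw; have [sw _ [K [cK KO w0]]] := tw.
have mK := measurable_compact cK.
have [i1 e1] := integral_test cK (subset_trans KO OG) sw w0 (iu K cK KO).
have [i2 e2] := integral_test cK (subset_trans KO OG) sw w0 (integrableZl mK r (iu K cK KO)).
rewrite e2; under eq_integral do rewrite -muleA.
by rewrite integralZl// mule_ge0 ?lee_fin ?(ltW r0)// -e1 tst.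
Qed.

Lemma ash_scale Om u (r : R) : open Om -> Om `<=` G -> (0 < r)%R ->
  ash b c Om u -> ash b c Om (fun z => r%:E * u z).
Proof.
move=> oO OG r0 [uN|up]; last by right; exact: ash_proper_scale.
by left => z Oz; rewrite uN// mulrNy gtr0_sg// mul1e.
Qed.

Lemma continuous_affine a (p : 'I_(n + n) -> R) : continuous (affine a p).
Proof. by move=> x; exact/differentiable_continuous/differentiable_affine. Qed.

Lemma continuous_integrable_compact K (f : V -> R) : compact K -> continuous f ->
  mu.-integrable (K : set T) (fun z : T => (f z)%:E).
Proof.
move=> cK cf; have mK := measurable_compact cK.
have [B B0 hB] := continuous_bounded_on cK (fun x _ => cf x).
apply: measurable_bounded_integrable => //.
- have [M M0 KM] := compact_norm_bound cK.
  apply: (@le_lt_trans _ _ (mu [set y : V | (`|y - 0| < M)%R])); last by rewrite leb_ball// ltry.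
  apply: le_measure; rewrite ?inE//; first exact: measurable_ball_bCn.
  by move=> x Kx /=; rewrite subr0; exact: KM.
- by apply: measurable_funTS; exact: continuous_measurable_bCn.
- exists B; split; first exact: num_real.
  by move=> t Bt x Kx /=; rewrite (le_trans (hB x Kx))// ltW.
Qed.

Lemma ash_proper_affine Om a (p : 'I_(n + n) -> R) : open Om -> Om `<=` G ->
  ash_proper Om (fun z => (affine a p z)%:E).
Proof.
move=> oO OG; have ca := @continuous_affine a p.
have su : strongly_usc Om (fun z => (affine a p z)%:E).
  split.
  - by move=> z _; rewrite ltry.
  - move=> z Oz t; rewrite lte_fin => zt.
    have H : \forall y \near z, (affine a p y < t)%R by exact: (cvgr_lt _ (ca z)).
    by apply: filterS H => y; rewrite lte_fin.
  - move=> z A Oz fA t; rewrite lte_fin => tz e e0.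
    have H0 : \forall y \near z, (t < affine a p y)%R by exact: (cvgr_gt _ (ca z)).
    have /nbhs_ballP[r2 /= r20 hr2] := H0.
    have [r1 r10 H] := full_near_meets fA.
    pose r := Num.min r1 (Num.min r2 e).
    have r0 : (0 < r)%R by rewrite !lt_min r10 r20.
    have [||y /= yr|y [/= yr Ay]] := H [set y : V | (`|y - z| < r)%R].
    + exact: measurable_ball_bCn.
    + exact: leb_ball_gt0.
    + by apply: (lt_le_trans yr); rewrite ge_min lexx.
    exists y; split=> //; first by apply: (lt_le_trans yr); rewrite !ge_min lexx !orbT.
    have : ball z r2 y.
      by rewrite ball_CnE /=; apply: (lt_le_trans yr); rewrite !ge_min lexx !orbT.
    by move=> /hr2 /=; rewrite lte_fin.
have mu1 := measurable_usc oO (strongly_usc_usc su).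
split => //; first by apply/(L1locP oO mu1) => K cK _; exact: continuous_integrable_compact.
move=> w [sw _ [K [cK KO w0]]].
have [_] := integral_affine_Lop HG cK (subset_trans KO OG) sw w0 a p.
have [i1 _] := integral_affine_Lop HG cK (subset_trans KO OG) sw w0 a p.
rewrite -integral_leb// => <-.
by under [X in _ <= Defs.integral X]eq_fun do rewrite -EFinM.
Qed.

End Equation.
End Subharmonic.

(** * The barrier *)

Section SmoothLine.
Variable R : realType.
Implicit Types (U W : set R) (f g : R -> R) (k : nat).

(** Differentiability k times on [U], without continuity of the last derivative. Only the
    conjunction over all k is used for smoothness. *)
Fixpoint Ck k U f : Prop :=
  if k is k'.+1 then (forall t, U t -> derivable f t 1) /\ Ck k' U (f^`())%classic else True.

Lemma Ck_ext k U f g : open U -> (forall t, U t -> f t = g t) -> Ck k U f -> Ck k U g.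
Proof.
move=> oU; elim: k f g => [//|k IH] f g fg [df cf].
have nfg t : U t -> {near t, f =1 g}.
  by move=> Ut; have : nbhs t U by [exact: open_nbhs_nbhs]; apply: filterS => s; exact: fg.
split => [t Ut|].
  by apply: (near_eq_derivable (f := f)); [exact: nfg|exact: df].
apply: IH cf => t Ut; rewrite !derive1E; apply: near_eq_derive; exact: nfg.
Qed.

Lemma Ck_is_derive k U f f' : open U ->
  (forall t, U t -> is_derive t (1 : R) f (f' t)) -> Ck k U f' -> Ck k.+1 U f.
Proof.
move=> oU df cf; split => [t /df[]//|].
by apply: Ck_ext cf => // t /df[_]; rewrite derive1E => ->.
Qed.

Lemma Ck_is_derive1 k U f t : Ck k.+1 U f -> U t -> is_derive t (1 : R) f (f^`()%classic t).
Proof. by move=> [df _] Ut; rewrite derive1E; apply: derivableP; exact: df. Qed.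

Lemma Ck_sub k U W f : U `<=` W -> Ck k W f -> Ck k U f.
Proof. by move=> UW; elim: k f => [//|k IH] f [df cf]; split => [t /UW|]; [exact: df|exact: IH]. Qed.

Lemma CkU k U W f : Ck k U f -> Ck k W f -> Ck k (U `|` W) f.
Proof.
elim: k f => [//|k IH] f [df cf] [dg cg]; split; last exact: IH.
by move=> t [/df|/dg].
Qed.

Lemma Ck_pred k U f : Ck k.+1 U f -> Ck k U f.
Proof. by elim: k f => [//|k IH] f [df cf]; split => //; exact: IH. Qed.

Lemma Ck_cst k U (r : R) : open U -> Ck k U (fun=> r).
Proof.
move=> oU; elim: k r => [//|k IH] r.
apply: (@Ck_is_derive _ _ _ (fun=> 0)) => //.
Qed.

Lemma Ck_id k U : open U -> Ck k U id.
Proof.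
move=> oU; case: k => [//|k].
apply: (@Ck_is_derive _ _ _ (fun=> 1)) => //; last exact: Ck_cst.
Qed.

Lemma CkD k U f g : open U -> Ck k U f -> Ck k U g -> Ck k U (fun t => f t + g t).
Proof.
move=> oU; elim: k f g => [//|k IH] f g cf cg.
apply: (@Ck_is_derive _ _ _ (fun t => f^`()%classic t + g^`()%classic t)) => //.
  by move=> t Ut; exact: (is_deriveD (Ck_is_derive1 cf Ut) (Ck_is_derive1 cg Ut)).
by apply: IH; [case: cf|case: cg].
Qed.

Lemma CkM k U f g : open U -> Ck k U f -> Ck k U g -> Ck k U (fun t => f t * g t).
Proof.
move=> oU; elim: k f g => [//|k IH] f g cf cg.
apply: (@Ck_is_derive _ _ _ (fun t => f t * g^`()%classic t + g t * f^`()%classic t)) => //.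
  by move=> t Ut; exact: (is_deriveM (Ck_is_derive1 cf Ut) (Ck_is_derive1 cg Ut)).
by apply: CkD => //; apply: IH; by [case: cf|case: cg|exact: Ck_pred].
Qed.

Lemma Ck_comp k U W f g : open U -> open W -> (forall t, U t -> W (g t)) ->
  Ck k W f -> Ck k U g -> Ck k U (fun t => f (g t)).
Proof.
move=> oU oW UW; elim: k f => [//|k IH] f cf cg.
apply: (Ck_is_derive oU (f' := fun t => f^`()%classic (g t) * g^`()%classic t)).
  by move=> t Ut; exact: (is_derive1_comp (Ck_is_derive1 cf (UW _ Ut)) (Ck_is_derive1 cg Ut)).
apply: CkM => //; last by case: cg.
by apply: IH; [case: cf|exact: Ck_pred].
Qed.

Lemma Ck_continuous U f t : Ck 1 U f -> U t -> {for t, continuous f}.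
Proof. by move=> [df _] Ut; exact/differentiable_continuous/derivable1_diffP/df. Qed.

Lemma Ck_expR k : Ck k setT (@expR R).
Proof.
elim: k => [//|k IH]; apply: (@Ck_is_derive _ _ _ (@expR R)) => //.
exact: openT.
Qed.

Lemma is_derive_inv (t : R) : t != 0 -> is_derive t (1 : R) (fun s => s^-1) (- (t^-1 * t^-1)).
Proof.
move=> t0; have di : derivable (fun t : R => t^-1) t 1 by apply: (@derivableV _ _ id).
apply: DeriveDef => //.
by rewrite (@deriveV _ _ id)//= derive_id /GRing.scale/= mulr1 expr2 invfM.
Qed.

Lemma Ck_inv k U : open U -> (forall t, U t -> t != 0) -> Ck k U (fun t => t^-1).
Proof.
move=> oU U0; elim: k => [//|k IH].
apply: (@Ck_is_derive _ _ _ (fun t => (-1) * (t^-1 * t^-1))) => //.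
  by move=> t /U0; rewrite mulN1r; exact: is_derive_inv.
by do ?apply: CkM => //; exact: Ck_cst.
Qed.

Lemma Ck_ln k U : open U -> (forall t, U t -> 0 < t) -> Ck k U (@ln R).
Proof.
move=> oU U0; case: k => [//|k].
apply: (@Ck_is_derive _ _ _ (fun t => t^-1)) => //.
  by move=> t /U0; exact: is_derive1_ln.
by apply: Ck_inv => // t /U0; exact: lt0r_neq0.
Qed.

(* The family t^-p exp(-1/t), closed under differentiation up to linear combinations. *)
Definition flat (p : nat) (t : R) : R := if 0 < t then t^-1 ^+ p * expR (- t^-1) else 0.

Lemma flat_ge0 p t : 0 <= flat p t.
Proof.
rewrite /flat; case: ifPn => // t0.
by rewrite mulr_ge0 ?exprn_ge0 ?invr_ge0 ?(ltW t0)// expR_ge0.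
Qed.

Lemma flat_le0 p t : t <= 0 -> flat p t = 0.
Proof. by rewrite /flat leNgt => /negbTE ->. Qed.

Lemma flat0_gt0 t : 0 < t -> 0 < flat 0 t.
Proof. by move=> t0; rewrite /flat t0 expr0 mul1r expR_gt0. Qed.

Lemma flat0_le1 t : flat 0 t <= 1.
Proof.
rewrite /flat; case: ifPn => // t0.
by rewrite expr0 mul1r expR_le1 oppr_le0 invr_ge0 ltW.
Qed.

(** From exp(1/t) >= (1/t)^(p+2) / (p+2)!. The quadratic bound yields differentiability at 0 with
    derivative 0. *)
Lemma flat_quadratic p : exists2 C : R, 0 < C & forall t, `|flat p t| <= C * t ^+ 2.
Proof.
exists (p.+2)`!%:R; first by rewrite ltr0n fact_gt0.
move=> t; rewrite ger0_norm ?flat_ge0// /flat; case: ifPn => t0; last first.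
  by rewrite mulr_ge0// sqr_ge0.
have i0 : 0 < t^-1 by rewrite invr_gt0.
have := expR_ge1Dxn p.+1 (ltW i0).
have : 0 < (p.+2)`!%:R :> R by rewrite ltr0n fact_gt0.
rewrite expRN; set F := _%:R; set E := expR _ => F0 H.
have E0 : 0 < E by exact: expR_gt0.
have {}H : t^-1 ^+ p.+2 <= F * E.
  rewrite mulrC -ler_pdivrMr//; apply: le_trans H; by rewrite lerDr.
rewrite ler_pdivrMr//.
have -> : t^-1 ^+ p = t^-1 ^+ p.+2 * t ^+ 2.
  by rewrite -addn2 exprD -mulrA -exprMn mulVf ?lt0r_neq0// expr1n mulr1.
by rewrite [leRHS]mulrAC ler_pM2r ?exprn_gt0.
Qed.

Lemma is_derive_quadratic f (C : R) : (forall t, `|f t| <= C * t ^+ 2) -> is_derive 0 (1 : R) f 0.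
Proof.
move=> fC.
have f0 : f 0 = 0 by apply/eqP; rewrite -normr_le0 (le_trans (fC 0))// expr0n mulr0.
have cv : h^-1 *: ((f \o shift 0) (h *: 1) - f 0) @[h --> 0^'] --> (0 : R).
  apply/cvgr0Pnorm_lt => e e0.
  have C0 : 0 <= C by have := le_trans (normr_ge0 _) (fC 1); rewrite expr1n mulr1.
  near=> h; rewrite /= addr0 f0 subr0 [h *: 1]mulr1 normrM normfV.
  have h0 : h != 0 by near: h; exact: nbhs_dnbhs_neq.
  have nh0 : 0 < `|h| by rewrite normr_gt0.
  rewrite mulrC ltr_pdivrMr//.
  apply: (le_lt_trans (fC h)); rewrite -[h ^+ 2]ger0_norm ?sqr_ge0// normrX expr2 mulrA ltr_pM2r//.
  have : `|h| < e / (C + 1) by near: h; apply: dnbhs0_lt; rewrite divr_gt0// ltr_wpDl.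
  rewrite ltr_pdivlMr ?ltr_wpDl// mulrC; apply: le_lt_trans.
  by rewrite ler_pM2r// lerDl.
apply: DeriveDef; first by apply/cvg_ex; exists 0.
exact/cvg_lim.
Unshelve. all: by end_near. Qed.

Lemma is_derive_flat p t : is_derive t (1 : R) (flat p) (flat p.+2 t - p%:R * flat p.+1 t).
Proof.
have [t0|t0|->] := ltgtP t 0.
- rewrite !(flat_le0 _ (ltW t0)) mulr0 subr0.
  apply: (@near_eq_is_derive _ _ _ (cst (0 : R)) _ t 1 0 _ (is_derive_cst (0 : R) t 1)).
  by near=> s; rewrite flat_le0// ltW//; near: s; exact: lt_nbhsl.
- have t00 : t != 0 by rewrite gt_eqF.
  have di := is_derive_inv t00.
  have dX : is_derive t (1 : R) (fun s => s^-1 ^+ p) (- p%:R * t^-1 ^+ p.+1).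
    have -> : (fun s : R => s^-1 ^+ p) = (fun s : R => s^-1) ^+ p.
      by apply/funext => s; rewrite fctE.
    apply: (is_derive_eq (is_deriveX p di)).
    rewrite /GRing.scale/=; case: p => [|p]; first by rewrite !mul0r oppr0 mul0r.
    by rewrite !exprS/= mulrN mulNr -!mulrA [t^-1 ^+ p * _]mulrC -!mulrA.
  have dE : is_derive t (1 : R) (fun s => expR (- s^-1)) (expR (- t^-1) * (t^-1 * t^-1)).
    have H := @is_derive1_comp R expR (fun s => - s^-1) t _ _ (is_derive_expR (- t^-1)) (is_deriveN di).
    by apply: (is_derive_eq H); rewrite opprK.
  have dM := is_deriveM dX dE.
  have E : flat p.+2 t - p%:R * flat p.+1 t =
      t^-1 ^+ p *: (expR (- t^-1) * (t^-1 * t^-1)) + expR (- t^-1) *: (- p%:R * t^-1 ^+ p.+1).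
    rewrite /flat t0 /GRing.scale/= !exprS; ring.
  rewrite E; apply: near_eq_is_derive dM.
  by near=> s; rewrite /flat ifT//; near: s; exact: lt_nbhsr.
- rewrite !flat_le0// mulr0 subr0.
  by have [C _ hC] := flat_quadratic p; exact: is_derive_quadratic hC.
Unshelve. all: by end_near. Qed.

Lemma Ck_flat k p : Ck k setT (flat p).
Proof.
elim: k p => [//|k IH] p.
apply: (@Ck_is_derive _ _ _ (fun t => flat p.+2 t + (- p%:R) * flat p.+1 t)).
- exact: openT.
- by move=> t _; rewrite mulNr; exact: is_derive_flat.
- by apply: CkD; [exact: openT|exact: IH|apply: CkM => //; [exact: openT|apply: Ck_cst; exact: openT]].
Qed.

End SmoothLine.

(** * Antiderivatives and a smooth step *)

Section Antiderivative.
Variable R : realType.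

Lemma antiderivative (g : R -> R) (A B : R) : continuous g ->
  (forall t, ~~ (A <= t <= B) -> g t = 0) ->
  exists F : R -> R, forall t, is_derive t (1 : R) F (g t).
Proof.
move=> cg g0.
have mI : measurable (`[A, B] : set (measurableTypeR R)) by [].
have ig : (@lebesgue_measure R).-integrable setT (EFin \o g).
  rewrite (_ : EFin \o g = (EFin \o g) \_ `[A, B]); last first.
    apply/funext => t; rewrite patchE; case: ifPn => // /negP tAB /=.
    by rewrite g0//; apply/negP => H; apply: tAB; apply/mem_set; rewrite /= in_itv.
  apply/(integrable_mkcond _ mI).
  apply: continuous_compact_integrable; first exact: segment_compact.
  exact: continuous_subspaceT.
exists (fun x => (\int[lebesgue_measure]_(t in [set` `]-oo, x]%R]) (g t))%R) => t.
have tt : t < t + 1 by rewrite ltrDl.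
have it : (@lebesgue_measure R).-integrable [set` Interval -oo%O (BRight (t + 1))] (EFin \o g).
  exact: (@integrableS _ _ _ _ setT).
have [dF <-] := continuous_FTC1 tt it (ltNyr _) (cg t).
by rewrite derive1E; exact: derivableP.
Qed.

Lemma derive0_cst (F : R -> R) (a b : R) : a <= b ->
  (forall t, a <= t <= b -> is_derive t (1 : R) F 0) -> F a = F b.
Proof.
rewrite le_eqVlt => /predU1P[->//|ab] dF.
have dF' t : t \in `]a, b[ -> is_derive t (1 : R) F 0.
  by rewrite in_itv/= => /andP[ta tb]; apply: dF; rewrite !ltW.
have [|c _] := @MVT R F (fun=> 0) a b ab dF'.
  apply: derivable_within_continuous => t; rewrite in_itv/= => tab.
  by have [] := dF t tab.
by rewrite mul0r => /eqP; rewrite subr_eq0 => /eqP.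
Qed.

Lemma ge0_derive_ndecr (F f : R -> R) (a b : R) : a <= b ->
  (forall t, is_derive t (1 : R) F (f t)) -> (forall t, 0 <= f t) -> F a <= F b.
Proof.
rewrite le_eqVlt => /predU1P[->//|ab] dF f0.
have [|c _ E] := @MVT R F f a b ab (fun t _ => dF t).
  by apply: derivable_within_continuous => t _; have [] := dF t.
by rewrite -subr_ge0 E mulr_ge0// subr_ge0 ltW.
Qed.

(** [X] integrates a bump carried by [1/2, 1]. The height [I] of the step is not normalised; it is
    absorbed by the constant [c0] of the profile. *)
Lemma smooth_step : exists (X X' : R -> R) (I : R),
  [/\ 0 < I, forall k, Ck k setT X, (forall t, is_derive t (1 : R) X (X' t)),
      (forall t, 0 <= X' t <= 1) &
      [/\ forall t, t <= 2^-1 -> X t = 0 /\ X' t = 0,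
          forall t, 1 <= t -> X t = I /\ X' t = 0 & forall t, 0 <= X t]].
Proof.
pose X' (t : R) := flat 0 (t - 2^-1) * flat 0 (1 - t).
have oT := @openT R.
have cX' k : Ck k setT X'.
  have cl k' (p q : R) : Ck k' setT (fun t : R => p * t + q).
    by apply: CkD => //; [apply: CkM => //; [exact: Ck_cst|exact: Ck_id]|exact: Ck_cst].
  apply: CkM => //; apply: (@Ck_comp _ _ _ setT (flat 0)) => //; try exact: Ck_flat.
  - apply: (Ck_ext oT _ (cl k 1 (- 2^-1))) => t _; by rewrite mul1r.
  - apply: (Ck_ext oT _ (cl k (-1) 1)) => t _; by rewrite mulN1r addrC.
have X'1 t : 0 <= X' t <= 1.
  by rewrite mulr_ge0 ?flat_ge0//= mulr_ile1 ?flat_ge0 ?flat0_le1.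
have X'l t : t <= 2^-1 -> X' t = 0 by move=> t2; rewrite /X' flat_le0 ?mul0r// subr_le0.
have X'r t : 1 <= t -> X' t = 0 by move=> t2; rewrite /X' [X in _ * X]flat_le0 ?mulr0// subr_le0.
have cont : continuous X'.
  by move=> t; exact: (@Ck_continuous _ setT X' t (cX' 1%N) I).
have [|Y dY] := @antiderivative X' (2^-1) 1 cont.
  by move=> t; rewrite negb_and -!ltNge => /orP[/ltW/X'l|/ltW/X'r].
pose X t := Y t - Y 2^-1.
have dX t : is_derive t (1 : R) X (X' t).
  by have := is_deriveB (dY t) (is_derive_cst (Y 2^-1) t 1); rewrite subr0.
have Xl t : t <= 2^-1 -> X t = 0.
  move=> t2; apply/eqP; rewrite subr_eq0; apply/eqP; apply: derive0_cst => // s /andP[_ s2].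
  by rewrite -(X'l _ s2).
have Xr t : 1 <= t -> X t = X 1.
  move=> t2; congr (_ - _); apply/esym; apply: derive0_cst => // s /andP[s2 _].
  by rewrite -(X'r _ s2).
have X0 t : 0 <= X t.
  have [/Xl ->//|/ltW t2] := leP t 2^-1.
  rewrite -(Xl 2^-1)//; apply: (ge0_derive_ndecr t2 dX) => s; by case/andP: (X'1 s).
exists X, X', (X 1); split=> //.
- have h1 : 2^-1 < 1 :> R by lra.
  rewrite lt_neqAle X0 andbT eq_sym; apply/negP => /eqP X10.
  have Xz t : 2^-1 <= t <= 1 -> X t = 0.
    move=> /andP[t1 t2]; apply/eqP; rewrite eq_le X0 andbT -X10.
    by apply: (ge0_derive_ndecr t2 dX) => s; case/andP: (X'1 s).
  (* If [X 1] were 0, the mean value theorem would produce a zero of [X'] strictly between 1/2 and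
     1, where both flat factors are positive. *)
  have [|c] := @MVT R X X' 2^-1 1 h1 (fun t _ => dX t).
    by apply: derivable_within_continuous => t _; have [] := dX t.
  rewrite in_itv/= => /andP[c1 c2] /eqP; rewrite X10 Xl// subrr eq_sym mulf_eq0 subr_eq0 (gt_eqF h1) orbF.
  by rewrite /X' mulf_eq0 !gt_eqF// flat0_gt0// subr_gt0.
- by case=> [//|k]; apply: (Ck_is_derive oT (f' := X')).
- by split=> // t t2; [rewrite Xl// X'l|rewrite Xr// X'r].
Qed.

End Antiderivative.

(** * The radial profile of the barrier *)

Section Profile.
Variable R : realType.

(* The logarithmic derivative of [core m beta] is [- (m / t + beta / (2 sqrt t))]: the singularity
   [t^-m] of the fundamental solution, corrected so that the error terms of order
   [sqrt t] of a Lipschitz perturbation are absorbed. *)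
Definition core (m : nat) (beta : R) (t : R) : R :=
  expR (- m%:R * ln t + (- beta) * expR (2^-1 * ln t)).

Lemma Ck_core m beta k : Ck k [set t : R | 0 < t] (core m beta).
Proof.
have oP : open [set t : R | 0 < t] by exact: open_gt.
have cl : Ck k [set t : R | 0 < t] (@ln R) by apply: Ck_ln.
apply: (@Ck_comp _ _ _ setT expR) => //; [exact: openT|exact: Ck_expR|].
apply: CkD => //; first by apply: CkM => //; exact: Ck_cst.
apply: CkM => //; first exact: Ck_cst.
apply: (@Ck_comp _ _ _ setT expR) => //; [exact: openT|exact: Ck_expR|].
by apply: CkM => //; exact: Ck_cst.
Qed.

(** The square root enters [core] as exp((ln t) / 2), so that smoothness for t > 0 follows from that
    of exp and ln. *)
Lemma sqrt_exp_ln (q : R) : 0 < q -> expR (2^-1 * ln (q ^+ 2)) = q.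
Proof.
by move=> q0; rewrite lnXn// -[ln q *+ 2]mulr_natl mulrA mulVf// mul1r lnK.
Qed.

Lemma coreE m beta (q : R) : 0 < q ->
  core m beta (q ^+ 2) = (q ^+ 2) ^- m * expR (- beta * q).
Proof.
move=> q0; rewrite /core sqrt_exp_ln// expRD; congr (_ * _).
by rewrite mulNr expRN mulrC expRM_natr lnK// posrE exprn_gt0.
Qed.

Lemma is_derive_core m beta (q : R) : 0 < q ->
  is_derive (q ^+ 2) (1 : R) (core m beta)
    (- core m beta (q ^+ 2) * (m%:R / q ^+ 2 + beta * q / (2 * q ^+ 2))).
Proof.
move=> q0; have t0 : 0 < q ^+ 2 by rewrite exprn_gt0.
have dl := is_derive1_ln t0.
have d1 := is_deriveM (is_derive_cst (2^-1 : R) (q ^+ 2) 1) dl.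
have d2 := @is_derive1_comp R expR (fun t => 2^-1 * ln t) _ _ _ (is_derive_expR _) d1.
have d3 := is_deriveM (is_derive_cst (- beta : R) (q ^+ 2) 1) d2.
have d4 := is_deriveM (is_derive_cst (- m%:R : R) (q ^+ 2) 1) dl.
have d5 := is_deriveD d4 d3.
have d6 := @is_derive1_comp R expR (fun t => - m%:R * ln t + - beta * expR (2^-1 * ln t)) _ _ _ (is_derive_expR _) d5.
apply: (is_derive_eq d6).
rewrite -/(core m beta (q ^+ 2)) /GRing.scale/= sqrt_exp_ln// !mulr0 !addr0.
move: (core _ _ _) => c; field.
by rewrite gt_eqF.
Qed.

(** For a = q^2 and d = 2m the terms without beta and [S] cancel. The deviations of a and d cost at
    most (4 kappa m + 2 kappa) q = beta q, while the beta term yields 2 beta q (1 - kappa q) >= beta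
    q. What is left comes from [S], the contribution of the outer cut-off. *)
Lemma bracket_ge (m : nat) (kappa beta q a d S T : R) :
  beta = 4 * kappa * m%:R + 2 * kappa -> 0 <= kappa -> 0 < q -> 0 < T ->
  kappa * q <= 2^-1 -> `|a - q ^+ 2| <= kappa * q ^+ 2 * q -> `|d - 2 * m%:R| <= kappa * q ->
  T^-1 <= S ->
  2 * q ^+ 2 / T <= 4 * a * (m%:R / q ^+ 2 + beta * q / (2 * q ^+ 2) + S) - 2 * d.
Proof.
move=> betaE k0 q0 T0 kq; rewrite !ler_distl => /andP[a1 _] /andP[_ d2] TS.
have t0 : 0 < q ^+ 2 by rewrite exprn_gt0.
have b0 : 0 <= beta by rewrite betaE addr_ge0// !mulr_ge0.
have a2 : q ^+ 2 * (1 - kappa * q) <= a by move: a1; lra.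
have a3 : q ^+ 2 / 2 <= a.
  by apply: le_trans a2; rewrite ler_pM2l//; move: kq; lra.
have s1 : 2 * q ^+ 2 / T <= 4 * a * S.
  have -> : 2 * q ^+ 2 / T = (4 * (q ^+ 2 / 2)) * T^-1 by field; rewrite gt_eqF.
  apply: ler_pM => //.
  - by move: t0; lra.
  - by rewrite invr_ge0 ltW.
  - by rewrite ler_pM2l.
have s2 : 4 * (1 - kappa * q) * (m%:R + beta * q / 2) <=
    4 * a * (m%:R / q ^+ 2 + beta * q / (2 * q ^+ 2)).
  have -> : 4 * a * (m%:R / q ^+ 2 + beta * q / (2 * q ^+ 2)) =
     4 * (a / q ^+ 2) * (m%:R + beta * q / 2) by field; rewrite gt_eqF.
  apply: ler_wpM2r; first by rewrite addr_ge0// divr_ge0// mulr_ge0// ltW.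
  by rewrite ler_pM2l// ler_pdivlMr// mulrC.
have s3 : 2 * d <= 4 * (1 - kappa * q) * (m%:R + beta * q / 2).
  have H : 0 <= beta * q * (1 - 2 * (kappa * q)).
    by rewrite mulr_ge0 ?mulr_ge0 ?(ltW q0)// subr_ge0; move: kq; lra.
  rewrite -subr_ge0; have {}d2 : 2 * d <= 4 * m%:R + 2 * (kappa * q) by move: d2; lra.
  have -> : 4 * (1 - kappa * q) * (m%:R + beta * q / 2) - 2 * d =
    (4 * m%:R + 2 * (kappa * q) - 2 * d) + beta * q * (1 - 2 * (kappa * q))
      + q * (beta - 4 * kappa * m%:R - 2 * kappa) by field.
  have -> : beta - 4 * kappa * m%:R - 2 * kappa = 0 by rewrite betaE; ring.
  by rewrite mulr0 addr0 addr_ge0// subr_ge0.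
rewrite mulrDr; move: s1 s2 s3; lra.
Qed.

(** [v] is the operator applied to F of a quadratic form with value q^2, as in [Lop_quadf]. The
    construction takes F' = -G, where [G] is a multiple of [core] cut off near [T] and below [tau].
    [G] is of order t^(-m), which in real dimension 2m is the derivative of the fundamental solution
    with respect to t = |y|^2. *)
Lemma profile (m : nat) (kappa : R) : (0 < m)%N -> 0 <= kappa ->
  exists2 C : R, 0 < C & forall T tau : R, 0 < T -> T <= 1 ->
    kappa ^+ 2 * T <= 4^-1 -> 0 < tau ->
  exists F : R -> R, [/\ forall k, Ck k setT F, forall t, 0 <= F t, forall t, T <= t -> F t = 0 &
    forall q a d, 0 <= q -> `|a - q ^+ 2| <= kappa * q ^+ 2 * q -> `|d - 2 * m%:R| <= kappa * q ->
    let v := 4 * a * (F^`()^`())%classic (q ^+ 2) + 2 * d * (F^`())%classic (q ^+ 2) in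
    [/\ tau <= q ^+ 2 -> 0 <= v, tau <= q ^+ 2 <= T / 2 -> T ^- m <= v & - C * tau ^- m <= v]].
Proof.
move=> m0 k0; have [X [X' [I [I0 cX dX X'01 [Xl Xr X0]]]]] := smooth_step R.
pose beta := 4 * kappa * m%:R + 2 * kappa.
have b0 : 0 <= beta by rewrite /beta addr_ge0// !mulr_ge0.
(* A lower bound for t <= T/2: [I] is the height of the step, exp(-beta) bounds the correction in
   [core] since q <= 1, exp(-2) bounds the outer cut-off, and 2 comes from [bracket_ge]. *)
pose c0 := 2 * I * expR (- beta - 2).
have c00 : 0 < c0 by rewrite !mulr_gt0// expR_gt0.
(* The only loss is due to the derivative of the step: 6 = 4 * (3/2) from a <= 3t/2, and 2^m from t
   >= tau/2. *)
exists (c0^-1 * (6 * 2 ^+ m)); first by rewrite mulr_gt0 ?invr_gt0// mulr_gt0// exprn_gt0.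
move=> T tau T0 T1 kT tau0.
have oT := @openT R.
(* For t < T this is exp(-1/s) with s = 1 - t/T. Its logarithmic derivative -1/(T s^2) supplies the
   term [S] of [bracket_ge], which is at least 1/T because s <= 1. *)
pose E (t : R) := flat 0 (1 + (- T^-1) * t).
pose Y (t : R) := X (tau^-1 * t).
pose G (t : R) := c0^-1 * (core m beta t * E t * Y t).
have cE k : Ck k setT E.
  apply: (@Ck_comp _ _ _ setT (flat 0)) => //; first exact: Ck_flat.
  by apply: CkD => //; [exact: Ck_cst|apply: CkM => //; [exact: Ck_cst|exact: Ck_id]].
have cY k : Ck k setT Y.
  by apply: (@Ck_comp _ _ _ setT X) => //; apply: CkM => //; [exact: Ck_cst|exact: Ck_id].
have Yl t : t <= tau / 2 -> Y t = 0.
  by move=> tt; rewrite /Y (Xl _ _).1// mulrC ler_pdivrMr// mulrC.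
have Gl t : t <= tau / 2 -> G t = 0 by move=> tt; rewrite /G Yl// !mulr0.
have Gr t : T <= t -> G t = 0.
  by move=> tT; rewrite /G /E flat_le0 ?mulr0 ?mul0r ?mulr0// mulNr subr_le0 mulrC ler_pdivlMr// mul1r.
have oP : open [set t : R | 0 < t] by exact: open_gt.
have oL : open [set t : R | t < tau / 2] by exact: open_lt.
have tau20 : 0 < tau / 2 by rewrite divr_gt0.
have cG k : Ck k setT G.
  (* [core] is smooth for t > 0 only, and [Y] makes [G] vanish for t < tau/2; the two half-lines
     cover the line. *)
  apply: (@Ck_sub _ _ _ ([set t : R | 0 < t] `|` [set t : R | t < tau / 2])).
    move=> t _; have [t0|t0] := ltP 0 t; first by left.
    by right; exact: le_lt_trans tau20.
  apply: CkU; last first.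
    by apply: (Ck_ext oL _ (Ck_cst k 0 oL)) => t /= tt; rewrite Gl// ltW.
  have sub U : U `<=` [set: R] by [].
  apply: CkM => //; first exact: Ck_cst.
  apply: CkM => //; last exact: Ck_sub (cY k).
  by apply: CkM => //; [exact: Ck_core|exact: Ck_sub (cE k)].
have cNG k : Ck k setT (fun t => - G t).
  apply: (@Ck_ext _ _ _ (fun t => (-1) * G t)) => // [t _|]; first by rewrite mulN1r.
  by apply: CkM => //; exact: Ck_cst.
have contG : continuous (fun t => - G t).
  by move=> t; exact: (@Ck_continuous _ setT (fun t => - G t) t (cNG 1%N) Logic.I).
have G0 t : ~~ (tau / 2 <= t <= T) -> - G t = 0.
  by rewrite negb_and -!ltNge => /orP[/ltW/Gl ->|/ltW/Gr ->]; rewrite oppr0.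
have [P dP] := antiderivative contG G0.
pose F t := P t - P T.
have dF t : is_derive t (1 : R) F (- G t).
  by have := is_deriveB (dP t) (is_derive_cst (P T) t 1); rewrite subr0.
have F1 : (F^`())%classic = (fun t => - G t).
  by apply/funext => t; rewrite derive1E; have [_ ->] := dF t.
have GP t : 0 <= G t.
  rewrite /G mulr_ge0 ?invr_ge0 ?(ltW c00)//.
  by rewrite mulr_ge0 ?X0// mulr_ge0 ?flat_ge0// expR_ge0.
have Fr t : T <= t -> F t = 0.
  move=> Tt; apply/eqP; rewrite subr_eq0; apply/eqP/esym; apply: derive0_cst => // s /andP[Ts _].
  by rewrite -oppr0 -(Gr s Ts).
exists F; split => //.
- by case=> [//|k]; apply: (Ck_is_derive oT (f' := fun t => - G t)).
- move=> t; have [/Fr ->//|/ltW tT] := leP T t.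
  rewrite -oppr_le0 -oppr0 -(Fr T)//.
  apply: (@ge0_derive_ndecr R (fun t => - F t) G) => // s.
  by have := is_deriveN (dF s); rewrite opprK.
move=> q a d q0 ha hd v.
have Cn0 : 0 <= c0^-1 * (6 * 2 ^+ m) * tau ^- m.
  by rewrite !mulr_ge0 ?invr_ge0 ?(ltW c00)// exprn_ge0// ltW.
have vE : v = - (4 * a * (G^`())%classic (q ^+ 2)) - 2 * d * G (q ^+ 2).
  rewrite /v F1 mulrN; congr (_ - _); rewrite -mulrN; congr (_ * _).
  rewrite !derive1E deriveN//; by have [+ _] := cG 1%N; apply.
move: q0; rewrite le_eqVlt => /predU1P[q0|q0].
  have v0 : v = 0.
    rewrite vE -q0 expr0n/= Gl ?(ltW tau20)// mulr0 subr0.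
    rewrite derive1E (near_eq_derive (g := cst 0)) ?derive_cst ?mulr0 ?oppr0//.
    near=> s; rewrite Gl// ltW//; near: s; exact: lt_nbhsl.
  rewrite v0; split => //; last by rewrite mulNr oppr_le0.
  by rewrite -q0 expr0n/= leNgt tau0.
have t0 : 0 < q ^+ 2 by rewrite exprn_gt0.
set t := q ^+ 2 in t0 ha hd v vE *.
have dY : is_derive t (1 : R) Y (X' (tau^-1 * t) * tau^-1).
  have H := is_deriveM (is_derive_cst (tau^-1 : R) t 1) (is_derive_id t 1).
  have H2 := @is_derive1_comp R X (fun t => tau^-1 * t) t _ _ (dX _) H.
  by apply: (is_derive_eq H2); rewrite /GRing.scale/= mulr0 addr0 mulr1.
have dE : is_derive t (1 : R) E (- (T^-1 * flat 2 (1 - T^-1 * t))).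
  have H := is_deriveM (is_derive_cst (- T^-1 : R) t 1) (is_derive_id t 1).
  have H1 := is_deriveD (is_derive_cst (1 : R) t 1) H.
  have H2 := @is_derive1_comp R (flat 0) (fun t => 1 + - T^-1 * t) t _ _ (is_derive_flat 0 _) H1.
  apply: (is_derive_eq H2); rewrite /GRing.scale/= mulr0 addr0 mulr1 add0r mul0r subr0 mulrN mulNr.
  by rewrite mulrC.
have dG : (G^`())%classic t = c0^-1 * (
   - core m beta t * (m%:R / t + beta * q / (2 * t)) * E t * Y t
   - core m beta t * (T^-1 * flat 2 (1 - T^-1 * t)) * Y t
   + core m beta t * E t * (X' (tau^-1 * t) * tau^-1)).
  have H := is_deriveM (is_derive_cst (c0^-1 : R) t 1) (is_deriveM (is_deriveM (is_derive_core m beta q0) dE) dY).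
  rewrite derive1E; have [_ ->] := H; rewrite -/t /GRing.scale/= !fctE.
  move: (core m beta t) (E t) (Y t) (X' _) (flat 2 _) (m%:R / t + _) c0^-1 => *; ring.
have c0i : 0 < c0^-1 by rewrite invr_gt0.
have [tT|tT] := leP T t.
  have s0 : 1 - T^-1 * t <= 0 by rewrite subr_le0 mulrC ler_pdivlMr// mul1r.
  have v0 : v = 0.
    by rewrite vE dG Gr// /E [in flat 0 _]mulNr !flat_le0// !(mulr0, mul0r, subr0, addr0, oppr0).
  rewrite v0; split => //; last by rewrite mulNr oppr_le0.
  move=> /andP[_ tT2]; have := le_trans tT tT2; move: T0; lra.
pose s := 1 - T^-1 * t.
have s0 : 0 < s by rewrite subr_gt0 mulrC ltr_pdivrMr// mul1r.
have s1 : s <= 1 by rewrite lerBlDr lerDl mulr_ge0 ?invr_ge0 ?(ltW T0) ?(ltW t0).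
have EE : E t = expR (- s^-1) by rewrite /E /flat mulNr -/s s0 expr0 mul1r.
have E2 : flat 2 (1 - T^-1 * t) = s^-1 ^+ 2 * E t by rewrite EE -/s /flat s0.
have kq : kappa * q <= 2^-1.
  rewrite -(@ler_pXn2r _ 2) ?nnegrE ?mulr_ge0 ?(ltW q0)// exprMn.
  apply: (@le_trans _ _ (kappa ^+ 2 * T)).
    by apply: ler_wpM2l; [rewrite sqr_ge0|exact: ltW].
  by apply: le_trans kT _; rewrite exprVn -natrX.
pose S := T^-1 * s^-1 ^+ 2.
have TS : T^-1 <= S.
  by rewrite ler_peMr ?invr_ge0 ?(ltW T0)// exprn_ege1// invf_ge1.
have br := bracket_ge (erefl beta) k0 q0 T0 kq ha hd TS.
rewrite -/t in br; set B := _ - _ in br.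
have c_gt0 : 0 < core m beta t by exact: expR_gt0.
have E0 : 0 <= E t by exact: flat_ge0.
have a_le : a <= 3 / 2 * t /\ 0 <= a.
  move: ha; rewrite ler_distl => /andP[].
  have : kappa * t * q <= t / 2.
    by rewrite -mulrA [t * q]mulrC mulrA mulrC ler_pM2l.
  move: t0; move: (kappa * t * q) => z; lra.
(* The first term is nonnegative by [bracket_ge]; the second carries the derivative of the step and
   lives on tau/2 < t < tau. *)
have {}vE : v = c0^-1 * (Y t * core m beta t * E t * B
     - 4 * a * core m beta t * E t * (X' (tau^-1 * t) * tau^-1)).
  rewrite vE dG E2 /G /B /S.
  move: (X' (tau^-1 * t)) => x'.
  move: (core m beta t) (E t) (Y t) c0^-1 (s^-1 ^+ 2) (m%:R / t + beta * q / (2 * t)) T^-1 tau^-1 => *; ring.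
have B0 : 0 <= B by apply: le_trans br; rewrite mulr_ge0 ?invr_ge0 ?(ltW T0)// mulr_ge0// ltW.
have main : 0 <= Y t * core m beta t * E t * B.
  by apply: mulr_ge0 => //; apply: mulr_ge0 => //; apply: mulr_ge0; [exact: X0|exact: ltW].
have big : tau <= t -> v = c0^-1 * (Y t * core m beta t * E t * B) /\ Y t = I.
  move=> taut; have h1 : 1 <= tau^-1 * t by rewrite mulrC ler_pdivlMr// mul1r.
  by rewrite vE /Y (Xr _ h1).1 (Xr _ h1).2 mul0r mulr0 subr0.
have v_ge0 : tau <= t -> 0 <= v.
  by move=> /big[-> _]; rewrite mulr_ge0// ltW.
have core_le : core m beta t <= t ^- m.
  rewrite /t coreE// -/t -[leRHS]mulr1 ler_pM2l ?invr_gt0 ?exprn_gt0//.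
  by rewrite expR_le1 mulNr oppr_le0 mulr_ge0// ltW.
split => //.
  move=> /andP[taut tT2]; have [-> YI] := big taut; rewrite YI.
  have q1 : q <= 1.
    rewrite -(@ler_pXn2r _ 2) ?nnegrE ?(ltW q0)// expr1n.
    exact: le_trans (ltW tT) T1.
  have core_ge : t ^- m * expR (- beta) <= core m beta t.
    rewrite /t coreE// -/t ler_pM2l ?invr_gt0 ?exprn_gt0// ler_expR mulNr lerN2.
    by rewrite ler_piMr.
  have s2 : 2^-1 <= s.
    have : T^-1 * t <= 2^-1 by rewrite mulrC ler_pdivrMr// mulrC.
    by rewrite /s; lra.
  have E_ge : expR (- 2) <= E t.
    by rewrite EE ler_expR lerN2 -[leRHS]invrK lef_pV2 ?posrE ?invr_gt0.
  (* Here m >= 1 matters: one power of 1/t pays for the factor t/T of the bracket, the others only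
     grow when T is replaced by t. *)
  have tm : T ^- m <= t ^- m * t / T.
    move: (t) t0 tT m0 => u u0 uT; case: (m) => [//|m'] _.
    rewrite !exprSr !invfM divfK ?gt_eqF// ler_pM2r ?invr_gt0//.
    by rewrite lef_pV2 ?posrE ?exprn_gt0// lerXn2r ?nnegrE ?ltW.
  apply: (le_trans tm).
  have H1 : t ^- m * expR (- beta) * expR (- 2) * (2 * t / T) <= core m beta t * E t * B.
    apply: ler_pM => //.
    - by rewrite !mulr_ge0 ?expR_ge0// invr_ge0 exprn_ge0// ltW.
    - by rewrite mulr_ge0 ?invr_ge0 ?(ltW T0)// mulr_ge0// ltW.
    - by apply: ler_pM => //; rewrite ?expR_ge0// mulr_ge0 ?expR_ge0// invr_ge0 exprn_ge0// ltW.
  rewrite ler_pdivlMl//.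
  have -> : c0 * (t ^- m * t / T) = I * (t ^- m * expR (- beta) * expR (- 2) * (2 * t / T)).
    by rewrite /c0 expRD; ring.
  by rewrite -!mulrA ler_pM2l// !mulrA; rewrite !mulrA in H1.
have [taut|taut] := leP tau t.
  by apply: (le_trans _ (v_ge0 taut)); rewrite mulNr oppr_le0.
have [t2|t2] := leP t (tau / 2).
  have h1 : tau^-1 * t <= 2^-1 by rewrite mulrC ler_pdivrMr// mulrC.
  by rewrite vE (Xl _ h1).2 mul0r mulr0 subr0 (@le_trans _ _ 0)// ?mulNr ?oppr_le0// mulr_ge0// ltW.
have Z : 4 * a * core m beta t * E t * (X' (tau^-1 * t) * tau^-1) <= 6 * 2 ^+ m * tau ^- m.
  have [a3 a0] := a_le; have /andP[x0 x1] := X'01 (tau^-1 * t).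
  apply: (@le_trans _ _ (4 * (3 / 2 * t) * t ^- m * 1 * (1 * tau^-1))).
    apply: ler_pM; rewrite ?mulr_ge0 ?invr_ge0 ?(ltW c_gt0) ?(ltW tau0)//.
      apply: ler_pM; rewrite ?mulr_ge0 ?(ltW c_gt0) ?flat0_le1//.
      by apply: ler_pM; rewrite ?mulr_ge0 ?(ltW c_gt0) ?ler_pM2l.
    by apply: ler_wpM2r; rewrite ?invr_ge0 ?(ltW tau0).
  have -> : 4 * (3 / 2 * t) * t ^- m * 1 * (1 * tau^-1) = 6 * (t ^- m) * (t / tau) by field; rewrite !gt_eqF// exprn_gt0.
  have tm : t ^- m <= 2 ^+ m * tau ^- m.
    have -> : 2 ^+ m * tau ^- m = (tau / 2) ^- m by rewrite -[RHS]exprVn invfM invrK exprMn exprVn mulrC.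
    by rewrite lef_pV2 ?posrE ?exprn_gt0// lerXn2r ?nnegrE ?ltW.
  apply: (@le_trans _ _ (6 * t ^- m)).
    apply: ler_piMr; last by rewrite ler_pdivrMr// mul1r ltW.
    by apply: mulr_ge0 => //; rewrite invr_ge0; apply: exprn_ge0; exact: ltW.
  by rewrite -mulrA ler_pM2l.
have -> : - (c0^-1 * (6 * 2 ^+ m)) * tau ^- m = c0^-1 * (- (6 * 2 ^+ m * tau ^- m)) by ring.
rewrite vE ler_pM2l// lerNl opprB.
by apply: le_trans Z; rewrite gerDl oppr_le0.
Unshelve. all: by end_near. Qed.

End Profile.

(** * Smooth functions on C^n and composition with quadratic forms *)

Section SmoothCn.
Variables (R : realType) (n : nat).
Local Notation V := (Cn R n).
Implicit Types (f g : V -> R) (k : nat).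

Fixpoint Cs k f : Prop :=
  if k is k'.+1 then (forall x, differentiable f x) /\ forall i, Cs k' ('D_(ev R i) f) else True.

Lemma dpath_rcons s i f : dpath (rcons s i) f = dpath s ('D_(ev R i) f).
Proof. by elim: s => [//|j s IH] /=; rewrite IH. Qed.

Lemma smooth_Cs f : (forall k, Cs k f) -> smooth f.
Proof.
move=> cf s x; have {cf} := cf (size s).+1.
elim/last_ind: s f => [|s i IH] f; first by case=> + _; apply.
by rewrite size_rcons dpath_rcons => -[_ /(_ i)] ci; apply: IH.
Qed.

Lemma Cs_pred k f : Cs k.+1 f -> Cs k f.
Proof. by elim: k f => [//|k IH] f [df cf]; split => // i; exact/IH/cf. Qed.

Lemma CsD k f g : Cs k f -> Cs k g -> Cs k (f + g).
Proof.
elim: k f g => [//|k IH] f g [df cf] [dg cg]; split => [x|i].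
  exact: differentiableD.
rewrite (_ : 'D_(ev R i) (f + g) = 'D_(ev R i) f + 'D_(ev R i) g); first exact: IH (cf i) (cg i).
by apply/funext => x; rewrite deriveD//; exact/diff_derivable.
Qed.

Lemma CsM k f g : Cs k f -> Cs k g -> Cs k (f * g).
Proof.
elim: k f g => [//|k IH] f g cf cg; have [df cf'] := cf; have [dg cg'] := cg.
split => [x|i]; first exact: differentiableM.
rewrite (_ : 'D_(ev R i) (f * g) = f * 'D_(ev R i) g + g * 'D_(ev R i) f).
  exact: (CsD (IH _ _ (Cs_pred cf) (cg' i)) (IH _ _ (Cs_pred cg) (cf' i))).
by apply/funext => x; rewrite deriveM; [|exact/diff_derivable/df|exact/diff_derivable/dg].
Qed.

Lemma Cs_cst k (r : R) : Cs k (cst r).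
Proof.
elim: k r => [//|k IH] r; split => [x|i]; first exact: differentiable_cst.
rewrite (_ : 'D_(ev R i) (cst r) = cst 0); first exact: IH.
by apply/funext => x; rewrite derive_cst.
Qed.

Lemma Cs_affine k a (p : 'I_(n + n) -> R) : Cs k (affine a p).
Proof.
case: k => [//|k]; split => [x|i]; first exact: differentiable_affine.
rewrite (_ : 'D_(ev R i) (affine a p) = cst (p i)); first exact: Cs_cst.
by apply/funext => x; rewrite derive_affine.
Qed.

Lemma Cs_sum k (I : Type) (s : seq I) (F : I -> V -> R) :
  (forall i, Cs k (F i)) -> Cs k (\sum_(i <- s) F i).
Proof.
move=> cF; elim: s => [|i s IH]; first by rewrite big_nil; exact: Cs_cst.
by rewrite big_cons; exact: CsD.
Qed.

Lemma derive_comp1 (F : R -> R) (q : V -> R) x v :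
  derivable F (q x) 1 -> differentiable q x ->
  differentiable (fun x => F (q x)) x /\
  'D_v (fun x => F (q x)) x = (F^`())%classic (q x) * 'D_v q x.
Proof.
move=> dF dq; have dF' : differentiable F (q x) by exact/derivable1_diffP.
have dc : differentiable (F \o q) x by exact: differentiable_comp.
split => //; rewrite (deriveE _ dc) diff_comp//= deriv1E// (deriveE _ dq).
by rewrite /GRing.scale/= mulrC.
Qed.

Lemma Cs_comp k (F : R -> R) (q : V -> R) : (forall j, Ck j setT F) -> Cs k q ->
  Cs k (fun x => F (q x)).
Proof.
elim: k F => [//|k IH] F cF cq; have [dq cq'] := cq.
have dF t : derivable F t 1 by have [+ _] := cF 1%N; apply.
split => [x|i]; first by have [] := derive_comp1 0 (dF (q x)) (dq x).
rewrite (_ : 'D_(ev R i) _ = (fun x => (F^`())%classic (q x)) * 'D_(ev R i) q).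
  apply: (CsM _ (cq' i)); apply: IH; last exact: Cs_pred cq.
  by move=> j; have [] := cF j.+1.
by apply/funext => x; have [_ ->] := derive_comp1 (ev R i) (dF (q x)) (dq x).
Qed.

Section QuadraticForm.
Variables (P : 'M[R]_(n + n)) (w : V).
Hypothesis symP : P^T = P.

Let PE i l : P i l = P l i. Proof. by rewrite -{1}symP mxE. Qed.

(* The gradient of the quadratic form is [2 * qgrad]. *)
Definition qgrad (x : V) : V := (x - w) *m P.

Definition quadf (x : V) : R := \sum_i (x - w) ord0 i * qgrad x ord0 i.

Lemma qgradE x i : qgrad x ord0 i = affine (- \sum_l w ord0 l * P l i) (fun l => P l i) x.
Proof.
rewrite /qgrad mxE /affine -sumrN -big_split/=; apply: eq_bigr => l _.
by rewrite !mxE/= mulrBl addrC [x _ _ * _]mulrC.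
Qed.

Let subE x i : (x - w) ord0 i = affine (- w ord0 i) (fun l => (l == i)%:R) x.
Proof.
rewrite /affine (bigD1 i)//= big1 => [|l /negbTE ->]; last by rewrite mul0r.
by rewrite eqxx mul1r addr0 !mxE addrC.
Qed.

Lemma quadfE : quadf = \sum_i (affine (- w ord0 i) (fun l => (l == i)%:R) *
    affine (- \sum_l w ord0 l * P l i) (fun l => P l i)).
Proof.
apply/funext => x; rewrite /quadf fct_sumE; apply: eq_bigr => i _.
by rewrite subE qgradE.
Qed.

Lemma Cs_quadf k : Cs k quadf.
Proof. by rewrite quadfE; apply: Cs_sum => i; apply: CsM; exact: Cs_affine. Qed.

Lemma derive_quadf l : 'D_(ev R l) quadf = affine (- (2 * \sum_m w ord0 m * P m l)) (fun m => 2 * P m l).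
Proof.
have dd a (p : 'I_(n + n) -> R) x v : derivable (affine a p) x v.
  exact/diff_derivable/differentiable_affine.
apply/funext => x.
transitivity (2 * qgrad x ord0 l); last first.
  rewrite qgradE /affine mulrDr mulrN; congr (_ + _); rewrite mulr_sumr.
  by apply: eq_bigr => i _; rewrite mulrA.
rewrite quadfE derive_sum; last by move=> i; exact: derivableM.
rewrite (eq_bigr (fun i => (l == i)%:R * qgrad x ord0 i + (x - w) ord0 i * P i l)); last first.
  move=> i _; rewrite deriveM// !derive_affine -subE -qgradE /GRing.scale/= PE; ring.
rewrite big_split/= (bigD1 l)//= eqxx mul1r big1 ?addr0; last first.
  by move=> i il; rewrite eq_sym (negbTE il) mul0r.
by rewrite [qgrad x]/qgrad mxE; ring.
Qed.

(** The chain rule with gradient [2 * qgrad] and Hessian [2 * P]. The two double sums are the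
    numbers a and d of [profile]. *)
Lemma Lop_quadf (b c : 'I_n -> 'I_n -> V -> R) (F : R -> R) x : (forall k, Ck k setT F) ->
  Lop b c (fun y => F (quadf y)) x =
   4 * (\sum_i \sum_l acoef b c i l x * (qgrad x ord0 i * qgrad x ord0 l)) *
     (F^`()^`())%classic (quadf x)
   + 2 * (\sum_i \sum_l acoef b c i l x * P i l) * (F^`())%classic (quadf x).
Proof.
move=> cF.
have dF t : derivable F t 1 by have [+ _] := cF 1%N; apply.
have dF' t : derivable (F^`())%classic t 1 by have [_ [+ _]] := cF 2%N; apply.
have dq y : differentiable quadf y by have [+ _] := Cs_quadf 1; apply.
have dqE l y : 'D_(ev R l) quadf y = 2 * qgrad y ord0 l.
  have /= -> := congr1 (fun f => f y) (derive_quadf l).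
  rewrite qgradE /affine mulrDr mulrN; congr (_ + _); rewrite mulr_sumr.
  by apply: eq_bigr => i _; rewrite mulrA.
have d2E i l : d2 (fun y => F (quadf y)) i l x =
   (F^`()^`())%classic (quadf x) * (4 * (qgrad x ord0 i * qgrad x ord0 l))
   + (F^`())%classic (quadf x) * (2 * P i l).
  rewrite /d2.
  have -> : 'D_(ev R l) (fun y => F (quadf y)) =
     (fun y => (F^`())%classic (quadf y)) * 'D_(ev R l) quadf.
    by apply/funext => y; have [_ ->] := derive_comp1 (ev R l) (dF (quadf y)) (dq y).
  have [d1 e1] := derive_comp1 (ev R i) (dF' (quadf x)) (dq x).
  have dD : derivable ('D_(ev R l) quadf) x (ev R i).
    by rewrite derive_quadf; exact/diff_derivable/differentiable_affine.
  have dF1 : derivable (fun y => (F^`())%classic (quadf y)) x (ev R i) by exact/diff_derivable.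
  have e2 : 'D_(ev R i) ('D_(ev R l) quadf) x = 2 * P i l.
    by rewrite derive_quadf derive_affine.
  etransitivity; first exact: (deriveM dF1 dD).
  rewrite e1 e2 (dqE l x) (dqE i x) /GRing.scale/=.
  move: (qgrad x ord0 i) (qgrad x ord0 l) ((F^`())%classic _) ((F^`()^`())%classic _) (P i l) => *.
  ring.
rewrite LopE !mulr_sumr !mulr_suml -big_split/=; apply: eq_bigr => i _.
rewrite !mulr_sumr !mulr_suml -big_split/=; apply: eq_bigr => l _.
rewrite d2E; ring.
Qed.

End QuadraticForm.
End SmoothCn.

(** * Ellipticity, bounds and Lipschitz constants near a point *)

Section LocalConstants.
Variables (R : realType) (n : nat).
Local Notation V := (Cn R n).

Lemma uniform_bound (I : finType) (S : Type) (D : set S) (f : I -> S -> R) :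
  (forall i, exists2 B : R, 0 < B & forall x, D x -> f i x <= B) ->
  exists2 B : R, 0 < B & forall i x, D x -> f i x <= B.
Proof.
move=> h; have /choice[B hB] : forall i, exists B : R, forall x, D x -> f i x <= B.
  by move=> i; have [B _ hB] := h i; exists B.
exists (1 + \sum_i `|B i|).
  by rewrite ltr_pwDl// sumr_ge0.
move=> i x Dx; apply: (le_trans (hB i x Dx)); apply: (le_trans (ler_norm _)).
by rewrite (bigD1 i)//= addrCA lerDl addr_ge0// sumr_ge0.
Qed.

Lemma derive_coords (f : V -> R) (x v : V) : differentiable f x ->
  'D_v f x = \sum_i v ord0 i * 'D_(ev R i) f x.
Proof.
move=> df; rewrite deriveE//.
have -> : v = \sum_i v ord0 i *: ev R i :> V.
  apply/matrixP => j k; rewrite (ord1 j) summxE (bigD1 k)//= big1 ?addr0.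
    by rewrite !mxE !eqxx mulr1.
  by move=> i ik; rewrite !mxE eqxx/= [k == i]eq_sym (negbTE ik) mulr0.
rewrite linear_sum; apply: eq_bigr => i _.
by rewrite linearZ/= (deriveE _ df) summxE (bigD1 i)//= big1 ?addr0 ?mxE ?eqxx ?mulr1// => k ki;
   rewrite !mxE eqxx/= [i == k]eq_sym (negbTE ki) mulr0.
Qed.

Lemma segment_in_ball (z0 x w : V) (r s : R) : 0 <= s <= 1 ->
  `|x - z0| <= r -> `|w - z0| <= r -> `|w + s *: (x - w) - z0| <= r.
Proof.
move=> /andP[s0 s1] xr wr.
have -> : w + s *: (x - w) - z0 = (1 - s) *: (w - z0) + s *: (x - z0).
  by rewrite !scalerBr !scalerBl !scale1r; apply/matrixP => i j; rewrite !mxE; ring.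
apply: (le_trans (ler_normD _ _)); rewrite !normrZ (ger0_norm s0) ger0_norm ?subr_ge0//.
have -> : r = (1 - s) * r + s * r by ring.
by apply: lerD; apply: ler_wpM2l; rewrite ?subr_ge0.
Qed.

Lemma lipschitz_on_ball (G : set V) (f : V -> R) (z0 : V) (r : R) : open G -> C1_on G f ->
  [set y : V | `|y - z0| <= r] `<=` G ->
  exists2 L : R, 0 < L & forall x w : V, `|x - z0| <= r -> `|w - z0| <= r ->
     `|f x - f w| <= L * `|x - w|.
Proof.
move=> oG Cf bG.
have [B B0 hB] : exists2 B : R, 0 < B & forall (i : 'I_(n + n)) x,
    [set y : V | `|y - z0| <= r] x -> `|'D_(ev R i) f x| <= B.
  apply: uniform_bound => i.
  apply: continuous_bounded_on (@compact_closed_ball_Cn _ _ z0 r) _ => x xr.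
  exact: C1_on_continuous (bG _ xr).
have df x : G x -> differentiable f x by case: Cf => + _; apply.
exists (1 + (n + n)%:R * B); first by rewrite ltr_pwDl// mulr_ge0// ltW.
move=> x w xr wr.
have inG (s : R) : 0 <= s <= 1 -> G (w + s *: (x - w)) by move=> s01; apply: bG; exact: segment_in_ball.
have dl (s : R) : s \in `]0, 1[ -> is_derive s (1 : R) (fun s : R => f (w + s *: (x - w))) ('D_(x - w) f (w + s *: (x - w))).
  rewrite in_itv/= => /andP[s0 s1]; apply: is_derive_line; apply/diff_derivable/df/inG.
  by rewrite !ltW.
have cf : {within `[0, 1], continuous (fun s : R => f (w + s *: (x - w)))}.
  apply: derivable_within_continuous => s; rewrite in_itv/= => s01.
  by have [] := @is_derive_line _ _ f w (x - w) s (diff_derivable (df _ (inG _ s01))).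
have [c] := @MVT R _ _ 0 1 ltr01 dl cf.
rewrite in_itv/= => /andP[c0 c1]; rewrite scale1r scale0r addr0 [w + (x - w)]addrC subrK subr0 mulr1 => ->.
have c01 : 0 <= c <= 1 by rewrite !ltW.
rewrite derive_coords; last exact/df/inG.
apply: (le_trans (ler_norm_sum _ _ _)).
apply: (@le_trans _ _ (\sum_(i < n + n) `|x - w| * B)).
  apply: ler_sum => i _; rewrite normrM; apply: ler_pM => //; first exact: coord_le_norm.
  by apply: hB; exact: segment_in_ball.
rewrite sumr_const card_ord -[leLHS]mulr_natl mulrCA mulrC ler_wpM2r//.
by rewrite lerDr.
Qed.

Variables (G : set V) (b c : 'I_n -> 'I_n -> V -> R).
Hypothesis HG : closed_strictly_positive_form G b c.

Lemma quadratic_sum_bound (D : 'I_(n + n) -> 'I_(n + n) -> R) (p : V) (e : R) :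
  (forall i l, `|D i l| <= e) ->
  `|\sum_i \sum_l D i l * (p ord0 i * p ord0 l)| <= ((n + n)%:R ^+ 2 * e) * `|p| ^+ 2.
Proof.
move=> De; apply: (le_trans (ler_norm_sum _ _ _)).
apply: (@le_trans _ _ (\sum_(i < n + n) \sum_(l < n + n) e * `|p| ^+ 2)).
  apply: ler_sum => i _; apply: (le_trans (ler_norm_sum _ _ _)); apply: ler_sum => l _.
  rewrite normrM; apply: ler_pM => //; rewrite normrM expr2.
  by apply: ler_pM => //; exact: coord_le_norm.
rewrite !sumr_const !card_ord -mulrnA -[leLHS]mulr_natl natrM le_eqVlt; apply/orP; left; apply/eqP; ring.
Qed.

Lemma ellipticity_at (z0 : V) : (0 < n)%N -> G z0 ->
  exists2 lam : R, 0 < lam & forall p : V,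
    lam * `|p| ^+ 2 <= \sum_i \sum_l acoef b c i l z0 * (p ord0 i * p ord0 l).
Proof.
move=> n0 Gz0.
pose q (p : V) := \sum_i \sum_l acoef b c i l z0 * (p ord0 i * p ord0 l).
have cq : continuous q.
  move=> p; apply: differentiable_continuous.
  rewrite (_ : q = \sum_i \sum_l (acoef b c i l z0 *: ((fun p : V => p ord0 i) * (fun p : V => p ord0 l)))).
    apply: differentiable_sum => i; apply: differentiable_sum => l; apply: differentiableZ.
    by apply: differentiableM; exact: differentiable_coord.
  by apply/funext => y; rewrite fct_sumE; apply: eq_bigr => i _; rewrite fct_sumE.
pose S := [set p : V | `|p| = 1].
have cS : compact S.
  apply: bounded_closed_compact.
    by exists 1; split; [exact: num_real|move=> B B1 p /= ->; exact: ltW].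
  rewrite (_ : S = (fun p : V => `|p|) @^-1` [set 1]); last by apply/seteqP; split.
  apply: closed_comp => [p _|]; first exact: norm_continuous.
  exact: (accessible_closed_set1 (hausdorff_accessible (@norm_hausdorff _ R))).
have Np : (0 < n + n)%N by rewrite addn_gt0 n0.
have S0 : S !=set0.
  exists (const_mx 1); rewrite /S/=; apply/eqP; rewrite eq_le; apply/andP; split.
    by apply/norm_leP => // i; rewrite mxE normr1.
  by have := coord_le_norm (const_mx 1 : V) (Ordinal Np); rewrite mxE normr1.
have [p0 Sp0 hp0] := @EVT_min_rV R _ q S S0 cS (continuous_subspaceT cq).
have q0 : 0 < q p0.
  apply: (acoef_pos HG) => //; apply: contrapT => /forallNP H.
  have : p0 = 0 by apply/matrixP => i j; rewrite (ord1 i) mxE; have /negP/negPn/eqP := H j.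
  by move=> p00; move/set_mem : Sp0; rewrite /S/= p00 normr0 => /eqP; rewrite eq_sym oner_eq0.
exists (q p0) => // p; have [->|pn0] := eqVneq p 0.
  by rewrite normr0 expr0n/= mulr0 sumr_ge0// => i _; rewrite sumr_ge0// => l _; rewrite !mxE !mulr0.
have np0 : 0 < `|p| by rewrite normr_gt0.
have : S (`|p|^-1 *: p) by rewrite /S/= normrZ normfV normr_id mulVf// gt_eqF.
move=> /mem_set /hp0 /(ler_wpM2r (sqr_ge0 `|p|)) /le_trans; apply.
rewrite /q mulr_suml; apply: ler_sum => i _; rewrite mulr_suml; apply: ler_sum => l _.
rewrite !mxE le_eqVlt; apply/orP; left; apply/eqP.
have := gt_eqF np0; move: `|p| (acoef _ _ _ _ _) (p ord0 i) (p ord0 l) => N A x y N0.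
by field; rewrite N0.
Qed.

(** Ellipticity spreads from [z0] to a ball: the form at [w] differs from that at [z0] by at most
    N^2 L r0 |p|^2, and [r0] is small enough to make this half of the ellipticity at [z0]. *)
Lemma local_constants (z0 : V) : (0 < n)%N -> G z0 ->
  exists r0 lam Lip M : R, [/\ 0 < r0, 0 < lam, 0 < Lip & 0 < M] /\
   [/\ [set y : V | `|y - z0| <= r0] `<=` G,
       forall i l (w : V), `|w - z0| <= r0 -> `|acoef b c i l w| <= M,
       forall i l (x w : V), `|x - z0| <= r0 -> `|w - z0| <= r0 ->
         `|acoef b c i l x - acoef b c i l w| <= Lip * `|x - w| &
       forall w p : V, `|w - z0| <= r0 ->
         lam * `|p| ^+ 2 <= \sum_i \sum_l acoef b c i l w * (p ord0 i * p ord0 l)].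
Proof.
move=> n0 Gz0; have oG : open G by case: HG.
have /nbhs_ballP[r1 /= r10 r1G] : nbhs z0 G by exact: open_nbhs_nbhs.
pose r2 := r1 / 2.
have r20 : 0 < r2 by rewrite divr_gt0.
have r2G : [set y : V | `|y - z0| <= r2] `<=` G.
  move=> y yr; apply: r1G; rewrite ball_CnE/=; apply: (le_lt_trans yr).
  by rewrite /r2; lra.
have [M M0 hM] : exists2 M : R, 0 < M & forall (il : 'I_(n + n) * 'I_(n + n)) w,
   [set y : V | `|y - z0| <= r2] w -> `|acoef b c il.1 il.2 w| <= M.
  apply: uniform_bound => il.
  apply: continuous_bounded_on (@compact_closed_ball_Cn _ _ z0 r2) _ => x xr.
  by apply: differentiable_continuous; have [+ _] := acoef_C1 HG il.1 il.2; apply; exact: r2G.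
have [L L0 hL] : exists2 L : R, 0 < L & forall (il : 'I_(n + n) * 'I_(n + n)) (xw : V * V),
   [set xw : V * V | `|xw.1 - z0| <= r2 /\ `|xw.2 - z0| <= r2 /\ xw.1 != xw.2] xw ->
   `|acoef b c il.1 il.2 xw.1 - acoef b c il.1 il.2 xw.2| / `|xw.1 - xw.2| <= L.
  apply: uniform_bound => il.
  have [L L0 hL] := lipschitz_on_ball oG (acoef_C1 HG il.1 il.2) r2G.
  exists L => // -[x w] [/= xr [wr xw]].
  by rewrite ler_pdivrMr ?normr_gt0 ?subr_eq0//; exact: hL.
have [lam lam0 hlam] := ellipticity_at n0 Gz0.
pose N2 : R := (n + n)%:R ^+ 2.
have N20 : 0 < N2 by rewrite exprn_gt0// ltr0n addn_gt0 n0.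
pose r0 := Num.min r2 (lam / 2 / (N2 * L)).
have r00 : 0 < r0 by rewrite lt_min r20 !divr_gt0// mulr_gt0.
have r02 : r0 <= r2 by rewrite ge_min lexx.
have hLip i l (x w : V) : `|x - z0| <= r0 -> `|w - z0| <= r0 ->
         `|acoef b c i l x - acoef b c i l w| <= L * `|x - w|.
  move=> xr wr; have [->|xw] := eqVneq x w; first by rewrite !subrr !normr0 mulr0.
  rewrite -ler_pdivrMr ?normr_gt0 ?subr_eq0//.
  by apply: (hL (i, l) (x, w)); split => /=; [|split]; [exact: le_trans r02..|].
exists r0, (lam / 2), L, M; split; first by rewrite divr_gt0.
split => //.
- by move=> y yr; apply: r2G; exact: le_trans r02.
- by move=> i l w wr; apply: (hM (i, l)); exact: le_trans r02.
move=> w p wr.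
have zr : `|z0 - z0| <= r0 by rewrite subrr normr0 ltW.
have := @quadratic_sum_bound (fun i l => acoef b c i l w - acoef b c i l z0) p (L * r0).
have e1 i l : `|acoef b c i l w - acoef b c i l z0| <= L * r0.
  by apply: (le_trans (hLip i l w z0 wr zr)); rewrite ler_pM2l.
move=> /(_ e1).
have -> : \sum_i \sum_l (acoef b c i l w - acoef b c i l z0) * (p ord0 i * p ord0 l) =
  \sum_i \sum_l acoef b c i l w * (p ord0 i * p ord0 l) -
  \sum_i \sum_l acoef b c i l z0 * (p ord0 i * p ord0 l).
  rewrite -sumrB; apply: eq_bigr => i _; rewrite -sumrB; apply: eq_bigr => l _.
  by rewrite mulrBl.
have e2 : N2 * (L * r0) * `|p| ^+ 2 <= lam / 2 * `|p| ^+ 2.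
  apply: ler_wpM2r; first exact: sqr_ge0.
  have -> : N2 * (L * r0) = r0 * (N2 * L) by ring.
  have NL : 0 < N2 * L by exact: mulr_gt0.
  rewrite -(ler_pdivlMr _ _ NL). by rewrite ge_min lexx orbT.
rewrite ler_distl => /andP[H _].
have := hlam p; move: H e2; rewrite -/N2.
have -> : lam * `|p| ^+ 2 = lam / 2 * `|p| ^+ 2 + lam / 2 * `|p| ^+ 2 by field.
move: (lam / 2 * _) (N2 * _ * _) (\sum_i _) (\sum_i _) => X Y Z W.
lra.
Qed.

End LocalConstants.

(** * The quadratic form of the inverse matrix *)

Section InverseForm.
Variables (R : realType) (n : nat).
Local Notation V := (Cn R n).
Local Notation N := ((n + n)%:R : R).
Variables (A : 'M[R]_(n + n)) (lam M : R).
Hypotheses (symA : A^T = A) (lam0 : 0 < lam) (M0 : 0 < M).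
Hypothesis bdA : forall i l, `|A i l| <= M.
Hypothesis posA : forall p : V, lam * `|p| ^+ 2 <= \sum_i \sum_l A i l * (p ord0 i * p ord0 l).

Let AE i l : A i l = A l i. Proof. by rewrite -{1}symA mxE. Qed.

Lemma form_mulmx (p : V) : \sum_i \sum_l A i l * (p ord0 i * p ord0 l) = \sum_i (p *m A) ord0 i * p ord0 i.
Proof.
apply: eq_bigr => i _; rewrite mxE mulr_suml; apply: eq_bigr => l _.
by rewrite AE mulrA [p _ _ * A _ _]mulrC mulrAC.
Qed.

Lemma unitmx_pos : A \in unitmx.
Proof.
rewrite -row_free_unit -kermx_eq0; apply/rowV0P => p /sub_kermxP pA0.
have := posA p; rewrite form_mulmx pA0 big1 => [|i _]; last by rewrite mxE mul0r.
rewrite pmulr_rle0// => p2; apply/eqP; rewrite -normr_eq0 -sqrf_eq0.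
by rewrite eq_le p2 sqr_ge0.
Qed.

Lemma invmx_sym : (invmx A)^T = invmx A.
Proof. by rewrite trmx_inv symA. Qed.

Section Point.
Variables (w x : V).
Let y := x - w.
Let g := qgrad (invmx A) w x.
Let Q := quadf (invmx A) w x.

Lemma qgradK : g *m A = y.
Proof. by rewrite /g /qgrad mulmxKV// unitmx_pos. Qed.

(** With g = y A^(-1) the form y A^(-1) y equals g A g. Ellipticity of [A] thus bounds [Q] from
    below by |g|^2, and all other comparisons between [Q], |g| and |y| follow from y = g A. *)
Lemma quadf_form : Q = \sum_i \sum_l A i l * (g ord0 i * g ord0 l).
Proof. by rewrite form_mulmx qgradK. Qed.

Lemma qgrad_le_quadf : lam * `|g| ^+ 2 <= Q.
Proof. by rewrite quadf_form. Qed.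

Lemma quadf_ge0 : 0 <= Q.
Proof. by apply: le_trans qgrad_le_quadf; rewrite mulr_ge0 ?sqr_ge0// ltW. Qed.

Lemma sub_le_qgrad : `|y| <= N * M * `|g|.
Proof.
apply/norm_leP => [|i]; first by rewrite !mulr_ge0// ltW.
rewrite -qgradK mxE; apply: (le_trans (ler_norm_sum _ _ _)).
apply: (@le_trans _ _ (\sum_(l < n + n) M * `|g|)).
  apply: ler_sum => l _; rewrite normrM mulrC; apply: ler_pM => //; exact: coord_le_norm.
by rewrite sumr_const card_ord -[leLHS]mulr_natl mulrA.
Qed.

Lemma quadf_le_mul : Q <= N * `|y| * `|g|.
Proof.
apply: (le_trans (ler_norm _)); apply: (le_trans (ler_norm_sum _ _ _)).
apply: (@le_trans _ _ (\sum_(l < n + n) `|y| * `|g|)).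
  by apply: ler_sum => l _; rewrite normrM; apply: ler_pM => //; exact: coord_le_norm.
by rewrite sumr_const card_ord -[leLHS]mulr_natl mulrA.
Qed.

Lemma qgrad_le_sub : `|g| <= N / lam * `|y|.
Proof.
have [->|g0] := eqVneq g 0; first by rewrite normr0 mulr_ge0// divr_ge0// ltW.
have ng : 0 < `|g| by rewrite normr_gt0.
have := le_trans qgrad_le_quadf quadf_le_mul.
by rewrite expr2 mulrA ler_pM2r// mulrC -ler_pdivlMr// mulrAC.
Qed.

Lemma quadf_le_sub : Q <= N ^+ 2 / lam * `|y| ^+ 2.
Proof.
apply: (le_trans quadf_le_mul).
have -> : N ^+ 2 / lam * `|y| ^+ 2 = N * `|y| * (N / lam * `|y|) by ring.
by apply: ler_wpM2l; [rewrite mulr_ge0|exact: qgrad_le_sub].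
Qed.

Lemma sub_le_quadf : lam / (N * M) ^+ 2 * `|y| ^+ 2 <= Q.
Proof.
have [->|y0] := eqVneq y 0; first by rewrite normr0 expr0n/= mulr0 quadf_ge0.
have N0 : 0 < N * M.
  rewrite lt_neqAle mulr_ge0 ?(ltW M0)// andbT eq_sym; apply: contra y0 => /eqP NM.
  by rewrite -normr_eq0 eq_le normr_ge0 andbT (le_trans sub_le_qgrad)// NM mul0r.
apply: le_trans qgrad_le_quadf; rewrite -mulrA ler_pM2l// mulrC ler_pdivrMr ?exprn_gt0//.
by rewrite mulrC -exprMn lerXn2r ?nnegrE ?mulr_ge0 ?(ltW M0)//; exact: sub_le_qgrad.
Qed.

End Point.

Lemma invmx_bound i l : `|invmx A i l| <= N / lam.
Proof.
have := qgrad_le_sub 0 (ev R i : V).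
rewrite /qgrad subr0 => H.
have e1 : `|ev R i : V| <= 1.
  by apply/norm_leP => // j; rewrite mxE eqxx/=; case: (_ == _); rewrite ?normr1 ?normr0.
apply: (@le_trans _ _ (N / lam * `|ev R i : V|)); last first.
  by rewrite ler_piMr// divr_ge0// ltW.
apply: le_trans H; have -> : invmx A i l = (ev R i *m invmx A) ord0 l; last exact: coord_le_norm.
by rewrite -rowE mxE.
Qed.

End InverseForm.

(** * Freezing the coefficients *)

Section Barrier.
Variables (R : realType) (n : nat).
Local Notation V := (Cn R n).
Local Notation N := ((n + n)%:R : R).
Variables (G : set V) (b c : 'I_n -> 'I_n -> V -> R).
Hypothesis HG : closed_strictly_positive_form G b c.

(** [P] is the inverse of the coefficient matrix at [w]. With the coefficients frozen at [w] the two
    sums would be exactly q^2 and the trace 2n of the identity; since |x - w| and the half-gradient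
    are O(q), Lipschitz coefficients perturb them by O(q^3) and O(q). *)
Lemma frozen_estimates (z0 : V) : (0 < n)%N -> G z0 ->
  exists r0 l1 l2 kappa : R, [/\ 0 < r0, 0 < l1, 0 < l2 & 0 <= kappa] /\
  forall w : V, `|w - z0| <= r0 -> exists P : 'M[R]_(n + n), P^T = P /\
   forall x, [/\ l1 * `|x - w| ^+ 2 <= quadf P w x, quadf P w x <= l2 * `|x - w| ^+ 2 &
     forall q, 0 <= q -> q ^+ 2 = quadf P w x -> `|x - z0| <= r0 ->
       `|\sum_i \sum_l acoef b c i l x * (qgrad P w x ord0 i * qgrad P w x ord0 l) - q ^+ 2|
          <= kappa * q ^+ 2 * q /\
       `|\sum_i \sum_l acoef b c i l x * P i l - 2 * n%:R| <= kappa * q].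
Proof.
move=> n0 Gz0.
have [r0 [lam [L [M [[r00 lam0 L0 M0] [ballG bdA lipA posA]]]]]] := local_constants HG n0 Gz0.
have N0 : 0 < N by rewrite ltr0n addn_gt0 n0.
(* A substitute for lam^(-1/2): s^2 >= 1/lam turns lam |g|^2 <= q^2 into |g| <= s q. *)
pose s : R := 1 + lam^-1.
have s0 : 0 < s by rewrite addr_gt0// invr_gt0.
pose k1 := N ^+ 2 * (L * (N * M * s)).
have k10 : 0 < k1 by rewrite !mulr_gt0.
exists r0, (lam / (N * M) ^+ 2), (N ^+ 2 / lam), (k1 * s ^+ 2 + k1 * (N / lam)).
split.
  split; [exact: r00| | |].
  - by rewrite divr_gt0// exprn_gt0// mulr_gt0.
  - by rewrite divr_gt0// exprn_gt0.
  - by rewrite addr_ge0// mulr_ge0 ?(ltW k10) ?sqr_ge0 ?divr_ge0 ?(ltW N0) ?(ltW lam0).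
move=> w wr; pose A : 'M[R]_(n + n) := \matrix_(i, l) acoef b c i l w.
have symA : A^T = A.
  by apply/matrixP => i l; rewrite !mxE; apply: (acoef_sym HG); exact: ballG.
have bA i l : `|A i l| <= M by rewrite mxE; exact: bdA.
have pA (p : V) : lam * `|p| ^+ 2 <= \sum_i \sum_l A i l * (p ord0 i * p ord0 l).
  apply: (le_trans (posA w p wr)); rewrite le_eqVlt; apply/orP; left; apply/eqP.
  by apply: eq_bigr => i _; apply: eq_bigr => l _; rewrite mxE.
have uA := unitmx_pos symA lam0 pA.
exists (invmx A); split; first exact: invmx_sym.
move=> x; split.
- exact: (sub_le_quadf symA lam0 M0 bA pA).
- exact: (quadf_le_sub symA lam0 pA).
move=> q q0 qQ xr.
set g := qgrad _ _ _.
have gq : `|g| <= s * q.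
  rewrite -(@ler_pXn2r _ 2) ?nnegrE ?mulr_ge0 ?(ltW s0)// exprMn qQ.
  have H := qgrad_le_quadf symA lam0 pA w x; rewrite -/g in H.
  rewrite -ler_pdivlMl// in H; apply: (le_trans H).
  apply: ler_wpM2r; first exact: (quadf_ge0 symA lam0 pA).
  have i0 : 0 < lam^-1 by rewrite invr_gt0.
  by rewrite /s expr2; nra.
have yq : `|x - w| <= N * M * s * q.
  apply: (le_trans (sub_le_qgrad symA lam0 M0 bA pA w x)).
  have -> : N * M * s * q = N * M * (s * q) by ring.
  by rewrite -/g; apply: ler_wpM2l => //; rewrite mulr_ge0 ?(ltW M0).
have Dle i l : `|acoef b c i l x - A i l| <= L * (N * M * s * q).
  by rewrite mxE; apply: (le_trans (lipA i l x w xr wr)); rewrite ler_pM2l.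
have k1E : N ^+ 2 * (L * (N * M * s * q)) = k1 * q by rewrite /k1; ring.
split.
  have := quadratic_sum_bound g Dle.
  have -> : \sum_i \sum_l (acoef b c i l x - A i l) * (g ord0 i * g ord0 l) =
     \sum_i \sum_l acoef b c i l x * (g ord0 i * g ord0 l) - q ^+ 2.
    rewrite qQ (quadf_form symA lam0 pA) -/g -sumrB; apply: eq_bigr => i _.
    by rewrite -sumrB; apply: eq_bigr => l _; rewrite mulrBl.
  move=> /le_trans; apply; rewrite k1E.
  apply: (@le_trans _ _ (k1 * q * (s * q) ^+ 2)).
    by apply: ler_wpM2l; [rewrite mulr_ge0// ltW|rewrite lerXn2r ?nnegrE ?mulr_ge0 ?(ltW s0)].
  have -> : k1 * q * (s * q) ^+ 2 = k1 * s ^+ 2 * q ^+ 2 * q by ring.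
  apply: ler_wpM2r => //; apply: ler_wpM2r; first exact: sqr_ge0.
  by rewrite lerDl mulr_ge0 ?divr_ge0 ?(ltW k10) ?(ltW N0) ?(ltW lam0).
have -> : \sum_i \sum_l acoef b c i l x * invmx A i l - 2 * n%:R =
    \sum_i \sum_l (acoef b c i l x - A i l) * invmx A i l.
  have E : \sum_i \sum_l A i l * invmx A i l = 2 * n%:R.
    transitivity (\tr (A *m invmx A)).
      apply: eq_bigr => i _; rewrite mxE; apply: eq_bigr => l _; congr (_ * _).
      by rewrite -{1}(invmx_sym symA) mxE.
    by rewrite mulmxV// mxtrace1 -natrM mul2n addnn.
  rewrite -E -sumrB; apply: eq_bigr => i _; rewrite -sumrB; apply: eq_bigr => l _.
  by rewrite mulrBl.
apply: (le_trans (ler_norm_sum _ _ _)).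
apply: (@le_trans _ _ (\sum_(i < n + n) \sum_(l < n + n) L * (N * M * s * q) * (N / lam))).
  apply: ler_sum => i _; apply: (le_trans (ler_norm_sum _ _ _)); apply: ler_sum => l _.
  by rewrite normrM; apply: ler_pM => //; exact: (invmx_bound symA lam0 pA).
rewrite !sumr_const !card_ord -mulrnA -[leLHS]mulr_natl natrM -expr2 mulrA k1E.
have -> : k1 * q * (N / lam) = k1 * (N / lam) * q by ring.
by apply: ler_wpM2r => //; rewrite lerDr mulr_ge0 ?sqr_ge0 ?(ltW k10).
Qed.

End Barrier.

(** * The barrier at all scales below a fixed radius *)

Section BarrierFunction.
Variables (R : realType) (n : nat).
Local Notation V := (Cn R n).
Variables (G : set V) (b c : 'I_n -> 'I_n -> V -> R).
Hypothesis HG : closed_strictly_positive_form G b c.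

Lemma barrier (z0 : V) : (0 < n)%N -> G z0 ->
  exists th r1 a e : R, [/\ 0 < th <= 8^-1, 0 < r1, 0 < a & 0 < e] /\
  ([set y : V | `|y - z0| <= r1] `<=` G) /\
  forall r (w : V) sigma, 0 < r <= r1 -> `|w - z0| < 2 * th * r -> 0 < sigma <= th * r ->
  exists W : V -> R, [/\ smooth W, (forall x, 0 <= W x),
    (forall x, r / 2 <= `|x - z0| -> W x = 0) &
    forall x, a * (r ^+ 2) ^- n * \1_[set y : V | `|y - z0| < th * r] x
       - e * (sigma ^+ 2) ^- n * \1_[set y : V | `|y - w| < sigma] x <= Lop b c W x].
Proof.
move=> n0 Gz0; have oG : open G by case: HG.
have [r0 [l1 [l2 [kappa [[r00 l10 l20 k0] est]]]]] := frozen_estimates HG n0 Gz0.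
have [C C0 prof] := profile n0 k0.
have /nbhs_ballP[rG /= rG0 rGG] : nbhs z0 G by exact: open_nbhs_nbhs.
(* For |x - z0| >= r/2 the bound 1/8 gives |x - w| >= r/4, and the second bound makes l1 r^2 / 16 at
   least [T] below, so that the barrier vanishes there. *)
pose th := Num.min (8^-1) (l1 / (16 * (18 * l2))).
have th0 : 0 < th by rewrite lt_min invr_gt0 ltr0n/= divr_gt0// !mulr_gt0.
have th8 : th <= 8^-1 by rewrite /th ge_min lexx.
have thl : 16 * (18 * l2) * th <= l1.
  by rewrite mulrC -ler_pdivlMr ?mulr_gt0// ge_min lexx orbT.
(* On B(z0, th r) one has |x - w| < 3 th r, so the form is at most 9 l2 th^2 r^2, which is T/2 for T
   = l r^2. *)
pose l := 18 * l2 * th ^+ 2.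
have l0 : 0 < l by rewrite !mulr_gt0// exprn_gt0.
(* The single condition T * kk <= 1 implies both T <= 1 and kappa^2 T <= 1/4. *)
pose kk := 4 * kappa ^+ 2 + 4.
have kk0 : 0 < kk by rewrite ltr_wpDl// mulr_ge0// sqr_ge0.
pose r1 := Num.min (rG / 2) (Num.min r0 (Num.min 1 (l * kk)^-1)).
have r10 : 0 < r1 by rewrite !lt_min divr_gt0// r00 ltr01 invr_gt0 mulr_gt0.
have r1r0 : r1 <= r0 by rewrite /r1 !ge_min lexx orbT.
have r11 : r1 <= 1 by rewrite /r1 !ge_min lexx !orbT.
have r1l : r1 * (l * kk) <= 1.
  by rewrite -ler_pdivlMr ?mulr_gt0// div1r /r1 !ge_min lexx !orbT.
have r1G : [set y : V | `|y - z0| <= r1] `<=` G.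
  move=> y yr; apply: rGG; rewrite ball_CnE/=; apply: (le_lt_trans yr).
  by apply: (@le_lt_trans _ _ (rG / 2)); [rewrite /r1 ge_min lexx|move: rG0; clear -HG; lra].
(* Inside B(w, sigma) only the bound -C tau^(-n) is available. The summand [a] in [e] compensates
   the first indicator there, r^(-2n) being at most sigma^(-2n). *)
pose a := l ^- n; pose e := C * l1 ^- n + a.
have a0 : 0 < a by rewrite invr_gt0 exprn_gt0.
have e0 : 0 < e by rewrite addr_gt0// mulr_gt0// invr_gt0 exprn_gt0.
exists th, r1, a, e; split; first by rewrite th0 th8.
split => // r w sigma /andP[rp rr1] wr /andP[s0 sr].
have rp2 : 0 < r ^+ 2 by rewrite exprn_gt0.
pose T := l * r ^+ 2; pose tau := l1 * sigma ^+ 2.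
have T0 : 0 < T by rewrite mulr_gt0.
have tau0 : 0 < tau by rewrite mulr_gt0// exprn_gt0.
have Tkk : T * kk <= 1.
  apply: le_trans r1l; have -> : T * kk = r ^+ 2 * (l * kk) by rewrite /T; ring.
  apply: ler_wpM2r; first by rewrite mulr_ge0 ?ltW.
  apply: (le_trans _ rr1); rewrite expr2 ler_piMr ?(ltW rp)//; exact: le_trans rr1 r11.
have kT : kappa ^+ 2 * T <= 4^-1.
  by move: Tkk T0; rewrite /kk; move: (kappa ^+ 2) (T) => ? ?; clear -HG; lra.
have T1 : T <= 1.
  have : 0 <= kappa ^+ 2 * T by rewrite mulr_ge0 ?sqr_ge0 ?ltW.
  by move: Tkk T0; rewrite /kk; move: (kappa ^+ 2) (T) => ? ?; clear -HG; lra.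
have wr0 : `|w - z0| <= r0.
  apply: ltW; apply: (lt_le_trans wr); apply: le_trans r1r0; apply: le_trans rr1.
  by rewrite ler_piMl ?(ltW rp)//; move: th8; clear -HG; lra.
have [P [symP estP]] := est w wr0.
have [F [cF F0 Fr FL]] := prof T tau T0 T1 kT tau0.
pose W x := F (quadf P w x).
have sW : smooth W.
  by apply: smooth_Cs => k; apply: Cs_comp => //; exact: Cs_quadf.
have W0 x : r / 2 <= `|x - z0| -> W x = 0.
  move=> xr; rewrite /W Fr//; have [lo _ _] := estP x; apply: le_trans lo.
  have xw : r / 4 <= `|x - w|.
    have : `|x - z0| <= `|x - w| + `|w - z0|.
      by have := ler_normD (x - w) (w - z0); rewrite addrA subrK.
    have : 2 * th * r <= r / 4.
      have : th * r <= 8^-1 * r by rewrite ler_pM2r.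
      by clear -HG; lra.
    by move: xr wr; clear -HG; lra.
  have xw2 : r ^+ 2 / 16 <= `|x - w| ^+ 2.
    have -> : r ^+ 2 / 16 = (r / 4) ^+ 2 by field.
    by rewrite lerXn2r ?nnegrE// divr_ge0// ltW.
  apply: (@le_trans _ _ (l1 * (r ^+ 2 / 16))); last by rewrite ler_pM2l.
  have -> : l1 * (r ^+ 2 / 16) = (l1 / 16) * r ^+ 2 by field.
  rewrite /T ler_pM2r// /l.
  have th2 : th ^+ 2 <= th by rewrite expr2 ler_piMr ?(ltW th0)//; move: th8; clear -HG; lra.
  have : 18 * l2 * th ^+ 2 <= 18 * l2 * th by rewrite ler_pM2l// mulr_gt0.
  by move: thl; clear -HG; lra.
have LW x : `|x - z0| <= r1 -> [/\ sigma <= `|x - w| -> 0 <= Lop b c W x,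
     sigma <= `|x - w| -> `|x - z0| < th * r -> T ^- n <= Lop b c W x &
     - C * tau ^- n <= Lop b c W x].
  move=> xr1; have [lo hi E] := estP x.
  have Q0 : 0 <= quadf P w x by apply: le_trans lo; rewrite mulr_ge0 ?sqr_ge0 ?ltW.
  pose q := Num.sqrt (quadf P w x).
  have q0 : 0 <= q by exact: sqrtr_ge0.
  have qQ : q ^+ 2 = quadf P w x by exact: sqr_sqrtr.
  have [ea ed] := E q q0 qQ (le_trans xr1 r1r0).
  have [v1 v2 v3] := FL q _ _ q0 ea ed.
  have LE : Lop b c W x = 4 * (\sum_i \sum_l acoef b c i l x * (qgrad P w x ord0 i * qgrad P w x ord0 l)) *
      (F^`()^`())%classic (q ^+ 2)
      + 2 * (\sum_i \sum_l acoef b c i l x * P i l) * (F^`())%classic (q ^+ 2).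
    by rewrite qQ; exact: Lop_quadf.
  have tq : sigma <= `|x - w| -> tau <= q ^+ 2.
    move=> xs; rewrite qQ; apply: le_trans lo; rewrite ler_pM2l//.
    by rewrite lerXn2r ?nnegrE// ltW.
  rewrite LE; split => //; first by move=> /tq /v1.
  move=> /tq tq' xth; apply: v2; rewrite tq' qQ/=; apply: (le_trans hi).
  have xw : `|x - w| <= 3 * (th * r).
    have : `|x - w| <= `|x - z0| + `|w - z0|.
      by have := ler_normB (x - z0) (w - z0); rewrite opprB addrA subrK.
    by move: wr xth; rewrite -mulrA; clear -HG; lra.
  have : `|x - w| ^+ 2 <= (3 * (th * r)) ^+ 2 by rewrite lerXn2r ?nnegrE ?mulr_ge0 ?(ltW th0) ?(ltW rp).
  rewrite -(ler_pM2l l20) => /le_trans; apply.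
  by rewrite /T /l le_eqVlt; apply/orP; left; apply/eqP; field.
exists W; split => // [x|x]; first exact: F0.
have [xr|xr] := leP `|x - z0| r1; last first.
  have xrr : r < `|x - z0| by apply: le_lt_trans xr.
  have -> : Lop b c W x = 0.
    apply: (@Lop_out _ _ [set y : V | `|y - z0| <= r / 2] b c (@compact_closed_ball_Cn _ _ z0 _)) => //.
      by move=> y /= /negP; rewrite -ltNge => /ltW; exact: W0.
    by move=> /=; apply/negP; rewrite -ltNge; move: xrr rp; clear -HG; lra.
  have i0 : \1_[set y : V | `|y - z0| < th * r] x = 0 :> R.
    rewrite indicE memNset//= => H; have := lt_trans xrr H; apply/negP; rewrite -leNgt.
    by rewrite ler_piMl ?(ltW rp)//; move: th8; clear -HG; lra.
  rewrite i0 mulr0 sub0r oppr_le0; apply: mulr_ge0 => //.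
  by apply: mulr_ge0; [exact: ltW|rewrite invr_ge0 exprn_ge0 ?sqr_ge0].
have [L1 L2 L3] := LW x xr.
have TE : T ^- n = a * (r ^+ 2) ^- n by rewrite /T /a exprMn invfM.
have tauE : tau ^- n = l1 ^- n * (sigma ^+ 2) ^- n by rewrite /tau exprMn invfM.
have sn : 0 < (sigma ^+ 2) ^- n by rewrite invr_gt0 !exprn_gt0.
have rn : 0 < (r ^+ 2) ^- n by rewrite invr_gt0 !exprn_gt0.
have [xs|xs] := ltP `|x - w| sigma.
  rewrite [\1_[set y | `|y - w| < sigma] x]indicE mem_set//= mulr1.
  apply: le_trans L3; rewrite tauE.
  have : a * (r ^+ 2) ^- n * \1_[set y : V | `|y - z0| < th * r] x <= a * (sigma ^+ 2) ^- n.
    apply: (@le_trans _ _ (a * (r ^+ 2) ^- n)).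
      by rewrite ler_piMr ?mulr_ge0 ?(ltW a0) ?(ltW rn)// indicE; case: (_ \in _).
    rewrite ler_pM2l// lef_pV2 ?posrE ?exprn_gt0//.
    apply: lerXn2r; rewrite ?nnegrE ?sqr_ge0//; apply: lerXn2r; rewrite ?nnegrE ?(ltW s0) ?(ltW rp)//.
    apply: (le_trans sr); rewrite ler_piMl ?(ltW rp)//; move: th8; clear -HG; lra.
  by rewrite /e mulrDl; move: (l1 ^- n) ((sigma ^+ 2) ^- n) => X Y; clear -HG; lra.
rewrite [\1_[set y | `|y - w| < sigma] x]indicE memNset /= ?mulr0 ?subr0; last first.
  by apply/negP; rewrite -leNgt.
rewrite indicE; have [/set_mem /= xth|_] := boolP (_ \in _).
  by rewrite mulr1 -TE; exact: L2.
by rewrite mulr0; exact: L1.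
Qed.

End BarrierFunction.

(** * The weak Harnack inequality *)

Section Separated.
Variables (R : realType) (n : nat).
Local Notation V := (Cn R n).
Local Notation T := (bCn R n).
Local Notation mu := (@leb R n).
Local Open Scope ereal_scope.

Definition separated (d : R) (ps : seq V) : Prop :=
  uniq ps /\ forall p q : V, p \in ps -> q \in ps -> p != q -> (d <= `|p - q|)%R.

(** Balls of radius sigma about points at mutual distance at least 2 sigma are disjoint. *)
Lemma separated_integral_le (sigma : R) (ps : seq V) (X : set T) (f : V -> \bar R) :
  separated (2 * sigma) ps -> measurable X -> measurable_fun X (f : T -> \bar R) ->
  (forall x, X x -> 0 <= f x) ->
  (forall p, p \in ps -> [set y : V | (`|y - p| < sigma)%R] `<=` X) ->
  \sum_(p <- ps) \int[mu]_(x in ([set y : V | (`|y - p| < sigma)%R] : set T)) f x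
    <= \int[mu]_(x in X) f x.
Proof.
move=> [ups sep] mX mf f0 pX.
pose B (p : V) : set T := [set y : V | (`|y - p| < sigma)%R].
have mB p : measurable (B p) by exact: measurable_ball_bCn.
have BX : \big[setU/set0]_(p <- ps) B p `<=` X.
  by rewrite -bigcup_seq => x [p /= pps Bx]; exact: (pX p).
have mU : measurable (\big[setU/set0]_(p <- ps) B p).
  by rewrite -bigcup_seq; apply: fin_bigcup_measurable => //; exact: finite_seq.
rewrite -ge0_integral_bigsetU//.
- exact: ge0_subset_integral.
- move=> p q /= pps qps [x [/= xp xq]]; apply: contrapT => /eqP pq.
  have := sep p q pps qps pq; apply/negP; rewrite -ltNge.
  have -> : (p - q = ((x : V) - q) - ((x : V) - p))%R by rewrite opprB [RHS]addrC addrA subrK.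
  have := ler_normB ((x : V) - q)%R ((x : V) - p)%R.
  by move: xp xq; rewrite /B/=; lra.
- exact: (measurable_funS mX BX mf).
- by move=> x /BX; exact: f0.
Qed.

Lemma integral_one_ball (z : V) (r : R) : (0 < r)%R ->
  \int[mu]_(x in ([set y : V | (`|y - z| < r)%R] : set T)) (1 : \bar R) = ((r *+ 2) ^+ (n + n))%:E.
Proof.
move=> r0; rewrite (@integral_cst _ _ _ mu _ (measurable_ball_bCn z r) 1) mul1e.
exact: leb_ball.
Qed.

(** If every separated set in [S] left some point uncovered, separated sets of any size k would
    exist, and the k disjoint balls of radius d/2 would exceed the volume of one ball containing
    them. *)
Lemma maximal_separated (d : R) (S : set V) (z : V) (r : R) : (0 < d)%R -> (0 < r)%R ->
  S `<=` [set y : V | (`|y - z| < r)%R] ->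
  exists ps : seq V, [/\ separated d ps, forall p, p \in ps -> S p &
    forall x, S x -> exists2 p, p \in ps & (`|x - p| < d)%R].
Proof.
move=> d0 r0 Sr; apply: contrapT => nex.
have grow k : exists ps : seq V, [/\ separated d ps, forall p, p \in ps -> S p & size ps = k].
  elim: k => [|k [ps [sp pS sz]]]; first by exists [::]; split.
  have [x [Sx xps]] : exists x, S x /\ forall p, p \in ps -> (d <= `|x - p|)%R.
    apply: contrapT => nx; apply: nex; exists ps; split => // x Sx.
    apply: contrapT => np; apply: nx; exists x; split => // p pps.
    by rewrite leNgt; apply/negP => xp; apply: np; exists p.
  have [up sepp] := sp.
  exists (x :: ps); split => /=; last by rewrite sz.
    split => /=.
      rewrite up andbT; apply/negP => /xps; rewrite subrr normr0 leNgt; by rewrite d0.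
    move=> p q; rewrite !inE => /orP[/eqP->|pp] /orP[/eqP->|qq].
    - by rewrite eqxx.
    - by move=> _; exact: xps.
    - by move=> _; rewrite distrC; exact: xps.
    - exact: sepp.
  by move=> p; rewrite inE => /orP[/eqP->//|/pS].
have d20 : (0 < d / 2)%R by rewrite divr_gt0.
have vol k : (k%:R * ((d / 2) *+ 2) ^+ (n + n) <= ((r + d / 2) *+ 2) ^+ (n + n))%R.
  have [ps [sp pS <-]] := grow k.
  have := @separated_integral_le (d / 2) ps [set y : V | (`|y - z| < r + d / 2)%R] (fun=> 1).
  have -> : (2 * (d / 2) = d)%R by field.
  move=> /(_ sp (measurable_ball_bCn _ _) (measurable_cst _) (fun _ _ => lee01)).
  rewrite integral_one_ball ?addr_gt0//.
  under eq_bigr do rewrite integral_one_ball//.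
  rewrite sumEFin big_const_seq count_predT iter_addr addr0 lee_fin mulr_natl; apply.
  move=> p /pS /Sr /= pz y /= yp.
  have := ltrD yp pz; rewrite [ltRHS]addrC; apply: le_lt_trans.
  by have := ler_normD (y - p)%R (p - z)%R; rewrite addrA subrK.
have D0 : (0 < ((d / 2) *+ 2) ^+ (n + n))%R by rewrite exprn_gt0// pmulrn_lgt0.
have := vol (Num.truncn (((r + d / 2) *+ 2) ^+ (n + n) / ((d / 2) *+ 2) ^+ (n + n))).+1.
rewrite -ler_pdivlMr// leNgt; apply/negP/negPn; exact: truncnS_gt.
Qed.

End Separated.

(** * Testing against the barrier *)

Section WeakHarnack.
Variables (R : realType) (n : nat).
Local Notation V := (Cn R n).
Local Notation T := (bCn R n).
Local Notation mu := (@leb R n).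
Local Open Scope ereal_scope.
Variables (G : set V) (b c : 'I_n -> 'I_n -> V -> R).
Hypothesis HG : closed_strictly_positive_form G b c.

Lemma integral_mul_indic (K S : set T) (s : V -> \bar R) (a : R) :
  measurable K -> measurable S -> S `<=` K -> mu.-integrable K (s : T -> \bar R) ->
  mu.-integrable K (fun x : T => s x * (a * \1_S x)%:E) /\
  \int[mu]_(x in K) (s x * (a * \1_S x)%:E) = a%:E * \int[mu]_(x in S) s x.
Proof.
move=> mK mS SK is_.
have E : (fun x : T => s x * (a * \1_S x)%:E) = (fun x : T => a%:E * ((s : T -> \bar R) \_ S) x).
  apply/funext => x; rewrite patchE indicE; case: ifPn => xS.
    by rewrite mulr1 muleC.
  by rewrite mulr0 !mule0.
have iS : mu.-integrable K ((s : T -> \bar R) \_ S).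
  apply: (iffLR (integrable_restrict mu mS mK s)).
  exact: (integrableS mK (measurableI _ _ mK mS) (@subIsetl _ _ _) is_).
rewrite E; split; first exact: integrableZl.
by rewrite integralZl// -integral_mkcondr setIidr.
Qed.

(** The integral of (M - u) L W is at most 0, because [L W] has integral zero. As M - u >= 0 on [K],
    [L W] may be replaced by its lower bound. *)
Lemma test_inequality (Om K : set V) (B S : set T) (u : V -> \bar R) (W : V -> R) (a e M : R) :
  open Om -> Om `<=` G -> ash_proper b c Om u -> compact K -> K `<=` Om ->
  smooth W -> (forall x, (0 <= W x)%R) -> (forall x, ~ K x -> W x = 0%R) ->
  measurable B -> measurable S -> B `<=` K -> S `<=` K ->
  (forall x : V, (a * \1_B (x : T) - e * \1_S (x : T) <= Lop b c W x)%R) ->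
  (forall x, K x -> u x <= M%:E) ->
  a%:E * \int[mu]_(x in B) (M%:E - u x) <= e%:E * \int[mu]_(x in S) (M%:E - u x).
Proof.
move=> oO OG [L1 su tst] cK KO sW W0 Wz mB mS BK SK LW uM.
have mK := measurable_compact cK.
have KG := subset_trans KO OG.
have mu1 := measurable_usc oO (strongly_usc_usc su).
have iu := (L1locP oO mu1).1 L1 K cK KO.
have iM : mu.-integrable (K : set T) (fun=> M%:E).
  apply: (continuous_integrable_compact cK (f := fun=> M)) => x; exact: cst_continuous.
pose s (x : V) := M%:E - u x.
have is_ : mu.-integrable (K : set T) (s : T -> \bar R) by exact: integrableB.
have s0 x : K x -> 0 <= s x by move=> Kx; rewrite sube_ge0 ?orbT//; exact: uM.
have [i1 e1] := integral_test HG cK KG sW Wz iu.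
have [i2 e2] := integral_test HG cK KG sW Wz iM.
have [i3 e3] := integral_test HG cK KG sW Wz is_.
have tw : test_fn Om W by split => //; exists K.
have pos := tst W tw; rewrite e1 in pos.
have zero : \int[mu]_(x in (K : set T)) (M%:E * (Lop b c W x)%:E) = 0.
  rewrite -e2; have [ia <-] := integral_affine_Lop HG cK KG sW Wz M (fun=> 0%R).
  rewrite -integral_leb//; apply: eq_iint => x; rewrite -EFinM; congr (_ * _)%:E.
  by rewrite /affine big1 ?addr0// => i _; rewrite mul0r.
have neg : \int[mu]_(x in (K : set T)) (s x * (Lop b c W x)%:E) <= 0.
  rewrite (eq_integral (fun x : T => M%:E * (Lop b c W x)%:E - u x * (Lop b c W x)%:E)); last first.
    by move=> x _; rewrite /s muleBl// fin_num_adde_defr.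
  by rewrite integralB// zero sub0e oppe_le0.
have [iB eB] := integral_mul_indic a mK mB BK is_.
have [iS eS] := integral_mul_indic e mK mS SK is_.
have iD : mu.-integrable (K : set T) (fun x : T => s x * (a * \1_B x - e * \1_S x)%:E).
  apply: integrableMl => //.
    by apply: measurable_funTS; apply: measurable_funB; apply: measurable_funM.
  exists (`|a| + `|e|)%R; split; first exact: num_real.
  move=> t Bt x _ /=; apply: (le_trans _ (ltW Bt)); apply: (le_trans (ler_normB _ _)).
  by apply: lerD; rewrite normrM ler_piMr// indicE; case: (_ \in _); rewrite ?normr1 ?normr0.
have H1 : \int[mu]_(x in (K : set T)) (s x * (a * \1_B x - e * \1_S x)%:E) <= 0.
  apply: le_trans neg; apply: le_integral => // x /set_mem Kx.
  by apply: lee_wpmul2l; [exact: s0|rewrite lee_fin].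
have H2 : \int[mu]_(x in (K : set T)) (s x * (a * \1_B x - e * \1_S x)%:E) =
   a%:E * \int[mu]_(x in B) s x - e%:E * \int[mu]_(x in S) s x.
  rewrite -eB -eS -(integralB mK iB iS); apply: ae_eq_integral => //.
  - exact: measurable_int iD.
  - by apply: emeasurable_funB; [exact: measurable_int iB|exact: measurable_int iS].
  (* Where [s] is infinite the product need not distribute over the difference; integrability
     confines this to a null set. *)
  have := integrable_ae mK is_; apply: filterS => x /= fx Kx.
  by rewrite EFinB muleBr// fx.
have fS : e%:E * \int[mu]_(x in S) s x \is a fin_num.
  by rewrite -eS; exact: integrable_fin_num.
by move: H1; rewrite H2 sube_le0.
Qed.

End WeakHarnack.

(** * Superlevel sets and their thickenings *)

Section Superlevel.
Variables (R : realType) (n : nat).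
Local Notation V := (Cn R n).
Local Notation T := (bCn R n).
Local Notation mu := (@leb R n).
Local Open Scope ereal_scope.

Definition thicken (S : set V) (d : R) : set V :=
  [set x | exists2 p, S p & (`|x - p| < d)%R].

Lemma measurable_thicken (S : set V) (d : R) : measurable (thicken S d : set T).
Proof.
apply: open_measurable_bCn.
have -> : thicken S d = \bigcup_(p in S) ball p d.
  by apply/seteqP; split => x [p Sp xp]; exists p => //; move: xp; rewrite ball_CnE.
by apply: bigcup_open => p _; rewrite openE => x; rewrite /interior => xp; apply: open_nbhs_nbhs; split => //; exact: ball_open.
Qed.

Lemma sub_thicken (S : set V) (d : R) : (0 < d)%R -> S `<=` thicken S d.
Proof. by move=> d0 x Sx; exists x => //; rewrite subrr normr0. Qed.

Lemma closed_superlevel (Om : set V) (u : V -> \bar R) (w : V) (rho t : R) :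
  usc_on Om u -> [set y | (`|y - w| <= rho)%R] `<=` Om ->
  closed [set y | (`|y - w| <= rho)%R /\ t%:E <= u y].
Proof.
move=> [_ usc] BO x clx.
have cB : closed [set y : V | (`|y - w| <= rho)%R].
  exact: (compact_closedV (@compact_closed_ball_Cn R n w rho)).
have Bx : (`|x - w| <= rho)%R.
  by apply: cB => U /clx [y [[By _] Uy]]; exists y.
split => //; rewrite leNgt; apply/negP => ux.
have [y [[_ ty]]] := clx _ (usc x (BO x Bx) t ux).
by rewrite ltNge ty.
Qed.

(** Were the set null, its complement would have full measure near [w], and strong upper
    semicontinuity would find in it a point of the ball with u > t. *)
Lemma superlevel_gt0 (Om : set V) (u : V -> \bar R) (w : V) (rho t : R) :
  strongly_usc Om u -> (0 < rho)%R -> [set y | (`|y - w| <= rho)%R] `<=` Om ->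
  t%:E < u w ->
  0 < mu [set y : V | (`|y - w| <= rho)%R /\ t%:E <= u y].
Proof.
move=> su rho0 BO tw; set S : set T := [set y : V | _].
have mS : measurable S.
  exact: (closed_measurable_bCn (closed_superlevel (strongly_usc_usc su) BO)).
rewrite lt0e measure_ge0 andbT; apply/eqP => S0.
have [_ _ u3] := su.
have Ow : Om w by apply: BO; rewrite /= subrr normr0 ltW.
have fA : full_near (~` S : set V) w.
  exists rho => //; exists (S : set V); split => //.
  by move=> z [_ /contrapT].
have [z [/= nS zw tz]] := u3 w _ Ow fA t tw rho rho0.
by apply: nS; split; exact: ltW.
Qed.

(** As [S] is closed, its thickenings of width d0/(k+1) shrink to [S] itself, and dominated
    convergence applies with the majorant |f|. *)
Lemma le_integral_thicken (S K : set V) (f : V -> \bar R) (c : \bar R) (d0 : R) :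
  closed S -> measurable (K : set T) -> mu.-integrable (K : set T) (f : T -> \bar R) ->
  (0 < d0)%R -> thicken S d0 `<=` K ->
  (forall d : R, (0 < d <= d0)%R -> c <= \int[mu]_(x in (thicken S d : set T)) f x) ->
  c <= \int[mu]_(x in (S : set T)) f x.
Proof.
move=> cS mK iF d00 SK H.
have mS : measurable (S : set T) by exact: closed_measurable_bCn.
have mF : measurable_fun (K : set T) (f : T -> \bar R) by exact: measurable_int iF.
pose d k : R := (d0 / k.+1%:R)%R.
have dk k : (0 < d k <= d0)%R.
  by rewrite /d divr_gt0//= ler_pdivrMr// ler_peMr ?ler1n// ltW.
have TK k : thicken S (d k) `<=` K.
  move=> x [p Sp xp]; apply: SK; exists p => //; apply: (lt_le_trans xp).
  by case/andP: (dk k).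
have SK' : S `<=` K by move=> x /(sub_thicken d00) /SK.
have mT k : measurable (thicken S (d k) : set T) by exact: measurable_thicken.
have mr (E : set T) : measurable E -> E `<=` K -> measurable_fun (K : set T) (f \_ E).
  move=> mE EK; apply/(measurable_restrict _ mE mK).
  by rewrite setIidr//; exact: measurable_funS mF.
have [_ _ cv] : [/\ mu.-integrable (K : set T) ((f : T -> \bar R) \_ (S : set T)),
    (\int[mu]_(x in (K : set T)) `|(((f : T -> \bar R) \_ (thicken S (d k) : set T)) x) - ((f : T -> \bar R) \_ (S : set T)) x|) @[k --> \oo] --> 0
    & (\int[mu]_(x in (K : set T)) ((f : T -> \bar R) \_ (thicken S (d k) : set T)) x) @[k --> \oo] -->
      \int[mu]_(x in (K : set T)) ((f : T -> \bar R) \_ (S : set T)) x].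
  apply: (@dominated_convergence _ _ _ mu (K : set T) mK
    (fun k => (f : T -> \bar R) \_ (thicken S (d k) : set T)) _ (fun x => `|f x|)).
  - by move=> k; exact: mr.
  - exact: mr.
  - apply/aeW => x _; rewrite !patchE; case: ifPn => xS.
      apply: cvg_near_cst; apply: nearW => k; rewrite patchE ifT//.
      apply/mem_set/sub_thicken; last exact/set_mem.
      by case/andP: (dk k).
    apply: cvg_near_cst.
    have oC : open (~` S) by exact: closed_openC.
    have /nbhs_ballP[e /= e0 he] : nbhs (x : V) (~` S).
      by apply: open_nbhs_nbhs; split => //; move/negP: xS => xS Sx; apply: xS; exact/mem_set.
    have H0 : \forall k \near \oo, (d k < e)%R.
      have := @cvg_harmonic R.
      move=> /cvgrPdist_lt /(_ (e / d0)%R (divr_gt0 e0 d00)); apply: filterS => k.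
      rewrite sub0r normrN /harmonic ger0_norm ?invr_ge0 ?ler0n//.
      by rewrite ltr_pdivlMr// mulrC.
    apply: filterS H0 => k dke; rewrite patchE ifF//; apply/negP => /set_mem [p Sp xp].
    apply: (he p) => //; rewrite ball_CnE /= distrC; exact: lt_trans xp dke.
  - exact: integrable_abse.
  - by apply/aeW => x k _; rewrite patchE; case: ifPn => // _; rewrite abse0 abse_ge0.
rewrite -(setIidr SK') integral_mkcondr -(cvg_lim _ cv)//.
apply: lime_ge; first by apply/cvg_ex; exists (\int[mu]_(x in (K : set T)) ((f : T -> \bar R) \_ (S : set T)) x).
by apply: nearW => k; rewrite -integral_mkcondr setIidr//; exact: H.
Qed.

(** The set is covered by cubes of side 4 sigma, each of volume (4 sigma)^(2n) = 16^n
    (sigma^2)^n. *)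
Lemma measure_le_separated (sigma : R) (S : set T) (ps : seq V) : (0 < sigma)%R ->
  measurable S ->
  (forall x : V, S x -> exists2 p, p \in ps & (`|x - p| < 2 * sigma)%R) ->
  mu S <= ((size ps)%:R * ((16 ^+ n) * (sigma ^+ 2) ^+ n))%:E.
Proof.
move=> s0 mS cov; have s20 : (0 < 2 * sigma)%R by rewrite mulr_gt0.
pose B (p : V) : set T := [set y : V | (`|y - p| < 2 * sigma)%R].
have mB p : measurable (B p) by exact: measurable_ball_bCn.
have mU : measurable (\big[setU/set0]_(p <- ps) B p).
  by rewrite -bigcup_seq; apply: fin_bigcup_measurable => //; exact: finite_seq.
apply: (@le_trans _ _ (mu (\big[setU/set0]_(p <- ps) B p))).
  apply: le_measure; rewrite ?inE// => x /cov[p pps xp].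
  by rewrite -bigcup_seq; exists p.
apply: (@le_trans _ _ (\sum_(p <- ps) mu (B p))).
  elim: (ps) => [|p qs IH]; first by rewrite !big_nil measure0.
  rewrite !big_cons; apply: (le_trans (measureU2 _ _ _)) => //.
    by rewrite -bigcup_seq; apply: fin_bigcup_measurable => //; exact: finite_seq.
  exact: leeD2l.
rewrite (eq_bigr (fun=> (16 ^+ n * (sigma ^+ 2) ^+ n)%:E)).
  by rewrite sumEFin big_const_seq count_predT iter_addr addr0 mulr_natl.
move=> p _; rewrite leb_ball//; congr EFin.
rewrite -exprMn addnn -mul2n exprM; congr (_ ^+ n)%R.
by rewrite -mulr_natr; ring.
Qed.

End Superlevel.

(** * From small balls to the value at one point *)

Section WeakHarnackInequality.
Variables (R : realType) (n : nat).
Local Notation V := (Cn R n).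
Local Notation T := (bCn R n).
Local Notation mu := (@leb R n).
Local Open Scope ereal_scope.
Variables (G : set V) (b c : 'I_n -> 'I_n -> V -> R).
Hypothesis HG : closed_strictly_positive_form G b c.

Lemma weak_harnack (z0 : V) : (0 < n)%N -> G z0 ->
  exists th r1 C : R, [/\ (0 < th)%R, (th <= 8^-1)%R, (0 < r1)%R & (0 < C)%R] /\
  [set y | (`|y - z0| <= r1)%R] `<=` G /\
  forall (r : R) (Om : set V) (u : V -> \bar R) (M t : R) (w : V),
    (0 < r <= r1)%R -> open Om -> Om `<=` G -> [set y | (`|y - z0| <= r)%R] `<=` Om ->
    ash_proper b c Om u -> (forall x, (`|x - z0| < r)%R -> u x <= M%:E) ->
    (`|w - z0| < th * r)%R -> t%:E <= u w ->
    mu.-integrable ([set y : V | (`|y - z0| < th * r)%R] : set T) (fun x : T => M%:E - u x) /\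
    \int[mu]_(x in ([set y : V | (`|y - z0| < th * r)%R] : set T)) (M%:E - u x)
      <= (C * (r ^+ 2) ^+ n * (M - t))%:E.
Proof.
move=> n0 Gz; have [th [r1 [a [e [[/andP[th0 th8] r10 a0 e0] [r1G bar]]]]]] := barrier HG n0 Gz.
(* 16^n comes from the covering in [measure_le_separated], e/a from the two weights of the
   barrier. *)
exists th, r1, (16 ^+ n * e / a)%R; split.
  by split => //; rewrite divr_gt0// mulr_gt0// exprn_gt0.
split => // r Om u M t w /andP[r0 rr1] oO OG rO au uM wz tu.
have [L1 su _] := au.
pose Kc : set V := [set y | (`|y - z0| <= r / 2)%R].
have cK : compact Kc by exact: compact_closed_ball_Cn.
have mK : measurable (Kc : set T) := measurable_compact cK.
have r2 : (r / 2 < r)%R by rewrite ltr_pdivrMr// ltr_pMr// ltr1n.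
have KO : Kc `<=` Om by move=> y /= yz; apply: rO; apply: (le_trans yz); exact: ltW.
have thr : (0 < th * r)%R by rewrite mulr_gt0.
have thr8 : (8 * (th * r) <= r)%R.
  by rewrite mulrA ler_piMl ?(ltW r0)// -ler_pdivlMl// mulr1.
pose B : set T := [set y : V | (`|y - z0| < th * r)%R].
have mB : measurable B by exact: measurable_ball_bCn.
have BK : B `<=` Kc by move=> y; rewrite /B /Kc /=; lra.
pose s (x : V) := M%:E - u x.
have mu1 := measurable_usc oO (strongly_usc_usc su).
have iu := (L1locP oO mu1).1 L1 Kc cK KO.
have is_ : mu.-integrable (Kc : set T) (s : T -> \bar R).
  apply: integrableB => //.
  by apply: (continuous_integrable_compact cK (f := fun=> M)) => x; exact: cst_continuous.
have s0 x : Kc x -> 0 <= s x.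
  by move=> Kx; rewrite sube_ge0 ?orbT//; apply: uM; exact: le_lt_trans Kx r2.
have iB : mu.-integrable B (s : T -> \bar R) := integrableS mK mB BK is_.
split => //.
have ms : measurable_fun (Kc : set T) (s : T -> \bar R) by exact: measurable_int is_.
pose I := fine (\int[mu]_(x in B) s x).
have IE : \int[mu]_(x in B) s x = I%:E by rewrite fineK//; exact: integrable_fin_num.
have I0 : (0 <= I)%R.
  by rewrite -lee_fin -IE; apply: integral_ge0 => x /BK; exact: s0.
rewrite -/B -/s IE lee_fin.
set X := (16 ^+ n * e / a * _)%R.
have X0 : (0 < X)%R by rewrite mulr_gt0 ?exprn_gt0// divr_gt0// mulr_gt0// exprn_gt0.
(* Strong upper semicontinuity gives positive measure only to superlevels strictly below [u w],
   hence the loss eta. *)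
suff H eta : (0 < eta)%R -> (I <= X * (M - t + eta))%R.
  apply/ler_addgt0Pr => eta eta0.
  have := H (eta / X)%R (divr_gt0 eta0 X0).
  by rewrite mulrDr [(X * (eta / X))%R]mulrC divfK ?gt_eqF.
move=> eta0.
pose rho := ((th * r - `|w - z0|) / 2)%R.
have rho0 : (0 < rho)%R by rewrite divr_gt0// subr_gt0.
have rhoE : (`|w - z0| + rho < th * r)%R by rewrite /rho; move: wz; lra.
have wB y : (`|y - w| <= rho)%R -> (`|y - z0| < th * r)%R.
  move=> yw; apply: le_lt_trans rhoE.
  have := ler_normD (y - w)%R (w - z0)%R; rewrite addrA subrK => /le_trans; apply.
  by rewrite addrC lerD2l.
have wO : [set y | (`|y - w| <= rho)%R] `<=` Om.
  by move=> y /wB /(BK y); exact: KO.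
have te : (t - eta)%:E < u w.
  by apply: lt_le_trans tu; rewrite lte_fin ltrBlDr ltrDl.
pose S : set T := [set y : V | (`|y - w| <= rho)%R /\ (t - eta)%:E <= u y].
have cS : closed (S : set V) := closed_superlevel (strongly_usc_usc su) wO.
have S0 : 0 < mu S := superlevel_gt0 su rho0 wO te.
have mS : measurable S by exact: closed_measurable_bCn.
have SB : S `<=` B by move=> y [/wB].
have muB : mu B = (((th * r) *+ 2) ^+ (n + n))%:E by exact: leb_ball.
have Sfin : mu S \is a fin_num.
  rewrite ge0_fin_numE//; apply: (@le_lt_trans _ _ (mu B)); last by rewrite muB ltry.
  by apply: le_measure; rewrite ?inE.
pose m := fine (mu S).
have mE : mu S = m%:E by rewrite fineK.
have m0 : (0 < m)%R by rewrite -lte_fin -mE.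
have TK : thicken S (th * r) `<=` Kc.
  move=> x [p /SB pB xp]; rewrite /Kc /=.
  have := ler_normD (x - p)%R (p - z0)%R; rewrite addrA subrK.
  by move: pB xp; rewrite /B/=; lra.
have a'0 : (0 < a * (r ^+ 2) ^- n)%R by rewrite mulr_gt0// invr_gt0 !exprn_gt0.
(* A bound independent of the scale d: each small ball contributes at least [q], proportional to
   d^(2n), and the covering forces at least m / (16^n d^(2n)) balls. *)
pose c0 := (m * (a * (r ^+ 2) ^- n * I) / (16 ^+ n * e))%R.
have key : c0%:E <= \int[mu]_(x in S) s x.
  apply: (le_integral_thicken cS mK is_ thr TK) => d /andP[d0 dth].
  have [ps [sep pS cov]] := maximal_separated (mulr_gt0 (ltr0Sn _ 1) d0) thr SB.
  have := measure_le_separated d0 mS cov; rewrite mE lee_fin => mle.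
  have dTK : thicken S d `<=` Kc.
    by move=> x [p Sp xp]; apply: TK; exists p => //; exact: lt_le_trans xp dth.
  have d20 : (0 < (d ^+ 2) ^+ n)%R by rewrite !exprn_gt0.
  pose q := (a * (r ^+ 2) ^- n * I * (d ^+ 2) ^+ n / e)%R.
  have each p : p \in ps -> q%:E <= \int[mu]_(x in ([set y : V | (`|y - p| < d)%R] : set T)) s x.
    move=> /pS Sp; have pz : (`|p - z0| < 2 * th * r)%R.
      by move: (SB _ Sp); rewrite /B/=; lra.
    have [W [sW W0 Wz LW]] := bar r p d (introT andP (conj r0 rr1)) pz (introT andP (conj d0 dth)).
    have pK : [set y : V | (`|y - p| < d)%R] `<=` Kc.
      by move=> y yp; apply: dTK; exists p.
    have Wz' x : ~ Kc x -> W x = 0%R.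
      by move=> /negP; rewrite -ltNge => /ltW; exact: Wz.
    have Ku x : Kc x -> u x <= M%:E by move=> Kx; apply: uM; exact: le_lt_trans Kx r2.
    have := test_inequality HG oO OG au cK KO sW W0 Wz' mB (measurable_ball_bCn p d) BK pK LW Ku.
    rewrite -/s IE -EFinM -lee_pdivrMl ?mulr_gt0 ?invr_gt0// -EFinM.
    by apply: le_trans; rewrite lee_fin /q invfM invrK le_eqVlt; apply/orP; left; apply/eqP; ring.
  apply: (@le_trans _ _ (\sum_(p <- ps) q%:E)).
    rewrite sumEFin big_const_seq count_predT iter_addr addr0 lee_fin -mulr_natl /c0.
    rewrite ler_pdivrMr ?mulr_gt0 ?exprn_gt0//.
    have -> : ((size ps)%:R * q * (16 ^+ n * e) = (size ps)%:R * (16 ^+ n * (d ^+ 2) ^+ n) * (a * (r ^+ 2) ^- n * I))%R.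
      by rewrite /q; move: (_ ^- n)%R => y; field; rewrite gt_eqF.
    by apply: ler_wpM2r => //; rewrite mulr_ge0// ltW.
  apply: (@le_trans _ _ (\sum_(p <- ps) \int[mu]_(x in ([set y : V | (`|y - p| < d)%R] : set T)) s x)).
    by rewrite big_seq [leRHS]big_seq; apply: lee_sum => p; exact: each.
  apply: separated_integral_le => //.
  - exact: measurable_thicken.
  - exact: measurable_funS ms.
  - by move=> x /dTK; exact: s0.
  - by move=> p /pS Sp x xp; exists p.
have up : \int[mu]_(x in S) s x <= (m * (M - t + eta))%:E.
  apply: (@le_trans _ _ (\int[mu]_(x in S) (M - t + eta)%:E)).
    apply: le_integral => //.
    - by apply: (integrableS mK) is_ => // x /SB /BK.
    - apply: (integrableS mK mS); first by move=> x /SB /BK.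
      by apply: (continuous_integrable_compact cK (f := fun=> (M - t + eta)%R)) => x; exact: cst_continuous.
    move=> x /set_mem [_ tx]; rewrite /s.
    have -> : (M - t + eta = M - (t - eta))%R by rewrite opprB addrA addrAC.
    by rewrite EFinB leeB.
  have -> : \int[mu]_(x in S) (M - t + eta)%:E = (M - t + eta)%:E * mu S by exact: integral_cst.
  by rewrite mE -EFinM mulrC.
have := le_trans key up; rewrite lee_fin /c0 -mulrA ler_pM2l// ler_pdivrMr ?mulr_gt0 ?exprn_gt0//.
rewrite -mulrA -ler_pdivlMl// => h.
have y0 : (0 < (r ^+ 2) ^- n)%R by rewrite invr_gt0 !exprn_gt0.
rewrite /X mulrC -[((r ^+ 2) ^+ n)%R]invrK.
move: h; move: (_ ^- n)%R y0 => y y0; rewrite -ler_pdivlMl// => /le_trans; apply.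
rewrite le_eqVlt; apply/orP; left; apply/eqP; field.
by rewrite !gt_eqF.
Qed.

End WeakHarnackInequality.

(** * Sums of subharmonic functions *)

Section Sums.
Variables (R : realType) (n : nat).
Local Notation V := (Cn R n).
Local Notation T := (bCn R n).
Local Notation mu := (@leb R n).
Local Open Scope ereal_scope.
Variables (G : set V) (b c : 'I_n -> 'I_n -> V -> R).
Hypothesis HG : closed_strictly_positive_form G b c.

(** If u + v <= c0 almost everywhere, the deficits M1 - u and M2 - v add up to at least M1 + M2 - c0
    there, whereas the weak Harnack inequality bounds their means by the deficits at [w1] and [w2].
    The two points may differ, as is needed when a value is only approached near [z0]. *)
Lemma deficit_sum (z0 : V) : (0 < n)%N -> G z0 ->
  exists th r1 C : R, [/\ (0 < th)%R, (th < 1)%R, (0 < r1)%R & (0 < C)%R] /\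
  forall (r : R) (Om : set V) (u v : V -> \bar R) (M1 M2 t1 t2 c0 : R) (w1 w2 : V) (N : set T),
    (0 < r <= r1)%R -> open Om -> Om `<=` G -> [set y | (`|y - z0| <= r)%R] `<=` Om ->
    ash_proper b c Om u -> ash_proper b c Om v ->
    (forall x, (`|x - z0| < r)%R -> u x <= M1%:E) ->
    (forall x, (`|x - z0| < r)%R -> v x <= M2%:E) ->
    (`|w1 - z0| < th * r)%R -> t1%:E <= u w1 ->
    (`|w2 - z0| < th * r)%R -> t2%:E <= v w2 ->
    measurable N -> mu N = 0 ->
    (forall x, (`|x - z0| < th * r)%R -> ~ N x -> u x + v x <= c0%:E) ->
    (M1 + M2 - c0 <= C * ((M1 - t1) + (M2 - t2)))%R.
Proof.
move=> n0 Gz; have [th [r1 [C [[th0 th8 r10 C0] [_ wh]]]]] := weak_harnack HG n0 Gz.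
have k0 : (0 < (4 * th ^+ 2) ^+ n)%R by rewrite exprn_gt0// mulr_gt0// exprn_gt0.
have th1 : (th < 1)%R by apply: (le_lt_trans th8); rewrite invf_lt1// ltr1n.
(* The divisor times (r^2)^n is the volume (2 th r)^(2n) of B(z0, th r). *)
exists th, r1, (C / (4 * th ^+ 2) ^+ n)%R; split; first by split=> //; rewrite divr_gt0.
move=> r Om u v M1 M2 t1 t2 c0 w1 w2 N rr oO OG rO au av uM vM wz1 tu wz2 tv mN N0 uvc.
have [i1 h1] := wh r Om u M1 t1 w1 rr oO OG rO au uM wz1 tu.
have [i2 h2] := wh r Om v M2 t2 w2 rr oO OG rO av vM wz2 tv.
have [r0 _] := andP rr.
have thr : (th * r < r)%R by rewrite gtr_pMl.
have Mt1 : (t1 <= M1)%R by rewrite -lee_fin (le_trans tu)// uM// (lt_trans wz1).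
have Mt2 : (t2 <= M2)%R by rewrite -lee_fin (le_trans tv)// vM// (lt_trans wz2).
have C'0 : (0 <= C / (4 * th ^+ 2) ^+ n)%R by rewrite divr_ge0// ltW.
have [neg|pos] := leP (M1 + M2 - c0)%R 0%R.
  by apply: (le_trans neg); rewrite mulr_ge0// addr_ge0// subr_ge0.
set B : set T := [set y : V | _] in i1 h1 i2 h2.
have mB : measurable B by exact: measurable_ball_bCn.
have ui x : B x -> u x <= M1%:E by move=> Bx; apply: uM; exact: lt_trans Bx thr.
have vi x : B x -> v x <= M2%:E by move=> Bx; apply: vM; exact: lt_trans Bx thr.
have up : \int[mu]_(x in B) ((M1%:E - u x) + (M2%:E - v x)) <=
    (C * (r ^+ 2) ^+ n * (M1 - t1) + C * (r ^+ 2) ^+ n * (M2 - t2))%:E.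
  by rewrite (integralD mB i1 i2) EFinD; exact: leeD.
have low : (M1 + M2 - c0)%:E * mu B <= \int[mu]_(x in B) ((M1%:E - u x) + (M2%:E - v x)).
  have -> : (M1 + M2 - c0)%:E * mu B = \int[mu]_(x in B) (M1 + M2 - c0)%:E.
    by apply/esym; exact: integral_cst.
  apply: ae_ge0_le_integral => //.
  - by move=> x _; rewrite lee_fin ltW.
  - move=> x Bx; rewrite adde_ge0// sube_ge0 ?orbT//; [exact: ui|exact: vi].
  - by apply: emeasurable_funD; [exact: measurable_int i1|exact: measurable_int i2].
  exists N; split => // x /= nx; apply: contrapT => Nx; apply: nx => Bx.
  have := uvc x Bx Nx; have := ui x Bx; have := vi x Bx.
  case: (u x) => [a| |] //; case: (v x) => [d| |] //= _ _;
    rewrite ?addeNy ?addNye ?addey// ?addye//; rewrite ?leey//.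
  by rewrite -!EFinD !lee_fin; lra.
have := le_trans low up; rewrite leb_ball ?mulr_gt0// -EFinM lee_fin.
have -> : (((th * r) *+ 2) ^+ (n + n) = (4 * th ^+ 2) ^+ n * (r ^+ 2) ^+ n)%R.
  rewrite -exprMn addnn -mul2n exprM; congr (_ ^+ n)%R.
  by rewrite -mulr_natr; ring.
have rn0 : (0 < (r ^+ 2) ^+ n)%R by rewrite !exprn_gt0.
rewrite -mulrDr mulrA [(C * _)%R]mulrC -[X in (_ <= X)%R]mulrA [X in (_ <= X)%R]mulrC ler_pM2r//.
by rewrite -ler_pdivlMr// => /le_trans; apply; rewrite mulrAC.
Qed.

Lemma lt_splitD (x y : \bar R) (t : R) : x < +oo -> y < +oo -> x + y < t%:E ->
  exists p q : R, [/\ x < p%:E, y < q%:E & (p + q = t)%R].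
Proof.
case: x => [x| |] //; case: y => [y| |] // _ _.
- rewrite -EFinD lte_fin => h; exists (x + (t - x - y) / 2)%R, (y + (t - x - y) / 2)%R.
  by split; rewrite ?lte_fin; [lra|lra|field].
- by exists (x + 1)%R, (t - x - 1)%R; split; [rewrite lte_fin ltrDl|rewrite ltNyr|ring].
- by exists (t - y - 1)%R, (y + 1)%R; split; [rewrite ltNyr|rewrite lte_fin ltrDl|ring].
- by exists t, 0%R; split; rewrite ?ltNyr// addr0.
Qed.

Lemma usc_on_add (Om : set V) (u v : V -> \bar R) :
  usc_on Om u -> usc_on Om v -> usc_on Om (fun z => u z + v z).
Proof.
move=> [u1 u2] [v1 v2]; split=> z Oz.
  by apply: lte_add_pinfty; [exact: u1|exact: v1].
move=> t /(lt_splitD (u1 z Oz) (v1 z Oz)) [p [q [up vq <-]]].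
apply: filterS2 (u2 z Oz p up) (v2 z Oz q vq) => y yp yq.
by rewrite EFinD lteD.
Qed.

Lemma strongly_usc_add (Om : set V) (u v : V -> \bar R) : (0 < n)%N ->
  open Om -> Om `<=` G -> ash_proper b c Om u -> ash_proper b c Om v ->
  strongly_usc Om (fun z => u z + v z).
Proof.
move=> n0 oO OG au av; have [_ su _] := au; have [_ sv _] := av.
have [s1 s2] := usc_on_add (strongly_usc_usc su) (strongly_usc_usc sv).
split => // z0 A Oz fA t tz r r0.
apply: contrapT => nex.
have [u1 u2 _] := su; have [v1 v2 _] := sv.
have [p [q [up vq]]] : exists p q : R, [/\ u z0 = p%:E, v z0 = q%:E & (t < p + q)%R].
  move: tz (u1 z0 Oz) (v1 z0 Oz); case: (u z0) => [p| |] //; case: (v z0) => [q| |] // h _ _.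
  by exists p, q; split => //; rewrite -lte_fin EFinD.
move=> tpq.
have [th [r1 [C [[th0 th1 r10 C0] def]]]] := deficit_sum n0 (OG _ Oz).
(* With upper bounds p + eta and q + eta near [z0], the assumption u + v <= t almost everywhere
   would give p + q - t + 2 eta <= 2 C eta = p + q - t. *)
pose eta := ((p + q - t) / (2 * C))%R.
have eta0 : (0 < eta)%R by rewrite divr_gt0 ?subr_gt0// mulr_gt0.
have pe : u z0 < (p + eta)%:E by rewrite up lte_fin ltrDl.
have qe : v z0 < (q + eta)%:E by rewrite vq lte_fin ltrDl.
have nO : nbhs z0 Om by exact: open_nbhs_nbhs.
have [r2 r20 hr2] : exists2 r2 : R, (0 < r2)%R & forall y, (`|y - z0| < r2)%R ->
    [/\ Om y, u y < (p + eta)%:E & v y < (q + eta)%:E].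
  have H : nbhs z0 (fun y => Om y /\ (u y < (p + eta)%:E /\ v y < (q + eta)%:E)).
    exact: filterI nO (filterI (u2 z0 Oz _ pe) (v2 z0 Oz _ qe)).
  have /nbhs_ballP[r2 /= r20 h] := H.
  by exists r2 => // y yz; have [|? []] := h y; [rewrite ball_CnE|split].
have [r3 r30 /null_set_leb[N [mN AN N0]]] := fA.
(* Only B(z0, th m) has to lie in the region where [A] is of full measure, hence the division by
   [th]. *)
pose m := (Num.min (r2 / 2) (Num.min r1 (Num.min r r3 / th)))%R.
have m0 : (0 < m)%R by rewrite !lt_min divr_gt0//= r10 divr_gt0// lt_min r0.
have mr1 : (m <= r1)%R by rewrite /m !ge_min lexx !orbT.
have mr2 : (m < r2)%R.
  by apply: (@le_lt_trans _ _ (r2 / 2)%R); [rewrite /m ge_min lexx|rewrite ltr_pdivrMr// ltr_pMr// ltr1n].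
have mr3 : (th * m <= Num.min r r3)%R.
  by rewrite mulrC -ler_pdivlMr// /m !ge_min lexx !orbT.
have z00 : (`|z0 - z0| < th * m)%R by rewrite subrr normr0 mulr_gt0.
have := def m Om u v (p + eta)%R (q + eta)%R p q t z0 z0 N _ oO OG _ au av _ _ z00 _ z00 _ mN N0.
have -> : (p + eta + (q + eta) - t = (p + q - t) + 2 * eta)%R by ring.
have -> : (p + eta - p + (q + eta - q) = 2 * eta)%R by ring.
have -> : (C * (2 * eta) = p + q - t)%R by rewrite /eta; field; rewrite gt_eqF.
rewrite m0 mr1 up vq !lexx => H.
suff : (p + q - t + 2 * eta <= p + q - t)%R by rewrite gerDl leNgt mulr_gt0.
apply: H => //.
- by move=> y /= yz; have [] := hr2 y (le_lt_trans yz mr2).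
- by move=> y /= yz; have [_ /ltW] := hr2 y (lt_trans yz mr2).
- by move=> y /= yz; have [_ _ /ltW] := hr2 y (lt_trans yz mr2).
move=> y yz nN; rewrite leNgt; apply/negP => ty; apply: nex; exists y.
have := lt_le_trans yz mr3; rewrite lt_min => /andP[yr yr3]; split => //.
by apply: contrapT => nA; apply: nN; apply: AN.
Qed.

Lemma ash_proper_add (Om : set V) (u v : V -> \bar R) : (0 < n)%N ->
  open Om -> Om `<=` G -> ash_proper b c Om u -> ash_proper b c Om v ->
  ash_proper b c Om (fun z => u z + v z).
Proof.
move=> n0 oO OG au av; have suv := strongly_usc_add n0 oO OG au av.
have [Lu su tu] := au; have [Lv sv tv] := av.
have iu := (L1locP oO (measurable_usc oO (strongly_usc_usc su))).1 Lu.
have iv := (L1locP oO (measurable_usc oO (strongly_usc_usc sv))).1 Lv.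
have iuv K : compact K -> K `<=` Om -> mu.-integrable (K : set T) (fun x : T => u x + v x).
  by move=> cK KO; apply: integrableD; [exact: measurable_compact|exact: iu|exact: iv].
split => //; first by apply/(L1locP oO (measurable_usc oO (strongly_usc_usc suv))).
move=> w tw; have [sw _ [K [cK KO w0]]] := tw.
have mK := measurable_compact cK; have KG := subset_trans KO OG.
have [i1 e1] := integral_test HG cK KG sw w0 (iu K cK KO).
have [i2 e2] := integral_test HG cK KG sw w0 (iv K cK KO).
have [i3 e3] := integral_test HG cK KG sw w0 (iuv K cK KO).
rewrite e3 (eq_integral (fun x : T => u x * (Lop b c w x)%:E + v x * (Lop b c w x)%:E)).
  by rewrite integralD// adde_ge0// -?e1 -?e2; [exact: tu|exact: tv].
move=> x /set_mem /KO Ox; rewrite muleDl//.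
by apply: ltpinfty_adde_def; rewrite inE /=; [case: su => /(_ x Ox)|case: sv => /(_ x Ox)].
Qed.

Lemma ash_add (Om : set V) (u v : V -> \bar R) : (0 < n)%N ->
  open Om -> Om `<=` G -> ash b c Om u -> ash b c Om v ->
  ash b c Om (fun z => u z + v z).
Proof.
move=> n0 oO OG [uN|up] [vN|vp]; last by right; exact: ash_proper_add.
all: left => z Oz.
- by rewrite uN// addNye.
- by rewrite uN// addNye.
- by rewrite vN// addeNy.
Qed.

End Sums.

(** * Extremal functions *)

Section ExtremalFunction.
Variables (R : realType) (n : nat).
Local Notation V := (Cn R n).
Local Open Scope ereal_scope.
Variables (G : set V) (b c : 'I_n -> 'I_n -> V -> R).
Implicit Types (E D K B : set V) (psi : V -> R) (u : V -> \bar R) (z : V).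

Lemma omega_star_ge E D psi u z : D z -> Uclass b c E D psi u ->
  u z <= omega_star b c E D psi z.
Proof.
move=> Dz Uu; apply: le_ereal_inf_tmp => _ [r /= r0 <-].
apply: (@le_trans _ _ (omega b c E D psi z)); apply: ereal_sup_ubound.
  by exists u.
by exists z => //=; split => //; rewrite subrr normr0.
Qed.

Lemma omega_star_lt E D psi z (t : \bar R) : omega_star b c E D psi z < t ->
  exists2 r : R, (0 < r)%R & forall u w, Uclass b c E D psi u -> D w ->
    (`|w - z| < r)%R -> u w < t.
Proof.
move=> /ereal_inf_lt[_ [r /= r0 <-] st]; exists r => // u w Uu Dw wz.
apply: le_lt_trans st; apply: (@le_trans _ _ (omega b c E D psi w)); apply: ereal_sup_ubound.
  by exists u.
by exists w.
Qed.

Lemma omega_star_le E D psi z (t : \bar R) (r : R) : (0 < r)%R ->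
  (forall u w, Uclass b c E D psi u -> D w -> (`|w - z| < r)%R -> u w <= t) ->
  omega_star b c E D psi z <= t.
Proof.
move=> r0 H.
apply: (@le_trans _ _ (ereal_sup [set omega b c E D psi w | w in [set w | D w /\ (`|w - z| < r)%R]])).
  by apply: ereal_inf_lbound; exists r.
apply: ge_ereal_sup => _ [w /= [Dw wz] <-].
by apply: ge_ereal_sup => _ [u Uu <-]; exact: H.
Qed.

Lemma omega_star_scale E1 E2 D psi1 psi2 z (m t : R) : (0 < m)%R ->
  (forall u, Uclass b c E1 D psi1 u -> Uclass b c E2 D psi2 (fun x => m%:E * u x)) ->
  omega_star b c E2 D psi2 z <= t%:E -> omega_star b c E1 D psi1 z <= (t / m)%:E.
Proof.
move=> m0 UU st; apply/lee_addgt0Pr => e e0.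
have : omega_star b c E2 D psi2 z < (t + m * e)%:E.
  by apply: (le_lt_trans st); rewrite lte_fin ltrDl mulr_gt0.
move=> /omega_star_lt[r r0 H]; apply: (omega_star_le r0) => u w Uu Dw wz.
have := H _ w (UU u Uu) Dw wz; rewrite -lte_pdivlMl// -EFinM => /ltW/le_trans; apply.
by rewrite -EFinD lee_fin mulrDr mulKf ?gt_eqF// mulrC.
Qed.

Lemma omega_star_le0 E D psi z : omega_star b c E D psi z <= 0.
Proof.
by apply: (@omega_star_le _ _ _ _ _ 1) => // u w [_ u0 _] Dw _; apply/ltW/u0.
Qed.

(** The smaller neighbourhood is a closed ball, because regularity is tested on the closure of a
    neighbourhood. *)
Lemma small_neighborhood K B psi z (e : R) : nbhs z B -> {within K, continuous psi} ->
  K z -> (0 < e)%R ->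
  exists B', [/\ nbhs z B', B' `<=` B &
    forall y, K y -> closure B' y -> (`|psi z - psi y| < e)%R].
Proof.
move=> zB /subspace_continuousP cpsi Kz e0.
have /cvgrPdist_lt /(_ e e0) := cpsi z Kz; rewrite near_withinE => H.
have HB : nbhs z (fun y => B y /\ (K y -> (`|psi z - psi y| < e)%R)) by exact: filterI zB H.
have /nbhs_ballP[r /= r0 hr] := HB.
have r2 : (r / 2 < r)%R by rewrite ltr_pdivrMr// ltr_pMr// ltr1n.
exists [set y | (`|y - z| <= r / 2)%R]; split.
- apply/nbhs_ballP; exists (r / 2)%R; first by rewrite /= divr_gt0.
  by move=> y; rewrite ball_CnE /=; exact: ltW.
- by move=> y /= yz; have [] := hr y; rewrite // ball_CnE /=; exact: le_lt_trans r2.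
move=> y Ky; rewrite -(closure_id _).1; last exact: (compact_closedV (@compact_closed_ball_Cn R n z _)).
by move=> /= yz; have [|_] := hr y; [rewrite ball_CnE /=; exact: le_lt_trans r2|exact].
Qed.

Hypothesis HG : closed_strictly_positive_form G b c.

Lemma ash_cst D (a : R) : open D -> D `<=` G -> ash b c D (fun=> a%:E).
Proof.
move=> oD DG; right; have := ash_proper_affine HG a (fun=> 0%R) oD DG.
congr ash_proper; apply/funext => x; rewrite /affine big1 ?addr0// => i _; exact: mul0r.
Qed.

Lemma Uclass_scale E1 E2 D psi1 psi2 (m : R) u : open D -> D `<=` G -> (0 < m)%R ->
  E2 `<=` E1 -> (forall x, E2 x -> (m * psi1 x <= psi2 x)%R) ->
  Uclass b c E1 D psi1 u -> Uclass b c E2 D psi2 (fun x => m%:E * u x).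
Proof.
move=> oD DG m0 E21 le [au u0 up]; split.
- exact: (ash_scale HG oD DG m0 au).
- by move=> x /u0 ux; rewrite pmule_rlt0.
move=> x E2x; apply: (@le_trans _ _ (m%:E * (psi1 x)%:E)).
  by rewrite lee_pmul2l//; exact/up/E21.
by rewrite -EFinM lee_fin; exact: le.
Qed.

(** The lower bounds come from explicit competitors: the constant -1 in one class, the extension
    [psit] in the other. For the upper bounds, a smaller neighbourhood has a larger class, so the
    estimate known there also controls the rescaled competitors of the given neighbourhood. *)
Lemma loc_regular_pt_unit D K psi psit z : open D -> D `<=` G -> K `<=` D -> K z ->
  {within K, continuous psi} -> (forall x, K x -> (psi x < 0)%R) ->
  ash b c D psit -> (forall x, D x -> psit x < 0) ->
  (forall x, K x -> psit x = (psi x)%:E) ->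
  loc_regular_pt b c K D psi z <->
  forall B, nbhs z B -> B `<=` D -> omega_star b c (K `&` closure B) D (fun=> (-1)%R) z = -1.
Proof.
move=> oD DG KD Kz cpsi psi0 apsit psit0 psitE.
have Dz := KD z Kz; have p0 := psi0 z Kz.
split => [reg B zB BD|reg B zB].
  apply/eqP; rewrite eq_le; apply/andP; split; last first.
    apply: (@omega_star_ge (K `&` closure B) D (fun=> (-1)%R) (fun=> (-1)%:E)) => //.
    by split => //; exact: ash_cst.
  apply/lee_addgt0Pr => e e0.
  pose d : R := (- psi z * e)%R.
  have d0 : (0 < d)%R by rewrite mulr_gt0// oppr_gt0.
  have [B' [zB' B'B hB']] := small_neighborhood zB cpsi Kz d0.
  have m0 : (0 < - psi z + d)%R by rewrite addr_gt0// oppr_gt0.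
  have US u : Uclass b c (K `&` closure B) D (fun=> (-1)%R) u ->
      Uclass b c (K `&` closure B') D psi (fun x => (- psi z + d)%:E * u x).
    apply: Uclass_scale => //.
      by move=> x [Kx B'x]; split => //; exact: closure_subset B'x.
    move=> x [Kx B'x]; have := hB' x Kx B'x; rewrite mulrN1 ltr_norml => /andP[_].
    by lra.
  have := omega_star_scale m0 US; move=> /(_ z (psi z)); rewrite reg// => /(_ (lexx _)) /le_trans; apply.
  rewrite -EFinD lee_fin ler_pdivrMr// /d -subr_ge0.
  have -> : ((-1 + e) * (- psi z + - psi z * e) - psi z = (- psi z) * (e * e))%R by ring.
  by rewrite mulr_ge0// ?oppr_ge0 ltW// mulr_gt0.
apply/eqP; rewrite eq_le; apply/andP; split; last first.
  rewrite -psitE//; apply: omega_star_ge => //; split => //.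
  by move=> x [Kx _]; rewrite psitE.
have zBD : nbhs z (B `&` D) by apply: filterI => //; exact: open_nbhs_nbhs.
apply/lee_addgt0Pr => e e0.
(* The bound - psi z / 2 keeps the divisor - psi z - d positive. *)
pose d : R := (Num.min e (- psi z / 2))%R.
have d0 : (0 < d)%R by rewrite lt_min e0 divr_gt0// oppr_gt0.
have de : (d <= e)%R by rewrite ge_min lexx.
have dp : (d <= - psi z / 2)%R by rewrite ge_min lexx orbT.
have m0 : (0 < - psi z - d)%R by lra.
have [B' [zB' B'B hB']] := small_neighborhood zBD cpsi Kz d0.
have US u : Uclass b c (K `&` closure B) D psi u ->
    Uclass b c (K `&` closure B') D (fun=> (-1)%R) (fun x => (- psi z - d)^-1%:E * u x).
  apply: Uclass_scale => //; first by rewrite invr_gt0.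
    move=> x [Kx B'x]; split => //; move: B'x; apply: closure_subset.
    by move=> y /B'B[].
  move=> x [Kx B'x]; have := hB' x Kx B'x; rewrite ltr_norml => /andP[+ _].
  by rewrite mulrC ler_pdivrMr// mulN1r; lra.
have im0 : (0 < (- psi z - d)^-1)%R by rewrite invr_gt0.
have := omega_star_scale im0 US; move=> /(_ z (-1)%R); rewrite reg//; last by move=> y /B'B[].
move=> /(_ (lexx _)) /le_trans; apply.
by rewrite invrK -EFinD lee_fin; lra.
Qed.

End ExtremalFunction.

(** * From global to local regularity *)

Section GlobalToLocal.
Variables (R : realType) (n : nat).
Local Notation V := (Cn R n).
Local Notation T := (bCn R n).
Local Notation mu := (@leb R n).
Local Open Scope ereal_scope.
Variables (G : set V) (b c : 'I_n -> 'I_n -> V -> R).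
Hypothesis HG : closed_strictly_positive_form G b c.

Lemma sqnorm_ge (x : V) (r : R) : (0 <= r)%R -> (r <= `|x|)%R -> (r ^+ 2 <= sqnorm x)%R.
Proof.
move=> r0; apply: contraTT; rewrite -!ltNge => xr.
have r1 : (0 < r)%R.
  rewrite lt_def r0 andbT; apply: contraTneq xr => ->; rewrite expr0n /= -leNgt.
  by apply: sumr_ge0 => i _; exact: sqr_ge0.
apply/(norm_ltP _ r1) => i; rewrite -(@ltr_pXn2r _ 2) ?nnegrE//.
rewrite real_normK ?num_real//; apply: le_lt_trans xr.
by rewrite /sqnorm (bigD1 i)//= lerDl sumr_ge0// => j _; exact: sqr_ge0.
Qed.

(* Subtracting [eps |z|^2] and adding the affine function [eps (2 <z, z0> - |z0|^2)]. *)
Lemma recentered_ash (D : set V) (psit : V -> \bar R) (eps : R) (z0 : V) : (0 < n)%N ->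
  open D -> D `<=` G -> D z0 -> psit z0 \is a fin_num ->
  ash b c D (fun z => psit z - (eps * sqnorm z)%:E) ->
  ash_proper b c D (fun z => psit z - (eps * sqnorm (z - z0))%:E).
Proof.
move=> n0 oD DG Dz0 fz0 [H|H].
  by have := H z0 Dz0; move: fz0; case: (psit z0).
have := ash_proper_add HG n0 oD DG H
  (ash_proper_affine HG (- (eps * sqnorm z0)) (fun i => 2 * eps * z0 ord0 i)%R oD DG).
congr ash_proper; apply/funext => z; rewrite -addeA -EFinN -EFinD; congr (_ + _%:E).
rewrite /affine /sqnorm !mulr_sumr -!sumrN -!big_split /=; apply: eq_bigr => i _.
by rewrite !mxE; ring.
Qed.

(* [v = (1 - d) (psit - eps |z - z0|^2) + d u]: the quadratic term beats [d psi] off [B]. *)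
Lemma regular_pt_local (D K B : set V) (psi : V -> R) (psit : V -> \bar R) (eps : R) (z0 : V) :
  (0 < n)%N -> open D -> D `<=` G -> compact K -> K `<=` D -> K z0 -> nbhs z0 B ->
  {within K, continuous psi} -> (forall z, D z -> psit z < 0) ->
  (forall z, K z -> psit z = (psi z)%:E) -> (0 < eps)%R ->
  ash b c D (fun z => psit z - (eps * sqnorm z)%:E) ->
  omega_star b c K D psi z0 <= (psi z0)%:E ->
  omega_star b c (K `&` closure B) D psi z0 <= (psi z0)%:E.
Proof.
move=> n0 oD DG cK KD Kz0 zB cpsi psit0 psitE eps0 apsit omK.
have Dz0 := KD _ Kz0.
have fz0 : psit z0 \is a fin_num by rewrite psitE.
have aphi := recentered_ash n0 oD DG Dz0 fz0 apsit.
set phi := (fun z : V => psit z - (eps * sqnorm (z - z0))%:E) in aphi.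
have phi_le z : phi z <= psit z.
  rewrite /phi leeBlDr// leeDl// lee_fin mulr_ge0 ?(ltW eps0)//.
  by apply: sumr_ge0 => i _; exact: sqr_ge0.
have phiz0 : phi z0 = (psi z0)%:E.
  rewrite /phi subrr /sqnorm big1 ?mulr0 ?sube0 ?psitE// => i _.
  by rewrite mxE expr0n.
have /nbhs_ballP[rho /= rho0 hrho] := zB.
have [L0 [_ hL]] := compact_bounded (continuous_compact cpsi cK).
pose L := (`|L0| + 1)%R.
have L_gt0 : (0 < L)%R by rewrite ltr_wpDl.
have psiL z : K z -> (- L <= psi z)%R.
  move=> Kz; have : (`|psi z| <= L)%R.
    by apply: hL; [rewrite (le_lt_trans (ler_norm _))// ltrDl|exists z].
  by rewrite ler_norml => /andP[].
(* [L] bounds |psi| on [K]. The second bound gives d L <= eps rho^2 / 2, which the first, through 1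
   - d >= 1/2, makes at most (1 - d) eps rho^2. *)
pose d := (Num.min (1 / 2) (eps * rho ^+ 2 / (2 * L)))%R.
have d0 : (0 < d)%R.
  by rewrite lt_min divr_gt0//= divr_gt0 ?mulr_gt0// exprn_gt0.
have d2 : (d <= 1 / 2)%R by rewrite ge_min lexx.
have d1 : (0 < 1 - d)%R by lra.
have dL : (d * L <= (1 - d) * (eps * rho ^+ 2))%R.
  have h : (d * L <= eps * rho ^+ 2 / 2)%R.
    rewrite -ler_pdivlMr//; apply: (@le_trans _ _ (eps * rho ^+ 2 / (2 * L)))%R.
      by rewrite ge_min lexx orbT.
    by rewrite invfM mulrA.
  apply: (le_trans h); rewrite mulrC ler_pM2r ?mulr_gt0 ?exprn_gt0//; lra.
have comp u : Uclass b c (K `&` closure B) D psi u ->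
    Uclass b c K D psi (fun z => d%:E * u z + (1 - d)%:E * phi z).
  move=> [au u0 up]; split.
  - apply: (ash_add HG) => //; first exact: (ash_scale HG).
    by right; exact: (ash_proper_scale HG).
  - move=> z Dz; rewrite -(adde0 0) lteD//.
      by rewrite pmule_rlt0// u0.
    by rewrite pmule_rlt0// (le_lt_trans (phi_le z))// psit0.
  move=> z Kz; have [Bz|nBz] := pselect (closure B z).
    apply: (@le_trans _ _ (d%:E * (psi z)%:E + (1 - d)%:E * (psi z)%:E)).
      apply: leeD; rewrite lee_pmul2l//; first exact: up.
      by rewrite -psitE.
    by rewrite -!EFinM -EFinD lee_fin -mulrDl addrC subrK mul1r.
  have zr : (rho <= `|z - z0|)%R.
    rewrite leNgt; apply/negP => zr; apply: nBz; apply: subset_closure.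
    by apply: hrho; rewrite ball_CnE.
  have q := sqnorm_ge (ltW rho0) zr.
  have q' : (eps * rho ^+ 2 <= eps * sqnorm (z - z0))%R by rewrite ler_pM2l.
  apply: (@le_trans _ _ (0 + (1 - d)%:E * phi z)).
    by rewrite leeD2r// ltW// pmule_rlt0// u0//; exact: KD.
  rewrite add0e /phi psitE// -EFinB -EFinM lee_fin.
  have h1 : ((1 - d) * (eps * rho ^+ 2) <= (1 - d) * (eps * sqnorm (z - z0)))%R by rewrite ler_pM2l.
  have h2 : (d * - L <= d * psi z)%R by rewrite ler_pM2l// psiL.
  by lra.
(* Let m > psi z0 be the local value. Near [z0], d u stays below d (m + tau) and nearly reaches it
   somewhere, (1 - d) phi stays below (1 - d)(psi z0 + tau) and nearly reaches it at [z0], but their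
   sum is at most psi z0 + tau. This is incompatible with [deficit_sum]. *)
rewrite leNgt; apply/negP => big.
have [m mE] : exists m : R, omega_star b c (K `&` closure B) D psi z0 = m%:E.
  move: big (omega_star_le0 b c (K `&` closure B) D psi z0).
  by case: (omega_star _ _ _ _ _ _) => // m _ _; exists m.
move: big; rewrite mE lte_fin => big.
have [th [r1 [C [[th0 th1 r10 C0] def]]]] := deficit_sum HG n0 (DG _ Dz0).
pose g := (d * (m - psi z0))%R.
have g0 : (0 < g)%R by rewrite mulr_gt0// subr_gt0.
(* The deficits add up to (1 + d) tau, and C (1 + d) tau = (1 + d) g / 3 is less than g because d <=
   1/2. *)
pose tau := (g / (3 * C))%R.
have tau0 : (0 < tau)%R by rewrite divr_gt0// mulr_gt0.
have [rB rB0 hB] : exists2 r : R, (0 < r)%R & forall u w,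
    Uclass b c (K `&` closure B) D psi u -> D w -> (`|w - z0| < r)%R -> u w < (m + tau)%:E.
  by apply: omega_star_lt; rewrite mE lte_fin ltrDl.
have [rK rK0 hK] : exists2 r : R, (0 < r)%R & forall u w,
    Uclass b c K D psi u -> D w -> (`|w - z0| < r)%R -> u w < (psi z0 + tau)%:E.
  by apply: omega_star_lt; apply: (le_lt_trans omK); rewrite lte_fin ltrDl.
have [_ [_ uphi _] _] := aphi.
have H : nbhs z0 (fun y => D y /\ phi y < (psi z0 + tau)%:E).
  apply: filterI; first exact: open_nbhs_nbhs.
  by apply: uphi => //; rewrite phiz0 lte_fin ltrDl.
have /nbhs_ballP[rD /= rD0 hD] := H.
pose r := (Num.min (Num.min rB rK) (Num.min (rD / 2) r1))%R.
have r0 : (0 < r)%R by rewrite !lt_min rB0 rK0 divr_gt0.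
have rrB : (r <= rB)%R by rewrite /r !ge_min lexx.
have rrK : (r <= rK)%R by rewrite /r !ge_min lexx !orbT.
have rr1 : (r <= r1)%R by rewrite /r !ge_min lexx !orbT.
have rrD : (r < rD)%R.
  apply: (@le_lt_trans _ _ (rD / 2)%R); first by rewrite /r !ge_min lexx !orbT.
  by rewrite ltr_pdivrMr// ltr_pMr// ltr1n.
have thr0 : (0 < th * r)%R by rewrite mulr_gt0.
have rD' y : (`|y - z0| < rD)%R -> D y /\ phi y < (psi z0 + tau)%:E.
  by move=> yz; apply: hD; rewrite ball_CnE.
(* The upper regularisation at [z0] is approached by values of competitors at nearby points, which
   need not be [z0]. *)
have [u [w [Uu Dw wz uw]]] : exists u w, [/\ Uclass b c (K `&` closure B) D psi u, D w,
    (`|w - z0| < th * r)%R & (m - tau)%:E < u w].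
  apply: contrapT => nex.
  have : omega_star b c (K `&` closure B) D psi z0 <= (m - tau)%:E.
    apply: (omega_star_le thr0) => u w Uu Dw wz; rewrite leNgt; apply/negP => uw.
    by apply: nex; exists u, w.
  by rewrite mE lee_fin lerBrDr gerDl leNgt tau0.
have au : ash_proper b c D u.
  have [[uN|//] _ _] := Uu; by rewrite (uN w Dw) in uw.
have [_ [u1 _ _] _] := aphi.
have := def r D (fun z => d%:E * u z) (fun z => (1 - d)%:E * phi z)
  (d * (m + tau))%R ((1 - d) * (psi z0 + tau))%R (d * (m - tau))%R ((1 - d) * psi z0)%R
  (psi z0 + tau)%R w z0 set0.
rewrite r0 rr1 subrr normr0 => /(_ isT oD DG).
have h1 : [set y | (`|y - z0| <= r)%R] `<=` D.
  by move=> y /= yz; have [] := rD' y (le_lt_trans yz rrD).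
have h2 x : (`|x - z0| < r)%R -> d%:E * u x <= (d * (m + tau))%:E.
  move=> xz; rewrite EFinM lee_pmul2l//; apply/ltW/hB => //; last exact: lt_le_trans xz rrB.
  by apply: h1; exact: ltW.
have h3 x : (`|x - z0| < r)%R -> (1 - d)%:E * phi x <= ((1 - d) * (psi z0 + tau))%:E.
  move=> xz; rewrite EFinM lee_pmul2l//; apply: ltW.
  by have [] := rD' x (lt_trans xz rrD).
have h4 : (d * (m - tau))%:E <= d%:E * u w by rewrite EFinM lee_pmul2l// ltW.
have h5 : ((1 - d) * psi z0)%:E <= (1 - d)%:E * phi z0 by rewrite phiz0 EFinM.
have thr : (th * r <= r)%R by rewrite ler_piMl// ltW.
have h6 x : (`|x - z0| < th * r)%R -> ~ (set0 : set T) x ->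
    d%:E * u x + (1 - d)%:E * phi x <= (psi z0 + tau)%:E.
  move=> xz _; apply: ltW; apply: (hK _ x (comp u Uu)).
    by apply: h1; apply/ltW/(lt_le_trans xz).
  exact: lt_le_trans (lt_le_trans xz thr) rrK.
move=> /(_ h1 (ash_proper_scale HG oD DG d0 au) (ash_proper_scale HG oD DG d1 aphi)
  h2 h3 wz h4 thr0 h5 measurable0 (measure0 _) h6).
have -> : (d * (m + tau) + (1 - d) * (psi z0 + tau) - (psi z0 + tau) = g)%R by rewrite /g; ring.
have -> : (d * (m + tau) - d * (m - tau) + ((1 - d) * (psi z0 + tau) - (1 - d) * psi z0)
   = (1 + d) * tau)%R by ring.
have -> : (C * ((1 + d) * tau) = (1 + d) / 3 * g)%R by rewrite /tau; field; rewrite gt_eqF.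
rewrite leNgt => /negP; apply.
by rewrite gtr_pMl// ltr_pdivrMr//; lra.
Qed.

End GlobalToLocal.

(** * The two characterisations of local regularity *)

Theorem theorem1p2 (R : realType) (n : nat) (Hn : (0 < n)%N)
  (G : set (Cn R n)) (b c : 'I_n -> 'I_n -> Cn R n -> R)
  (D K : set (Cn R n)) (psi : Cn R n -> R) :
  closed_strictly_positive_form G b c ->
  closure D `<=` G ->
  alpha_regular b c D ->
  compact K -> K `<=` D ->
  {within K, continuous psi} ->
  (forall z, K z -> psi z < 0) ->
  (exists psit : Cn R n -> \bar R,
      [/\ ash b c D psit, (forall z, D z -> (psit z < 0)%E)
        & forall z, K z -> psit z = (psi z)%:E]) ->
  (forall z0, K z0 ->
     (loc_regular_pt b c K D psi z0 <->
      (forall B : set (Cn R n), nbhs z0 B -> B `<=` D ->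
         omega_star b c (K `&` closure B) D (fun _ => -1) z0 = (-1)%E)))
  /\
  ((exists (Dplus : set (Cn R n)) (psit : Cn R n -> \bar R),
      [/\ open Dplus /\ closure D `<=` Dplus, Dplus `<=` G,
          strictly_ash b c Dplus psit,
          (forall z, K z -> psit z = (psi z)%:E)
        & (forall z, D z -> (psit z < 0)%E)]) ->
   forall z0, K z0 ->
     (loc_regular_pt b c K D psi z0 <-> regular_pt b c K D psi z0)).
Proof.
move=> HG DG [[M DM] [domD _]] cK KD cpsi psi0 [psit [apsit psit0 psitE]].
have [oD _ _] := domD.
have DG' : D `<=` G by move=> z /(@subset_closure _ D) /DG.
split=> [z0 Kz0|[Dp [phi [[_ DDp] _ sphi phiE phi0]]] z0 Kz0].
  exact: (loc_regular_pt_unit HG oD DG' KD Kz0 cpsi psi0 apsit psit0 psitE).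
split=> [reg|reg B zB].
  (* The neighbourhood is taken to be the whole space. *)
  by rewrite /regular_pt -(setIT K) -closureT; apply: reg; exact: filterT.
have cD : compact (closure D).
  apply: (subclosed_compact _ (@compact_closed_ball_Cn R n 0 M)); first exact: closed_closure.
  rewrite ((closure_id _).1 (compact_closedV (@compact_closed_ball_Cn R n 0 M))).
  by apply: closure_subset => z Dz; rewrite /= subr0 DM.
(* [D] itself serves as the relatively compact subdomain of [Dp], its closure being closed and
   bounded. *)
have [eps eps0 aphi] := sphi D domD cD DDp.
apply/eqP; rewrite eq_le; apply/andP; split.
  apply: (regular_pt_local HG Hn oD DG' cK KD Kz0 zB cpsi phi0 phiE eps0 aphi).
  by rewrite reg.
(* The competitor for the lower bound is the negative subharmonic extension [psit] on [D], not the
   strict one. *)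
rewrite -psitE//; apply: omega_star_ge; first exact: KD.
by split => // x [Kx _]; rewrite psitE.
Qed.
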